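(* Let $L/k$ be a finite Galois extension with group $\Gamma$, let $T$ be an algebraic $k$-torus split over $L$ with character module $M$ of rank $n$, and let $A_Q=L_Q[M]^\Gamma$ be a quantum form of $T$, where $Q=(q_{ij})$ with $q_{ij}=\epsilon^{s_{ij}}$, $s_{ij}\in\mathbf Z/l\mathbf Z$, and $\epsilon\in L$ is a primitive root of unity of degree $l$. Let $\chi:Z_Q\to k$ be a homomorphism of $k$-algebras, where $Z_Q$ is the center of $A_Q$, and let $P_\chi$, $P_{\chi,L}$, $P_\chi^{(l)}$, $P_{\chi,L}^{(l)}$ be the associated quotient algebras defined in the context. Then: 1) $P_\chi^{(l)}$ and $P_{\chi,L}^{(l)}$ are semisimple algebras, $P_\chi$ and $P_{\chi,L}$ are central simple algebras (over $k$ and $L$ respectively), and $P_{\chi,L}$ is a polycyclic algebra; 2) $P_\chi^{(l)}\otimes_kL=P_{\chi,L}^{(l)}$ and $P_\chi\otimes_kL=P_{\chi,L}$.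
   Context: For a matrix $Q=(q_{ij})_{i,j=1}^n$ with $q_{ij}\in L^*$, $q_{ij}q_{ji}=q_{ii}=1$, $L_Q[M]=L_Q[x_1^{\pm1},\dots,x_n^{\pm1}]$ denotes the $L$-algebra generated by $x_1^{\pm1},\dots,x_n^{\pm1}$ with relations $x_ix_j=q_{ij}x_jx_i$. Here $M$ is the character group of $T$, free abelian of rank $n$ with $\Gamma$-action, and $t_1,\dots,t_n$ is a basis of $M$, so $L[T]=L[t_1^{\pm1},\dots,t_n^{\pm1}]$. A quantum form of $T$ is a $k$-algebra $A_Q$ such that (1) $A_Q\otimes_kL=L_Q[x_1^{\pm1},\dots,x_n^{\pm1}]$, and (2) there is a coaction $R:A_Q\to k[T]\otimes_kA_Q$ of the Hopf algebra $k[T]$ whose extension $R_L=R\otimes1$ to $L$ is the algebra homomorphism with $R_L(x_i)=t_i\otimes x_i$. The group $\Gamma$ acts on $L_Q[M]=A_Q\otimes_kL$ through the second factor and $A_Q=L_Q[M]^\Gamma$. Centers: $Z_Q[M]$ is the center of $L_Q[M]$; it satisfies $Z_Q[M]=Z_Q\otimes_kL$. When the $q_{ij}$ are $l$-th roots of unity, put $Z_Q^{(l)}[M]=L[x_1^{\pm l},\dots,x_n^{\pm l}]\subseteq Z_Q[M]$ and $Z_Q^{(l)}=L[x_1^{\pm l},\dots,x_n^{\pm l}]^\Gamma\subseteq Z_Q$ (the $l$-center of $A_Q$); one has $Z_Q^{(l)}[M]=Z_Q^{(l)}\otimes_kL$. Quotients: given a $k$-algebra homomorphism $\chi:Z_Q\to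 k$, let $\chi_l$ be its restriction to $Z_Q^{(l)}$, and let $\chi_L:Z_Q[M]\to L$ and $\chi_{l,L}:Z_Q^{(l)}[M]\to L$ be the $L$-linear ($\Gamma$-equivariant) extensions of $\chi$ and $\chi_l$. Define $P_{\chi,L}=L_Q[M]/\mathrm{Ker}\,\chi_L$, $P_{\chi,L}^{(l)}=L_Q[M]/\mathrm{Ker}\,\chi_{l,L}$, $P_\chi=A_Q/\mathrm{Ker}\,\chi$, $P_\chi^{(l)}=A_Q/\mathrm{Ker}\,\chi_l$, where in each case one factors by the two-sided ideal generated by the indicated kernel. Cyclic and polycyclic algebras: for $a,b\in L^*$ and $d\ge1$, the cyclic algebra $C_d(a,b)$ is the $L$-algebra generated by $x,y$ with relations $x^d=a$, $y^d=b$, $xy=\omega yx$, where $\omega\in L$ is a primitive root of unity of degree $d$. A polycyclic algebra is a tensor product over $L$ of finitely many cyclic algebras (possibly of different degrees $d$). *)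

(* Defs.v *)
From HB Require Import structures.
From mathcomp Require Import all_boot all_order all_algebra all_fingroup all_field.
From mathcomp Require Import generic_quotient ring_quotient boolp.

Set Implicit Arguments.
Unset Strict Implicit.
Unset Printing Implicit Defensive.

Import GRing.Theory.
Local Open Scope ring_scope.
Local Open Scope quotient_scope.

Definition bilin (R : pzRingType) (U V W : lmodType R) (f : U -> V -> W) :=
  (forall u, linear (f u)) /\ (forall v, linear (f^~ v)).

(* Tensor products: formal finite sums of pairs (u, v), two of them being
   identified when no bilinear map separates them. *)

Section Tensor.
Variables (R : comNzRingType) (U V : lmodType R).

Definition fsum (W : zmodType) (f : U -> V -> W) (s : seq (U * V)) : W :=
  \sum_(p <- s) f p.1 p.2.

Definition tens_rel (s t : seq (U * V)) : bool :=
  `[< forall (W : lmodType R) (f : U -> V -> W), bilin f ->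
        fsum f s = fsum f t >].

Lemma tens_rel_equiv : equiv_class_of tens_rel.
Proof.
split=> [s|s t|t s u].
- by apply/asboolP.
- by apply/asboolP/asboolP=> h W f /h.
- move=> /asboolP h1 /asboolP h2; apply/asboolP=> W f bf.
  by rewrite (h1 W f bf) (h2 W f bf).
Qed.

Canonical tens_equiv := EquivRelPack tens_rel_equiv.
Canonical tens_encModRel := defaultEncModRel tens_rel.

Definition tens := {eq_quot tens_rel}.
HB.instance Definition _ := Choice.on tens.
HB.instance Definition _ : EqQuotient _ tens_rel tens := EqQuotient.on tens.

Definition tpi (s : seq (U * V)) : tens := \pi_tens s.

(* The factorization of f through the tensor product; meaningful when f is
   biadditive and balanced over R, in particular when f is bilinear, possibly
   into a module over an extension of R. *)
Definition tlift (W : zmodType) (f : U -> V -> W) (x : tens) : W :=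
  fsum f (repr x).

Definition pure (u : U) (v : V) : tens := tpi [:: (u, v)].

Lemma tlift_pi (W : lmodType R) (f : U -> V -> W) s :
  bilin f -> tlift f (tpi s) = fsum f s.
Proof.
move=> bf; have /eqmodP/asboolP/(_ W f bf) : repr (tpi s) = s %[mod tens].
  by rewrite reprK.
exact.
Qed.

Lemma tens_ext (x y : tens) :
  (forall (W : lmodType R) (f : U -> V -> W), bilin f ->
     tlift f x = tlift f y) -> x = y.
Proof.
move=> h; rewrite -[x]reprK -[y]reprK; apply/eqmodP/asboolP=> W f bf.
exact: h.
Qed.

Definition tzero : tens := tpi [::].
Definition tadd (x y : tens) : tens := tpi (repr x ++ repr y).
Definition topp (x : tens) : tens := tpi [seq (- p.1, p.2) | p <- repr x].
Definition tscale (c : R) (x : tens) : tens :=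
  tpi [seq (c *: p.1, p.2) | p <- repr x].

Section Ops.
Variables (W : lmodType R) (f : U -> V -> W).
Hypothesis bf : bilin f.

Lemma bilinZDl c u u' v : f (c *: u + u') v = c *: f u v + f u' v.
Proof. exact: bf.2. Qed.
Lemma bilinZDr c u v v' : f u (c *: v + v') = c *: f u v + f u v'.
Proof. exact: bf.1. Qed.
Lemma bilinDl u u' v : f (u + u') v = f u v + f u' v.
Proof. by rewrite -[u]scale1r bilinZDl !scale1r. Qed.
Lemma bilinDr u v v' : f u (v + v') = f u v + f u v'.
Proof. by rewrite -[v]scale1r bilinZDr !scale1r. Qed.
Lemma bilin0l v : f 0 v = 0.
Proof. by apply: (addrI (f 0 v)); rewrite -bilinDl !addr0. Qed.
Lemma bilin0r u : f u 0 = 0.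
Proof. by apply: (addrI (f u 0)); rewrite -bilinDr !addr0. Qed.
Lemma bilinZl c u v : f (c *: u) v = c *: f u v.
Proof. by rewrite -[c *: u]addr0 bilinZDl bilin0l addr0. Qed.
Lemma bilinZr c u v : f u (c *: v) = c *: f u v.
Proof. by rewrite -[c *: v]addr0 bilinZDr bilin0r addr0. Qed.
Lemma bilinNl u v : f (- u) v = - f u v.
Proof. by rewrite -scaleN1r bilinZl scaleN1r. Qed.

Lemma tlift0 : tlift f tzero = 0.
Proof. by rewrite tlift_pi // /fsum big_nil. Qed.
Lemma tliftD x y : tlift f (tadd x y) = tlift f x + tlift f y.
Proof. by rewrite tlift_pi // /fsum big_cat. Qed.
Lemma tliftN x : tlift f (topp x) = - tlift f x.
Proof.
by rewrite tlift_pi // /fsum big_map -sumrN; apply: eq_bigr=> p _; exact: bilinNl.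
Qed.
Lemma tliftZ c x : tlift f (tscale c x) = c *: tlift f x.
Proof.
rewrite tlift_pi // /fsum big_map scaler_sumr; apply: eq_bigr=> p _.
exact: bilinZl.
Qed.
Lemma tlift_pure u v : tlift f (pure u v) = f u v.
Proof. by rewrite tlift_pi // /fsum big_seq1. Qed.
End Ops.

Lemma taddA : associative tadd.
Proof. by move=> x y z; apply: tens_ext=> W f bf; rewrite !tliftD // addrA. Qed.
Lemma taddC : commutative tadd.
Proof. by move=> x y; apply: tens_ext=> W f bf; rewrite !tliftD // addrC. Qed.
Lemma tadd0 : left_id tzero tadd.
Proof. by move=> x; apply: tens_ext=> W f bf; rewrite tliftD // tlift0 // add0r. Qed.
Lemma taddN : left_inverse tzero topp tadd.
Proof.
by move=> x; apply: tens_ext=> W f bf; rewrite tliftD // tliftN // tlift0 // addNr.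
Qed.
HB.instance Definition _ := GRing.isZmodule.Build tens taddA taddC tadd0 taddN.

Lemma tscaleA a b x : tscale a (tscale b x) = tscale (a * b) x.
Proof. by apply: tens_ext=> W f bf; rewrite !tliftZ // scalerA. Qed.
Lemma tscale1 : left_id 1 tscale.
Proof. by move=> x; apply: tens_ext=> W f bf; rewrite tliftZ // scale1r. Qed.
Lemma tscaleDr : right_distributive tscale +%R.
Proof.
move=> a x y; apply: tens_ext=> W f bf.
by rewrite tliftZ // !tliftD // !tliftZ // scalerDr.
Qed.
Lemma tscaleDl x : {morph tscale^~ x : a b / a + b}.
Proof.
move=> a b; apply: tens_ext=> W f bf.
by rewrite tliftZ // tliftD // !tliftZ // scalerDl.
Qed.
HB.instance Definition _ := GRing.Zmodule_isLmodule.Build R tens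
  tscaleA tscale1 tscaleDr tscaleDl.

Lemma tlift_linear (W : lmodType R) (f : U -> V -> W) :
  bilin f -> linear (tlift f).
Proof. by move=> bf c x y; rewrite [LHS]tliftD // tliftZ. Qed.

Lemma eq_tlift (W : lmodType R) (f g : U -> V -> W) :
  (forall u v, f u v = g u v) -> tlift f =1 tlift g.
Proof. by move=> fg x; apply: eq_bigr. Qed.

Lemma tliftDf (W : lmodType R) c (f g : U -> V -> W) x :
  tlift (fun u v => c *: f u v + g u v) x = c *: tlift f x + tlift g x.
Proof. by rewrite /tlift /fsum big_split scaler_sumr. Qed.

Lemma pure_bilin : bilin pure.
Proof.
split=> [u|v] c a b; apply: tens_ext=> W f bf;
  rewrite [RHS]tliftD // tliftZ // !tlift_pure //.
  exact: bilinZDr.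
exact: bilinZDl.
Qed.

End Tensor.

Arguments tens {R} U V.
Arguments pure {R U V} u v.
Notation "u ⊗ v" := (pure u v) (at level 40, left associativity) : ring_scope.

Definition tmap (R : comNzRingType) (U V U' V' : lmodType R)
    (f : U -> U') (g : V -> V') : tens U V -> tens U' V' :=
  tlift (fun u v => f u ⊗ g v).

Definition tassoc (R : comNzRingType) (U V W : lmodType R) :
    tens (tens U V) W -> tens U (tens V W) :=
  tlift (fun x w => tlift (fun u v => u ⊗ (v ⊗ w)) x).

Section TensorAlgebra.
Variables (R : comNzRingType) (U V : algType R).
Local Notation T := (tens U V).

Definition tmul (x y : T) : T :=
  tlift (fun u v => tlift (fun u' v' => (u * u') ⊗ (v * v')) y) x.
Definition tone : T := 1 ⊗ 1.

Lemma mul_bilin_r u v (W : lmodType R) (f : U -> V -> W) :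
  bilin f -> bilin (fun u' v' => f (u * u') (v * v')).
Proof.
move=> bf; split=> [a|b] c x y.
  by rewrite mulrDr -scalerAr bilinZDr.
by rewrite mulrDr -scalerAr bilinZDl.
Qed.

Lemma mul_bilin_l (W : lmodType R) (f : U -> V -> W) y :
  bilin f -> bilin (fun u v => tlift (fun u' v' => f (u * u') (v * v')) y).
Proof.
move=> bf; split=> [a|b] c x z; rewrite -tliftDf; apply: eq_tlift=> u v.
  by rewrite mulrDl -scalerAl bilinZDr.
by rewrite mulrDl -scalerAl bilinZDl.
Qed.

Lemma tlift_tmul (W : lmodType R) (f : U -> V -> W) x y : bilin f ->
  tlift f (tmul x y)
  = tlift (fun u v => tlift (fun u' v' => f (u * u') (v * v')) y) x.
Proof.
move=> bf; have Ls (I : Type) (r : seq I) F :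
    tlift f (\sum_(i <- r) F i) = \sum_(i <- r) tlift f (F i).
  by apply: (big_morph (tlift f)) => [a b|]; [exact: tliftD|exact: tlift0].
transitivity (tlift f (\sum_(p <- repr x) \sum_(q <- repr y)
    ((p.1 * q.1) ⊗ (p.2 * q.2) : T))); first by [].
rewrite Ls; apply: eq_bigr=> p _; rewrite Ls; apply: eq_bigr=> r _.
exact: tlift_pure.
Qed.

Lemma tmulA : associative tmul.
Proof.
move=> x y z; apply: tens_ext=> W f bf; rewrite !tlift_tmul //; last first.
  exact: mul_bilin_l.
apply: eq_tlift=> u v; rewrite tlift_tmul; last exact: mul_bilin_r.
by apply: eq_tlift=> u' v'; apply: eq_tlift=> u'' v''; rewrite !mulrA.
Qed.

Lemma tmul1x : left_id tone tmul.
Proof.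
move=> x; apply: tens_ext=> W f bf; rewrite tlift_tmul // tlift_pure //.
  by apply: eq_tlift=> u v; rewrite !mul1r.
exact: mul_bilin_l.
Qed.

Lemma tmulx1 : right_id tone tmul.
Proof.
move=> x; apply: tens_ext=> W f bf; rewrite tlift_tmul //.
apply: eq_tlift=> u v; rewrite tlift_pure ?mulr1 //; exact: mul_bilin_r.
Qed.

Lemma tmulDl : left_distributive tmul +%R.
Proof.
move=> x y z; apply: tens_ext=> W f bf.
by rewrite tlift_tmul // !tliftD ?tlift_tmul //; exact: mul_bilin_l.
Qed.

Lemma tmulDr : right_distributive tmul +%R.
Proof.
move=> x y z; apply: tens_ext=> W f bf; rewrite tliftD // !tlift_tmul //.
rewrite -[tlift _ x in RHS]scale1r -tliftDf; apply: eq_tlift=> u v.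
by rewrite scale1r -tliftD //; exact: mul_bilin_r.
Qed.

HB.instance Definition _ := GRing.Zmodule_isPzRing.Build T
  tmulA tmul1x tmulx1 tmulDl tmulDr.

End TensorAlgebra.


(* The library's algType excludes the zero ring, so tensor products and
   quotients, not known in advance to be nonzero, only receive their module and
   ring structures; this notation covers them as well. *)
Notation alghom f := (linear f /\ monoid_morphism f).

(* Extension of scalars: phi : A -> B is k-semilinear into an L-module B, and
   the canonical map A ⊗_k L -> B is bijective. *)

Section BaseChange.
Variables (k : fieldType) (L : fieldExtType k).

Definition semilinear_over (A : lmodType k) (B : lmodType L) (phi : A -> B) :=
  forall (c : k) (a b : A), phi (c *: a + b) = (c%:A : L) *: phi a + phi b.

Definition extmap (A : lmodType k) (B : lmodType L) (phi : A -> B) :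
    tens A L -> B :=
  tlift (fun a c => c *: phi a).

Definition base_change (A : lmodType k) (B : lmodType L) (phi : A -> B) :=
  semilinear_over phi /\ bijective (extmap phi).

End BaseChange.

(* B is the R-algebra presented by the generators x and the relations rel.
   Omitting the zero algebra among the targets C is harmless: every B has
   exactly one morphism to it. *)
Definition presented_by (R : comNzRingType) (G : Type)
    (rel : forall C : algType R, (G -> C) -> Prop)
    (B : algType R) (x : G -> B) : Prop :=
  rel B x /\
  forall (C : algType R) (u : G -> C), rel C u ->
    exists f : {lrmorphism B -> C}, (forall g, f (x g) = u g) /\
      forall f' : {lrmorphism B -> C}, (forall g, f' (x g) = u g) -> f' =1 f.

(* The generator inl i is x_i and inr i is its inverse. *)
Definition qtorus_rel (L : fieldType) (n : nat) (q : 'M[L]_n) (C : algType L)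
    (x : 'I_n + 'I_n -> C) : Prop :=
  (forall i, x (inl i) * x (inr i) = 1 /\ x (inr i) * x (inl i) = 1) /\
  (forall i j, x (inl i) * x (inl j) = q i j *: (x (inl j) * x (inl i))).

Definition is_qtorus (L : fieldType) (n : nat) (q : 'M[L]_n) (B : algType L)
    (x : 'I_n + 'I_n -> B) : Prop :=
  presented_by (qtorus_rel q) x.

Section Hopf.
Variables (k : fieldType) (H : algType k).
Variables (comul : H -> tens H H) (counit : H -> k^o) (antipode : H -> H).

Definition hopf_algebra : Prop :=
  [/\ alghom comul, alghom counit & linear antipode] /\
  [/\ forall h, tassoc (tmap comul id (comul h)) = tmap id comul (comul h),
      forall h, tlift (fun a b => counit a *: b) (comul h) = h,
      forall h, tlift (fun a b => counit b *: a) (comul h) = h,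
      forall h, tlift (fun a b => antipode a * b) (comul h) = counit h *: 1
    & forall h, tlift (fun a b => a * antipode b) (comul h) = counit h *: 1].

Definition coaction (A : lmodType k) (rho : A -> tens H A) : Prop :=
  [/\ linear rho,
      forall a, tassoc (tmap comul id (rho a)) = tmap id rho (rho a)
    & forall a, tlift (fun h b => counit h *: b) (rho a) = a].

End Hopf.

(* A torus T over k of rank n split over L, given by its coordinate Hopf
   algebra k[T] and a basis t_1, ..., t_n of its characters over L, that is, by
   group-like elements making L[T] the Laurent polynomial algebra. *)
Record torus_split_by (k : fieldType) (L : fieldExtType k) (n : nat) := SplitTorus {
  t_alg : comAlgType k;
  t_comul : t_alg -> tens t_alg t_alg;
  t_counit : t_alg -> k^o;
  t_antipode : t_alg -> t_alg;
  t_hopf : hopf_algebra t_comul t_counit t_antipode;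
  t_algL : algType L;
  t_char : 'I_n + 'I_n -> t_algL;
  t_charP : is_qtorus (const_mx 1) t_char;
  t_inc : t_alg -> t_algL;
  t_incM : monoid_morphism t_inc;
  t_incP : base_change t_inc;
  t_comulL : t_algL -> tens t_algL t_algL;
  t_comulL_alghom : alghom t_comulL;
  t_comulL_ext : forall h, t_comulL (t_inc h)
    = tlift (fun a b => t_inc a ⊗ t_inc b) (t_comul h);
  t_comulL_char : forall i,
    t_comulL (t_char (inl i)) = t_char (inl i) ⊗ t_char (inl i)
}.

(* A quantum form A_Q of T; qf_algL is L_Q[M] = A_Q ⊗_k L. *)
Record quantum_form (k : fieldType) (L : fieldExtType k) (n : nat)
    (T : torus_split_by L n) (q : 'M[L]_n) := QuantumForm {
  qf_alg : algType k;
  qf_algL : algType L;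
  qf_gen : 'I_n + 'I_n -> qf_algL;
  qf_genP : is_qtorus q qf_gen;
  qf_inc : qf_alg -> qf_algL;
  qf_incM : monoid_morphism qf_inc;
  qf_incP : base_change qf_inc;
  qf_coact : qf_alg -> tens (t_alg T) qf_alg;
  qf_coactP : coaction (@t_comul _ _ _ T) (@t_counit _ _ _ T) qf_coact;
  qf_coactL : qf_algL -> tens (t_algL T) qf_algL;
  qf_coactL_alghom : alghom qf_coactL;
  qf_coactL_ext : forall a, qf_coactL (qf_inc a)
    = tlift (fun h b => t_inc h ⊗ qf_inc b) (qf_coact a);
  qf_coactL_gen : forall i,
    qf_coactL (qf_gen (inl i)) = t_char T (inl i) ⊗ qf_gen (inl i)
}.

Section Center.
Variables (R : comNzRingType) (A : algType R).

Definition center : {pred A} := fun z => `[< forall a, z * a = a * z >].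

Lemma centerP z : reflect (forall a, z * a = a * z) (z \in center).
Proof. exact: asboolP. Qed.

Lemma center_subalg : subalg_closed center.
Proof.
split=> [|c u v /centerP hu /centerP hv|u v /centerP hu /centerP hv];
  apply/centerP=> a.
- by rewrite mul1r mulr1.
- by rewrite mulrDl mulrDr -scalerAl -scalerAr hu hv.
- by rewrite -mulrA hv mulrA hu mulrA.
Qed.
HB.instance Definition _ := GRing.isSubalgClosed.Build R A center center_subalg.

Record centerT := CenterT { center_val : A; _ : center_val \in center }.
HB.instance Definition _ := [isSub for center_val].
HB.instance Definition _ := [Choice of centerT by <:].
HB.instance Definition _ := [SubChoice_isSubAlgebra of centerT by <:].
End Center.

Section GeneratedSubalgebra.
Variables (R : comNzRingType) (A : algType R) (X : A -> Prop).

Definition gen_subalg : {pred A} := fun a =>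
  `[< forall S : {pred A}, subalg_closed S -> (forall x, X x -> x \in S) ->
        a \in S >].

Lemma gen_subalg_subalg : subalg_closed gen_subalg.
Proof.
split=> [|c u v /asboolP hu /asboolP hv|u v /asboolP hu /asboolP hv];
  apply/asboolP=> S SS XS; have [S1 SZ SM] := SS.
- exact: S1.
- by apply: SZ; [apply: hu|apply: hv].
- by apply: SM; [apply: hu|apply: hv].
Qed.
HB.instance Definition _ :=
  GRing.isSubalgClosed.Build R A gen_subalg gen_subalg_subalg.

Record gen_subalgT := GenSubalg { gen_val : A; _ : gen_val \in gen_subalg }.
HB.instance Definition _ := [isSub for gen_val].
HB.instance Definition _ := [Choice of gen_subalgT by <:].
HB.instance Definition _ := [SubChoice_isSubAlgebra of gen_subalgT by <:].
End GeneratedSubalgebra.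

Definition left_ideal (P : pzRingType) (I : P -> Prop) : Prop :=
  [/\ I 0, forall a b, I a -> I b -> I (a - b) & forall p a, I a -> I (p * a)].

Definition two_sided_ideal (P : pzRingType) (I : P -> Prop) : Prop :=
  left_ideal I /\ forall a p, I a -> I (a * p).

(* quo X is the quotient of A by the two-sided ideal generated by X. *)

Section IdealQuotient.
Variables (R : comNzRingType) (A : algType R) (X : A -> Prop).

Definition gen_ideal : {pred A} := fun a =>
  `[< forall I : A -> Prop, two_sided_ideal I -> (forall x, X x -> I x) ->
        I a >].

Lemma gen_ideal_zmod : zmod_closed gen_ideal.
Proof.
split=> [|a b /asboolP ha /asboolP hb]; apply/asboolP=> I iI XI;
  have [[I0 IB _] _] := iI => //.
by apply: IB; [apply: ha|apply: hb].
Qed.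
HB.instance Definition _ := GRing.isZmodClosed.Build A gen_ideal gen_ideal_zmod.

Lemma gen_idealMl p a : a \in gen_ideal -> p * a \in gen_ideal.
Proof.
move=> /asboolP ha; apply/asboolP=> I iI XI; have [[_ _ IM] _] := iI.
by apply: IM; apply: ha.
Qed.
Lemma gen_idealMr p a : a \in gen_ideal -> a * p \in gen_ideal.
Proof.
move=> /asboolP ha; apply/asboolP=> I iI XI; have [_ IM] := iI.
by apply: IM; apply: ha.
Qed.
Lemma gen_idealZ (c : R) a : a \in gen_ideal -> c *: a \in gen_ideal.
Proof. by rewrite -[a in c *: a]mul1r scalerAl; apply: gen_idealMl. Qed.

Definition quo := Quotient.quot gen_ideal.
HB.instance Definition _ := GRing.Zmodule.on quo.

Definition quo_pi (a : A) : quo := \pi_(Quotient.quot gen_ideal) a.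

Lemma quo_eq a b : (quo_pi a = quo_pi b) <-> a - b \in gen_ideal.
Proof. by rewrite Quotient.idealrBE; split=> [h|/eqP //]; apply/eqP; exact: h. Qed.
Lemma quo_repr (x : quo) : quo_pi (repr x) = x.
Proof. exact: reprK. Qed.
Lemma quo_piD a b : quo_pi (a + b) = quo_pi a + quo_pi b.
Proof. by rewrite /quo_pi raddfD. Qed.

Definition quo_one : quo := quo_pi 1.
Definition quo_mul (x y : quo) : quo := quo_pi (repr x * repr y).
Definition quo_scale (c : R) (x : quo) : quo := quo_pi (c *: repr x).

Lemma quo_piM a b : quo_pi (a * b) = quo_mul (quo_pi a) (quo_pi b).
Proof.
apply/quo_eq; set a' := repr _; set b' := repr _.
have ha : a - a' \in gen_ideal by apply/quo_eq; rewrite quo_repr.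
have hb : b - b' \in gen_ideal by apply/quo_eq; rewrite quo_repr.
have -> : a * b - a' * b' = (a - a') * b + a' * (b - b').
  by rewrite mulrBl mulrBr addrA subrK.
by apply: rpredD; [apply: gen_idealMr|apply: gen_idealMl].
Qed.
Lemma quo_piZ c a : quo_pi (c *: a) = quo_scale c (quo_pi a).
Proof.
apply/quo_eq; rewrite -scalerBr; apply: gen_idealZ.
by apply/quo_eq; rewrite quo_repr.
Qed.

Lemma quo_mulA : associative quo_mul.
Proof.
move=> x y z; rewrite -[x]quo_repr -[y]quo_repr -[z]quo_repr.
by rewrite -!quo_piM mulrA.
Qed.
Lemma quo_mul1x : left_id quo_one quo_mul.
Proof. by move=> x; rewrite -[x]quo_repr -quo_piM mul1r. Qed.
Lemma quo_mulx1 : right_id quo_one quo_mul.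
Proof. by move=> x; rewrite -[x]quo_repr -quo_piM mulr1. Qed.
Lemma quo_mulDl : left_distributive quo_mul +%R.
Proof.
move=> x y z; rewrite -[x]quo_repr -[y]quo_repr -[z]quo_repr.
by rewrite -quo_piD -!quo_piM -quo_piD mulrDl.
Qed.
Lemma quo_mulDr : right_distributive quo_mul +%R.
Proof.
move=> x y z; rewrite -[x]quo_repr -[y]quo_repr -[z]quo_repr.
by rewrite -quo_piD -!quo_piM -quo_piD mulrDr.
Qed.
HB.instance Definition _ := GRing.Zmodule_isPzRing.Build quo
  quo_mulA quo_mul1x quo_mulx1 quo_mulDl quo_mulDr.

Lemma quo_scaleA a b x : quo_scale a (quo_scale b x) = quo_scale (a * b) x.
Proof. by rewrite -[x]quo_repr -!quo_piZ scalerA. Qed.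
Lemma quo_scale1 : left_id 1 quo_scale.
Proof. by move=> x; rewrite -[x]quo_repr -quo_piZ scale1r. Qed.
Lemma quo_scaleDr : right_distributive quo_scale +%R.
Proof.
move=> a x y; rewrite -[x]quo_repr -[y]quo_repr.
by rewrite -quo_piD -!quo_piZ -quo_piD scalerDr.
Qed.
Lemma quo_scaleDl x : {morph quo_scale^~ x : a b / a + b}.
Proof. by move=> a b; rewrite -[x]quo_repr -!quo_piZ -quo_piD scalerDl. Qed.
HB.instance Definition _ := GRing.Zmodule_isLmodule.Build R quo
  quo_scaleA quo_scale1 quo_scaleDr quo_scaleDl.

End IdealQuotient.

(* The left regular module is semisimple: every submodule is a direct summand. *)
Definition semisimple (P : pzRingType) : Prop :=
  forall I : P -> Prop, left_ideal I ->
  exists J : P -> Prop,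
    [/\ left_ideal J, forall a, I a -> J a -> a = 0
      & forall a, exists b c, [/\ I b, J c & a = b + c]].

(* The algebra structure of the ring P over the field F is given here by the
   scalar map c |-> c *: 1. *)
Definition central_simple (F : fieldType) (P : pzRingType) (scal : F -> P) :=
  [/\ exists s : seq P, forall p, exists c : nat -> F,
        p = \sum_(i < size s) scal (c i) * s`_i,
      forall z : P, (forall p, z * p = p * z) -> exists c, z = scal c,
      (1 : P) <> 0
    & forall I : P -> Prop, two_sided_ideal I ->
        (forall p, I p -> p = 0) \/ (forall p, I p)].

Definition cyclic_rel (L : fieldType) (d : nat) (a b w : L) (C : algType L)
    (x : bool -> C) : Prop :=
  [/\ x true ^+ d = a%:A, x false ^+ d = b%:A
    & x true * x false = w *: (x false * x true)].

Definition is_cyclic_algebra (L : fieldType) (C : algType L) : Prop :=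
  exists (d : nat) (a b w : L) (x : bool -> C),
    [/\ (0 < d)%N, a != 0, b != 0, d.-primitive_root w
      & presented_by (cyclic_rel d a b w) x].

Inductive polycyclic (L : fieldType) (P : algType L) : Prop :=
| polycyclic_cyclic of is_cyclic_algebra P
| polycyclic_tens (D C : algType L) (h : tens D C -> P) of
    polycyclic D & is_cyclic_algebra C & alghom h & bijective h.

Section Forms.
Variables (k : fieldType) (L : splittingFieldType k) (n : nat).
Variables (T : torus_split_by L n) (q : 'M[L]_n) (A : quantum_form T q) (l : nat).

(* Z_Q^(l)[M]: the powers taken are x_i ^ l and x_i ^ -l. *)
Definition lcenterL := gen_subalgT (fun b : qf_algL A =>
  exists g, b = qf_gen A g ^+ l).

(* Invariance under the action of the Galois group on L_Q[M] = A_Q ⊗_k L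
   through the second factor. *)
Definition gal_invariant (b : qf_algL A) : Prop :=
  forall s : gal_of {:L}, s \in 'Gal({:L} / 1)%g ->
  forall t, extmap (@qf_inc k L n T q A) t = b ->
    extmap (@qf_inc k L n T q A) (tmap id s t) = b.

(* Z_Q^(l), where A_Q is identified with its image in L_Q[M]. *)
Definition lcenter (a : qf_alg A) : Prop :=
  gal_invariant (qf_inc a) /\ exists w : lcenterL, gen_val w = qf_inc a.

Variables (chi : centerT (qf_alg A) -> k).
Variables (chiL : centerT (qf_algL A) -> L) (chilL : lcenterL -> L).

(* chiL extends chi. *)
Definition extends_chi : Prop :=
  forall (z : centerT (qf_alg A)) (w : centerT (qf_algL A)),
    center_val w = qf_inc (center_val z) -> chiL w = (chi z)%:A.

(* chilL extends the restriction chi_l of chi to Z_Q^(l). *)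
Definition extends_chi_l : Prop :=
  forall (z : centerT (qf_alg A)) (w : lcenterL),
    lcenter (center_val z) -> gen_val w = qf_inc (center_val z) ->
    chilL w = (chi z)%:A.

(* The kernels of chi, chi_l, chi_L and chi_{l,L}, as subsets of A_Q and
   L_Q[M]. *)
Definition ker_chi (a : qf_alg A) : Prop :=
  exists2 z, center_val z = a & chi z = 0.
Definition ker_chi_l (a : qf_alg A) : Prop :=
  exists2 z, center_val z = a & lcenter a /\ chi z = 0.
Definition ker_chiL (b : qf_algL A) : Prop :=
  exists2 w, center_val w = b & chiL w = 0.
Definition ker_chi_lL (b : qf_algL A) : Prop :=
  exists2 w, gen_val w = b & chilL w = 0.

End Forms.

(* Main.v *)
Require Import Defs.
From HB Require Import structures.
From mathcomp Require Import all_boot all_order all_algebra all_fingroup all_field.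
From mathcomp Require Import generic_quotient boolp.

Set Implicit Arguments.
Unset Strict Implicit.
Unset Printing Implicit Defensive.

Import Order.TTheory GRing.Theory Num.Theory.
Local Open Scope ring_scope.

(* L_Q[M] is spanned by the group U generated by the x_i and the l-th roots of
   unity, and any two elements of U commute up to an l-th root of unity.  A
   subspace stable under conjugation by U is therefore spanned by the monomials
   it contains.  This gives the simplicity of P_{chi,L}, the triviality of its
   center, and, applied to L_Q[M] itself with coefficients in the kernel of
   chi_L, the fact that P_{chi,L} is not zero.  The algebra P^(l)_{chi,L} is
   spanned by the image of U, which is finite modulo L^*, of exponent l modulo
   L^*, and l is invertible in L: Maschke's averaging argument makes it
   semisimple.  As long as the commutators are not trivial, suitable powers of
   two elements of U generate a cyclic algebra that P_{chi,L} contains as a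
   tensor factor; its complement is the centralizer of these two elements, which
   is again spanned by monomials, so P_{chi,L} is polycyclic.

   The kernels of chi_L and chi_{l,L} are spanned by those of chi and chi_l: the
   center commutes with base change, and Z_Q^(l)[M] is handled by Galois descent.
   The latter needs the stability of L[x_i^l, x_i^-l] under the Galois group,
   which holds because an automorphism maps x_i to a unit, and the units of the
   quantum torus are the scalar multiples of the monomials.  Semisimplicity and central simplicity
   then descend from L to k along the linear maps A ⊗_k L -> A induced by the
   functionals L -> k. *)

(** * Tensor products and extension of scalars *)

(** The quantum torus is given by a presentation, so no basis of it is at hand; what comes for free
    is a spanning group of units. The notion [monomial_group] keeps just this: it asks for a
    spanning set and not for linear independence, and so it passes to quotients and to centralizers,
    where the same lemmas apply again. Independence is recovered where it is used: from the distinct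
    eigenvalues of conjugations in the cyclic case, and from a representation on functions on Z^n
    for the units of the torus. A functional L -> k cuts an element of A ⊗ L down to a slice in A.
    Slicing is A-linear on both sides, and a factor in L only changes the functional; this is how
    ideals and projections travel between A and A ⊗ L without a basis of A. Nonvanishing is at stake
    only for P_{chi,L}, from which P_chi inherits it; for P^(l) the zero ring would be semisimple as
    well. *)

Lemma inj_surj_bij (X Y : Type) (f : X -> Y) :
  injective f -> (forall y, exists x, f x = y) -> bijective f.
Proof.
move=> fI fS; have [g gK] := choice fS.
by exists g => // x; apply: fI; rewrite gK.
Qed.

Section TensorSums.
Variables (R : comNzRingType) (U V : lmodType R).

Lemma tlift_sum (W : lmodType R) (f : U -> V -> W) (I : Type) (r : seq I) F :
  bilin f -> tlift f (\sum_(i <- r) F i) = \sum_(i <- r) tlift f (F i).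
Proof.
by move=> bf; apply: (big_morph (tlift f)) => [x y|]; [apply: tliftD|apply: tlift0].
Qed.

Lemma pureDl (u u' : U) (v : V) : (u + u') ⊗ v = u ⊗ v + u' ⊗ v.
Proof. exact: (bilinDl (pure_bilin U V)). Qed.
Lemma pureDr (u : U) (v v' : V) : u ⊗ (v + v') = u ⊗ v + u ⊗ v'.
Proof. exact: (bilinDr (pure_bilin U V)). Qed.
Lemma pure0l (v : V) : (0 : U) ⊗ v = 0.
Proof. exact: (bilin0l (pure_bilin U V)). Qed.
Lemma pure0r (u : U) : u ⊗ (0 : V) = 0.
Proof. exact: (bilin0r (pure_bilin U V)). Qed.
Lemma pureZl c (u : U) (v : V) : (c *: u) ⊗ v = c *: (u ⊗ v).
Proof. exact: (bilinZl (pure_bilin U V)). Qed.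
Lemma pureZr c (u : U) (v : V) : u ⊗ (c *: v) = c *: (u ⊗ v).
Proof. exact: (bilinZr (pure_bilin U V)). Qed.
Lemma pure_suml (I : Type) (r : seq I) (F : I -> U) (v : V) :
  (\sum_(i <- r) F i) ⊗ v = \sum_(i <- r) F i ⊗ v.
Proof.
by apply: (big_morph (fun u => u ⊗ v)) => [x y|]; [apply: pureDl|apply: pure0l].
Qed.
Lemma pure_sumr (I : Type) (r : seq I) (F : I -> V) (u : U) :
  u ⊗ (\sum_(i <- r) F i) = \sum_(i <- r) u ⊗ F i.
Proof.
by apply: (big_morph (fun v => u ⊗ v)) => [x y|]; [apply: pureDr|apply: pure0r].
Qed.

Lemma tens_pures (x : tens U V) :
  exists s : seq (U * V), x = \sum_(p <- s) p.1 ⊗ p.2.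
Proof.
exists (repr x); apply: tens_ext => W f bf; rewrite tlift_sum //.
by apply: eq_bigr => p _; rewrite tlift_pure.
Qed.

End TensorSums.

Section RestrictedScalars.
Variables (k : fieldType) (L : fieldExtType k) (B : lmodType L).

(** Bilinear maps over k must take values in k-modules. With the action of k through L, [extmap]
    becomes the factorization of a k-bilinear map. *)
Definition restr : Type := B.
HB.instance Definition _ := GRing.Zmodule.on restr.

Definition restr_scale (c : k) (b : restr) : restr := (c%:A : L) *: (b : B).
Lemma restr_scaleA a b x :
  restr_scale a (restr_scale b x) = restr_scale (a * b) x.
Proof. by rewrite /restr_scale scalerA -scalerAl mul1r scalerA. Qed.
Lemma restr_scale1 : left_id 1 restr_scale.
Proof. by move=> x; rewrite /restr_scale !scale1r. Qed.
Lemma restr_scaleDr : right_distributive restr_scale +%R.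
Proof. by move=> a x y; rewrite /restr_scale scalerDr. Qed.
Lemma restr_scaleDl x : {morph restr_scale^~ x : a b / a + b}.
Proof. by move=> a b; rewrite /restr_scale scalerDl scalerDl. Qed.
HB.instance Definition _ := GRing.Zmodule_isLmodule.Build k restr
  restr_scaleA restr_scale1 restr_scaleDr restr_scaleDl.

End RestrictedScalars.

(** Coordinates in a k-basis of L: an element of A ⊗ L is determined by its slices along the f_i. *)
Lemma dual_basis (k : fieldType) (L : fieldExtType k) :
  exists (d : nat) (e : 'I_d -> L) (f : 'I_d -> {linear L -> k^o}),
    forall c, c = \sum_i f i c *: e i.
Proof.
pose e := vbasis {:L}.
have lin i : linear (fun c : L => coord e i c : k^o).
  by move=> a x y; rewrite linearP.
pose f i : {linear L -> k^o} := HB.pack (fun c : L => coord e i c : k^o)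
  (GRing.isLinear.Build _ _ _ _ _ (lin i)).
exists (\dim {:L}), (fun i => e`_i), f => c.
by rewrite [LHS](coord_vbasis (memvf c)).
Qed.

Section BaseChangeTools.
Variables (k : fieldType) (L : fieldExtType k) (A : lmodType k) (B : lmodType L).
Variable phi : A -> B.
Hypothesis phiL : semilinear_over phi.

Lemma semilinD a b : phi (a + b) = phi a + phi b.
Proof. by have := phiL 1 a b; rewrite !scale1r. Qed.
Lemma semilin0 : phi 0 = 0.
Proof. by apply: (addrI (phi 0)); rewrite -semilinD !addr0. Qed.
Lemma semilinZ c a : phi (c *: a) = (c%:A : L) *: phi a.
Proof. by have := phiL c a 0; rewrite semilin0 !addr0. Qed.
Lemma semilinN a : phi (- a) = - phi a.
Proof. by apply/eqP; rewrite -addr_eq0 -semilinD addNr semilin0. Qed.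
Lemma semilinB a b : phi (a - b) = phi a - phi b.
Proof. by rewrite semilinD semilinN. Qed.
Lemma semilin_sum (I : Type) (r : seq I) (F : I -> A) :
  phi (\sum_(i <- r) F i) = \sum_(i <- r) phi (F i).
Proof. by apply: (big_morph phi) => [x y|]; [apply: semilinD|apply: semilin0]. Qed.

Lemma extmap_bilin :
  bilin (fun (a : A) (c : L) => c *: phi a : restr B).
Proof.
split=> [a|c] d x y; rewrite /=.
  by rewrite scalerDl -[d *: x]mulr_algl -scalerA.
by rewrite phiL scalerDr scalerA mulrC -scalerA.
Qed.

Lemma extmap_pure a c : extmap phi (a ⊗ c) = c *: phi a.
Proof. exact: (tlift_pure extmap_bilin). Qed.
Lemma extmap_sum (I : Type) (r : seq I) F :
  extmap phi (\sum_(i <- r) F i) = \sum_(i <- r) extmap phi (F i).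
Proof. exact: (tlift_sum r F extmap_bilin). Qed.
Lemma extmapB x y : extmap phi (x - y) = extmap phi x - extmap phi y.
Proof.
apply/eqP; rewrite eq_sym subr_eq; apply/eqP.
by rewrite -[x in LHS](subrK y); apply: (tliftD extmap_bilin).
Qed.

(** An element of A ⊗ L is the sum of its slices along f_i tensored with e_i, so it vanishes once
    all its slices do. The second hypothesis says that the slices of a relation in B vanish in A. *)
Lemma base_change_of_slices :
  (forall b, exists s : seq (L * A), b = \sum_(p <- s) p.1 *: phi p.2) ->
  (forall s : seq (L * A), \sum_(p <- s) p.1 *: phi p.2 = 0 ->
     forall f : {linear L -> k^o}, \sum_(p <- s) f p.1 *: p.2 = 0) ->
  base_change phi.
Proof.
move=> gen ind; split=> //; apply: inj_surj_bij => [x y xy|b]; last first.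
  have [s ->] := gen b; exists (\sum_(p <- s) p.2 ⊗ p.1).
  by rewrite extmap_sum; apply: eq_bigr => p _; rewrite extmap_pure.
apply/eqP; rewrite -subr_eq0; apply/eqP.
have: extmap phi (x - y) = 0 by rewrite extmapB xy subrr.
have [s ->] := tens_pures (x - y); rewrite extmap_sum => s0.
have [d [e [f eL]]] := dual_basis L.
transitivity (\sum_i (\sum_(p <- s) f i p.2 *: p.1) ⊗ e i : tens A L).
  transitivity (\sum_(p <- s) \sum_i (f i p.2 *: p.1) ⊗ e i : tens A L).
    apply: eq_bigr => p _; rewrite {1}(eL p.2) pure_sumr; apply: eq_bigr => i _.
    by rewrite pureZl pureZr.
  by rewrite exchange_big; apply: eq_bigr => i _; rewrite pure_suml.
apply: big1 => i _; rewrite (_ : \sum_(p <- s) _ = 0) ?pure0l //.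
transitivity (\sum_(p <- [seq (p.2, p.1) | p <- s]) f i p.1 *: p.2).
  by rewrite big_map.
apply: ind; rewrite big_map -[RHS]s0; apply: eq_bigr => p _.
by rewrite extmap_pure.
Qed.

Hypothesis phiP : bijective (extmap phi).

Lemma base_change_span b :
  exists s : seq (L * A), b = \sum_(p <- s) p.1 *: phi p.2.
Proof.
have [g gK Kg] := phiP; have [s gb] := tens_pures (g b).
exists [seq (p.2, p.1) | p <- s].
rewrite big_map -{1}[b]Kg gb extmap_sum; apply: eq_bigr => p _.
by rewrite extmap_pure.
Qed.

(* The slice of b along f is its image under id ⊗ f : A ⊗_k L -> A. *)
Lemma slice_ex (f : {linear L -> k^o}) (b : B) : exists a : A,
  forall t, extmap phi t = b -> a = tlift (fun a c => f c *: a) t.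
Proof.
have [g gK Kg] := phiP; exists (tlift (fun a c => f c *: a) (g b)) => t <-.
by rewrite gK.
Qed.
Definition slice (f : {linear L -> k^o}) (b : B) : A := sval (cid (slice_ex f b)).

Lemma slice_bilin (f : {linear L -> k^o}) :
  bilin (fun (a : A) (c : L) => f c *: a).
Proof.
split=> [a|c] d x y /=; first by rewrite linearP scalerDl scalerA.
by rewrite scalerDr !scalerA mulrC.
Qed.

Lemma slice_sum (f : {linear L -> k^o}) (s : seq (L * A)) :
  slice f (\sum_(p <- s) p.1 *: phi p.2) = \sum_(p <- s) f p.1 *: p.2.
Proof.
rewrite /slice; case: cid => a /= aP.
rewrite (aP (\sum_(p <- s) p.2 ⊗ p.1)).
  rewrite tlift_sum; last exact: slice_bilin.
  by apply: eq_bigr => p _; rewrite tlift_pure //; exact: slice_bilin.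
by rewrite extmap_sum; apply: eq_bigr => p _; rewrite extmap_pure.
Qed.

Lemma sliceZ f c a : slice f (c *: phi a) = f c *: a.
Proof. by have := slice_sum f [:: (c, a)]; rewrite !big_seq1. Qed.

Lemma sliceD f b b' : slice f (b + b') = slice f b + slice f b'.
Proof.
have [s ->] := base_change_span b; have [s' ->] := base_change_span b'.
by rewrite -big_cat !slice_sum big_cat.
Qed.
Lemma slice0 f : slice f 0 = 0.
Proof. by apply: (addrI (slice f 0)); rewrite -sliceD !addr0. Qed.
Lemma sliceN f b : slice f (- b) = - slice f b.
Proof. by apply/eqP; rewrite -addr_eq0 -sliceD addNr slice0. Qed.
Lemma sliceB f b b' : slice f (b - b') = slice f b - slice f b'.
Proof. by rewrite sliceD sliceN. Qed.
Lemma slice_bigsum f (I : Type) (r : seq I) F :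
  slice f (\sum_(i <- r) F i) = \sum_(i <- r) slice f (F i).
Proof. by apply: (big_morph (slice f)) => [x y|]; [apply: sliceD|apply: slice0]. Qed.

Lemma slice_expand d (e : 'I_d -> L) (f : 'I_d -> {linear L -> k^o}) :
  (forall c, c = \sum_i f i c *: e i) ->
  forall b, b = \sum_i e i *: phi (slice (f i) b).
Proof.
move=> eL b; have [s ->] := base_change_span b.
transitivity (\sum_(p <- s) \sum_i e i *: phi (f i p.1 *: p.2)).
  apply: eq_bigr => p _; rewrite {1}(eL p.1) scaler_suml; apply: eq_bigr => i _.
  by rewrite semilinZ scalerA -scalerAr mulr1.
rewrite exchange_big; apply: eq_bigr => i _.
by rewrite slice_sum semilin_sum scaler_sumr.
Qed.

End BaseChangeTools.

Section Functionals.
Variables (k : fieldType) (L : fieldExtType k).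

(** Some coordinate of 1 is not zero and can be rescaled. Slicing along the result is a retraction
    of A -> A ⊗ L. *)
Lemma functional_one : exists f : {linear L -> k^o}, f 1 = 1.
Proof.
have [d [e [f eL]]] := dual_basis L.
have [i fi] : exists i, f i 1 != 0.
  apply/existsP; apply: contraNT (oner_neq0 L) => /existsPn f0.
  rewrite [1]eL big1 // => i _.
  by have := f0 i; rewrite negbK => /eqP ->; rewrite scale0r.
have lin : linear (fun c : L => (f i 1)^-1 * f i c : k^o).
  by move=> a x y /=; rewrite linearP mulrDr mulrCA.
pose F := GRing.isLinear.Build _ _ _ _ _ lin.
pose g : {linear L -> k^o} := HB.pack (fun c : L => (f i 1)^-1 * f i c : k^o) F.
by exists g; rewrite /= mulVf.
Qed.

Lemma functional_mul (f : {linear L -> k^o}) (c : L) :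
  exists g : {linear L -> k^o}, forall x, g x = f (c * x).
Proof.
have lin : linear (fun x : L => f (c * x)).
  by move=> a x y /=; rewrite mulrDr -scalerAr linearP.
pose F := GRing.isLinear.Build _ _ _ _ _ lin.
by exists (HB.pack (fun x : L => f (c * x)) F : {linear L -> k^o}).
Qed.
End Functionals.

(** * Ideals, quotients and descent of simplicity and semisimplicity *)

Section NonzeroQuotient.
Variables (R : comNzRingType) (A : algType R) (X : A -> Prop).

(** The proof that the quotient is not zero is a parameter of the type, so that inference finds the
    [algType] structure, which requires it. *)
Definition nzquo of (1 : quo X) != 0 : Type := quo X.

Variable nz : (1 : quo X) != 0.
Local Notation Q := (nzquo nz).
HB.instance Definition _ := GRing.PzRing.copy Q (quo X).
HB.instance Definition _ := GRing.Lmodule.copy Q (quo X).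
HB.instance Definition _ := GRing.PzSemiRing_isNonZero.Build Q nz.

Lemma nzquo_scaleAl c (x y : Q) : c *: (x * y) = (c *: x) * y.
Proof.
change (quo_scale c (quo_mul x y) = quo_mul (quo_scale c x) y).
by rewrite -[x]quo_repr -[y]quo_repr -quo_piM -!quo_piZ -quo_piM scalerAl.
Qed.
Lemma nzquo_scaleAr c (x y : Q) : c *: (x * y) = x * (c *: y).
Proof.
change (quo_scale c (quo_mul x y) = quo_mul x (quo_scale c y)).
by rewrite -[x]quo_repr -[y]quo_repr -quo_piM -!quo_piZ -quo_piM scalerAr.
Qed.
HB.instance Definition _ := GRing.Lmodule_isLalgebra.Build R Q nzquo_scaleAl.
HB.instance Definition _ := GRing.Lalgebra_isAlgebra.Build R Q nzquo_scaleAr.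

End NonzeroQuotient.

Lemma quo_pi0 (R : comNzRingType) (A : algType R) (X : A -> Prop) :
  quo_pi X 0 = 0.
Proof. by rewrite /quo_pi raddf0. Qed.

Section AlgebraBaseChange.
Variables (k : fieldType) (L : fieldExtType k) (A : algType k) (B : algType L).
Variable inc : A -> B.
Hypothesis incM : monoid_morphism inc.
Hypothesis incL : semilinear_over inc.
Hypothesis incP : bijective (extmap inc).
Local Notation sl := (slice incP).

Lemma slice_scale (f g : {linear L -> k^o}) c :
  (forall x, g x = f (c * x)) -> forall b, sl f (c *: b) = sl g b.
Proof.
move=> fg b; have [s ->] := base_change_span incL incP b.
rewrite scaler_sumr !(slice_bigsum incL); apply: eq_bigr => p _.
by rewrite scalerA !(sliceZ incL) fg.
Qed.

Lemma slice_incl f a b : sl f (inc a * b) = a * sl f b.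
Proof.
have [s ->] := base_change_span incL incP b.
rewrite mulr_sumr !(slice_bigsum incL) mulr_sumr; apply: eq_bigr => p _.
by rewrite -scalerAr -incM.2 !(sliceZ incL) scalerAr.
Qed.

Lemma slice_incr f a b : sl f (b * inc a) = sl f b * a.
Proof.
have [s ->] := base_change_span incL incP b.
rewrite mulr_suml !(slice_bigsum incL) mulr_suml; apply: eq_bigr => p _.
by rewrite -scalerAl -incM.2 !(sliceZ incL) scalerAl.
Qed.

Lemma slice_inc f a : sl f (inc a) = f 1 *: a.
Proof. by rewrite -[inc a]scale1r (sliceZ incL). Qed.

(** This is the extension I ⊗ L, described by slices. Factors in A pass through the slicing, and
    factors in L are absorbed by the functional. *)
Lemma slice_two_sided (I : A -> Prop) : two_sided_ideal I ->
  two_sided_ideal (fun b => forall f, I (sl f b)).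
Proof.
move=> [[I0 IB Il] Ir].
have I_sum (J : seq (L * A)) (F : L * A -> A) :
    (forall p, I (F p)) -> I (\sum_(p <- J) F p).
  move=> IF; elim: J => [|p J IH]; first by rewrite big_nil.
  rewrite big_cons -[\sum_(_ <- _) _]opprK; apply: (IB) => //.
  by rewrite -sub0r; apply: (IB).
split; first split=> [f|a b Ia Ib f|p a Ia f].
- by rewrite (slice0 incL).
- by rewrite (sliceB incL); apply: IB.
- have [s ->] := base_change_span incL incP p.
  rewrite mulr_suml (slice_bigsum incL); apply: I_sum => q.
  rewrite -scalerAl; have [g gE] := functional_mul f q.1.
  by rewrite (slice_scale gE) slice_incl; apply: Il.
- move=> a p Ia f; have [s ->] := base_change_span incL incP p.
  rewrite mulr_sumr (slice_bigsum incL); apply: I_sum => q.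
  rewrite -scalerAr; have [g gE] := functional_mul f q.1.
  by rewrite (slice_scale gE) slice_incr; apply: Ir.
Qed.

(** Generators of A are the components in A of generators of B. If z is central, [inc z] is a scalar
    c and z is its slice f1(c). An ideal I of A is compared with the ideal of the elements of B
    whose slices all lie in I. *)
Lemma central_simple_base_change :
  central_simple (fun c : L => c *: (1 : B)) ->
  central_simple (fun c : k => c *: (1 : A)).
Proof.
have [f1 f1E] := functional_one L.
have f1inc a : sl f1 (inc a) = a by rewrite slice_inc f1E scale1r.
case=> [[s sP] cent nz simp]; split.
- have [F FP] := choice (base_change_span incL incP).
  pose S := flatten [seq F b | b <- s].
  suff H (a : A) : exists cc : nat -> k, a = \sum_(i < size S) cc i *: (S`_i).2.
    exists [seq p.2 | p <- S] => a; have [cc ->] := H a.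
    exists cc; rewrite size_map; apply: eq_bigr => i _.
    by rewrite mulr_algl (nth_map 0).
  have [c cP] := sP (inc a).
  (* The coefficients d are arbitrary because removing the head of t shifts their indices. *)
  have cov (t : seq B) (d : nat -> L) :
      exists cc : nat -> k,
        sl f1 (\sum_(i < size t) d i *: (1 : B) * t`_i)
          = \sum_(i < size (flatten [seq F b | b <- t]))
              cc i *: ((flatten [seq F b | b <- t])`_i).2.
    elim: t d => [|b t IH] d /=.
      by exists (fun=> 0); rewrite !big_ord0 (slice0 incL).
    have [cc ccE] := IH (fun i => d i.+1).
    rewrite big_ord_recl /= (sliceD incL) ccE mulr_algl {1}(FP b) scaler_sumr.
    rewrite (slice_bigsum incL) size_cat.
    exists (fun i => if (i < size (F b))%N then f1 (d 0 * ((F b)`_i).1)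
                     else cc (i - size (F b))%N).
    rewrite big_split_ord /=; congr (_ + _).
      rewrite (big_nth 0) big_mkord; apply: eq_bigr => i _.
      by rewrite scalerA (sliceZ incL) ltn_ord nth_cat ltn_ord.
    apply: eq_bigr => i _.
    by rewrite ltnNge leq_addr /= nth_cat ltnNge leq_addr /= addKn.
  have [cc ccE] := cov s c; exists cc.
  by rewrite -[a in LHS]f1inc cP ccE.
- move=> z zC; have [|c cE] := cent (inc z).
    move=> p; have [t ->] := base_change_span incL incP p.
    rewrite mulr_sumr mulr_suml; apply: eq_bigr => q _.
    by rewrite -scalerAr -scalerAl -!incM.2 zC.
  by exists (f1 c); rewrite -[z]f1inc cE -incM.1 (sliceZ incL).
- by move=> z; apply: nz; rewrite -incM.1 z (semilin0 incL).
- move=> I II; have [H|H] := simp _ (slice_two_sided II).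
    left=> p Ip; rewrite -[p]f1inc (H (inc p)) ?(slice0 incL) // => f.
    rewrite slice_inc -mulr_algl; case: II => [[_ _ Il] _]; exact: Il.
  by right=> p; have := H (inc p) f1; rewrite f1inc.
Qed.

(* With I' = L·I and a complement J' of I' in B, the composite of the projection
   of B onto I' with a slice of value 1 at 1 is an A-linear projection of A
   onto I. *)
Lemma semisimple_base_change : semisimple B -> semisimple A.
Proof.
have [f1 f1E] := functional_one L.
have f1inc a : sl f1 (inc a) = a by rewrite slice_inc f1E scale1r.
move=> ssB I [I0 IB Il].
have I_sum (J : seq (L * A)) (F : L * A -> A) :
    (forall p, I (F p)) -> I (\sum_(p <- J) F p).
  move=> IF; elim: J => [|p J IH]; first by rewrite big_nil.
  rewrite big_cons -[\sum_(_ <- _) _]opprK; apply: (IB) => //.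
  by rewrite -sub0r; apply: (IB).
pose I' b := forall f, I (sl f b).
have [|J' [[J0 JB Jl] IJ0 IJ]] := ssB I'.
  split=> [f|a b Ia Ib f|p a Ia f].
  - by rewrite (slice0 incL).
  - by rewrite (sliceB incL); apply: IB.
  - have [s ->] := base_change_span incL incP p.
    rewrite mulr_suml (slice_bigsum incL); apply: I_sum => q.
    rewrite -scalerAl; have [g gE] := functional_mul f q.1.
    by rewrite (slice_scale gE) slice_incl; apply: Il.
have I'inc a : I a -> I' (inc a).
  by move=> Ia f; rewrite slice_inc -mulr_algl; apply: Il.
have I'D a b : I' a -> I' b -> I' (a - b).
  by move=> Ia Ib f; rewrite (sliceB incL); apply: IB.
have I'M a b : I' b -> I' (inc a * b).
  by move=> Ib f; rewrite slice_incl; apply: Il.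
(* This is the kernel of the projection of A onto I. *)
exists (fun a => exists b c, [/\ I' b, J' c, inc a = b + c & sl f1 b = 0]).
split.
- split.
  + exists 0, 0; split=> //.
      by move=> f; rewrite (slice0 incL).
    by rewrite (semilin0 incL) addr0.
    by rewrite (slice0 incL).
  + move=> a a' [b [c [Ib Jc E Z]]] [b' [c' [Ib' Jc' E' Z']]].
    exists (b - b'), (c - c'); split; [exact: I'D|exact: JB| |].
      by rewrite (semilinB incL) E E' opprD addrACA.
    by rewrite (sliceB incL) Z Z' subrr.
  + move=> p a [b [c [Ib Jc E Z]]]; exists (inc p * b), (inc p * c).
    split; [exact: I'M|exact: Jl|by rewrite incM.2 E mulrDr|].
    by rewrite slice_incl Z mulr0.
- move=> a Ia [b [c [Ib Jc E Z]]].
  have c0 : c = 0.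
    apply: IJ0 => //; have -> : c = inc a - b by rewrite E addrC addKr.
    by apply: I'D => //; apply: I'inc.
  by rewrite -[a]f1inc E c0 addr0.
- move=> a; have [b [c [Ib Jc E]]] := IJ (inc a).
  exists (sl f1 b), (a - sl f1 b); split=> //; last by rewrite addrC subrK.
  exists (b - inc (sl f1 b)), c; split=> //.
  + by apply: I'D => //; apply: I'inc.
  + by rewrite (semilinB incL) E addrAC.
  + by rewrite (sliceB incL) f1inc subrr.
Qed.

Variables (X : A -> Prop) (Y : B -> Prop).
Hypothesis XY : forall x, X x -> Y (inc x).
Hypothesis YX : forall y, Y y ->
  exists2 s : seq (L * A), (forall p, p \in s -> X p.2)
                         & y = \sum_(p <- s) p.1 *: inc p.2.

Lemma gen_ideal_gen (R : comNzRingType) (C : algType R) (Z : C -> Prop) z :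
  Z z -> z \in gen_ideal Z.
Proof. by move=> Zz; apply/asboolP => I _ ZI; apply: ZI. Qed.

Lemma gen_ideal_two_sided (R : comNzRingType) (C : algType R) (Z : C -> Prop) :
  two_sided_ideal (fun c => c \in gen_ideal Z).
Proof.
split; first split; first exact: rpred0.
- by move=> a b; apply: rpredB.
- by move=> p a; apply: gen_idealMl.
- by move=> a p; apply: gen_idealMr.
Qed.

Lemma gen_ideal_inc a : a \in gen_ideal X -> inc a \in gen_ideal Y.
Proof.
move=> /asboolP H; apply: (H (fun a => inc a \in gen_ideal Y)); last first.
  by move=> x Xx; apply: gen_ideal_gen; apply: XY.
split; first split=> [|a' b ha hb|p a' ha].
- by rewrite (semilin0 incL) rpred0.
- by rewrite (semilinB incL) rpredB.
- by rewrite incM.2 gen_idealMl.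
- by move=> a' p ha; rewrite incM.2 gen_idealMr.
Qed.

(** The elements whose slices all lie in [gen_ideal X] form a two-sided ideal, which contains Y by
    [YX]. *)
Lemma gen_ideal_slice b f : b \in gen_ideal Y -> sl f b \in gen_ideal X.
Proof.
move=> /asboolP/(_ _ (slice_two_sided (gen_ideal_two_sided X)))/(_ _ f); apply.
move=> y /YX[s sX ->] g; rewrite (slice_bigsum incL) big_seq rpred_sum // => p ps.
by rewrite (sliceZ incL) gen_idealZ // gen_ideal_gen //; apply: sX.
Qed.

(** By [gen_ideal_inc] the map descends to the quotients; by [gen_ideal_slice] slicing does too, so
    a relation in the quotient of B has zero slices in the quotient of A. *)
Lemma quo_base_change :
  exists2 psi : quo X -> quo Y,
    (forall a, psi (quo_pi _ a) = quo_pi _ (inc a)) &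
    monoid_morphism psi /\ base_change psi.
Proof.
pose psi (x : quo X) : quo Y := quo_pi Y (inc (repr x)).
have psiE a : psi (quo_pi _ a) = quo_pi _ (inc a).
  apply/quo_eq; rewrite -(semilinB incL); apply: gen_ideal_inc.
  by apply/quo_eq; rewrite quo_repr.
exists psi => //; split.
  split=> [|x y]; first by rewrite [LHS]psiE incM.1.
  by rewrite [LHS]psiE incM.2 quo_piM.
have pi_sum (s : seq (L * A)) :
    quo_pi Y (\sum_(p <- s) p.1 *: inc p.2)
      = \sum_(p <- [seq (p.1, quo_pi X p.2) | p <- s]) p.1 *: psi p.2.
  elim: s => [|p s IH]; first by rewrite !big_nil quo_pi0.
  rewrite !big_cons quo_piD IH psiE; congr (_ + _).
  exact: quo_piZ.
apply: base_change_of_slices.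
- move=> c a b; rewrite -[a]quo_repr -[b]quo_repr !psiE.
  transitivity (psi (quo_pi X (c *: repr a + repr b))).
    by rewrite quo_piD quo_piZ.
  by rewrite psiE (incL c) quo_piD quo_piZ.
- move=> b; rewrite -[b]quo_repr.
  have [s ->] := base_change_span incL incP (repr b).
  by exists [seq (p.1, quo_pi X p.2) | p <- s].
- move=> s s0 f; pose s' := [seq (p.1, repr p.2) | p <- s].
  have sE : s = [seq (p.1, quo_pi X p.2) | p <- s'].
    rewrite -map_comp -[LHS]map_id; apply: eq_map => -[c x] /=.
    by rewrite quo_repr.
  have mem : \sum_(p <- s') p.1 *: inc p.2 \in gen_ideal Y.
    by rewrite -[X in X \in _]subr0; apply/quo_eq; rewrite pi_sum -sE s0 quo_pi0.
  have := gen_ideal_slice f mem; rewrite (slice_sum incL) -[X in X \in _]subr0.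
  move=> /quo_eq pi0; transitivity (quo_pi X 0); last exact: quo_pi0.
  rewrite -pi0 {1}sE.
  elim: s' {sE mem pi0} => [|p t IH]; first by rewrite !big_nil quo_pi0.
  by rewrite /= !big_cons quo_piD IH quo_piZ.
Qed.

End AlgebraBaseChange.

(** * Algebras spanned by monomials *)

Section MonomialGroups.
Variables (F : fieldType) (l : nat) (R : algType F).

Record monomial_group (U : R -> Prop) : Prop := MonomialGroup {
  mg1 : U 1;
  mgM : forall u v, U u -> U v -> U (u * v);
  mgV : forall u, U u -> exists2 v, U v & u * v = 1 /\ v * u = 1;
  mgC : forall u v, U u -> U v -> exists2 z : F, z ^+ l = 1 & u * v = z *: (v * u);
  mg_span : forall r, exists2 s : seq (F * R),
    (forall p, p \in s -> U p.2) & r = \sum_(p <- s) p.1 *: p.2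
}.

Variable U : R -> Prop.
Hypothesis UP : monomial_group U.

Lemma mg_neq0 u : U u -> u != 0.
Proof.
move=> /(mgV UP)[v _ [uv _]]; apply/eqP => u0.
by have /eqP := oner_neq0 R; rewrite -uv u0 mul0r.
Qed.

Lemma mgX u m : U u -> U (u ^+ m).
Proof.
move=> Uu; elim: m => [|m IH]; first exact: mg1 UP.
by rewrite exprS; apply: (mgM UP).
Qed.

(** Products of elements of U are units, hence not zero, so a commutator determines its scalar. *)
Lemma mg_scale_inj u v z z' : U u -> U v ->
  u * v = z *: (v * u) -> u * v = z' *: (v * u) -> z = z'.
Proof.
move=> Uu Uv -> /eqP; rewrite -subr_eq0 -scalerBl scaler_eq0 subr_eq0.
case/orP => [/eqP //|/eqP vu0].
by have := mg_neq0 (mgM UP Uv Uu); rewrite vu0 eqxx.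
Qed.

Lemma mg_commute_center u : (forall v, U v -> v * u = u * v) -> u \in @center F R.
Proof.
move=> uC; apply/centerP => r; have [s sU ->] := mg_span UP r.
rewrite mulr_sumr mulr_suml; apply: eq_big_seq => p ps.
by rewrite -scalerAl -scalerAr uC //; apply: sU.
Qed.

Lemma mg_cover_span (S : seq R) :
  (forall u, U u -> exists c x, x \in S /\ u = c *: x) ->
  forall p, exists c : nat -> F, p = \sum_(i < size S) c i *: S`_i.
Proof.
move=> US p; have [s sU ->] := mg_span UP p.
elim: s sU => [|q s IH] sU.
  by exists (fun=> 0); rewrite big_nil big1 // => i _; rewrite scale0r.
have [|c cE] := IH; first by move=> q' q's; apply: sU; rewrite inE q's orbT.
have [c' [x [xS qE]]] := US _ (sU _ (mem_head _ _)).
exists (fun i => c i + (if i == index x S then q.1 * c' else 0)).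
rewrite big_cons cE addrC; under [RHS]eq_bigr do rewrite scalerDl.
rewrite big_split /=; congr (_ + _).
have xi : (index x S < size S)%N by rewrite index_mem.
rewrite (bigD1 (Ordinal xi)) //= eqxx big1 ?addr0.
  by rewrite nth_index // qE scalerA.
move=> i /negPf ni; rewrite ifN ?scale0r //.
by apply/negP => /eqP ii; move: ni; rewrite -val_eqE /= ii eqxx.
Qed.

Section Split.
Variables K V : R -> Prop.
Hypothesis K_center : forall z, K z -> z \in @center F R.
Hypothesis KD : forall z z', K z -> K z' -> K (z + z').
Hypothesis KZ : forall c z, K z -> K (c *: z).
Hypothesis KM : forall z w, K z -> U w -> w \in @center F R -> K (z * w).
Hypothesis VL : forall c b b', V b -> V b' -> V (c *: b + b').
Hypothesis VJ : forall u v b, U u -> u * v = 1 -> v * u = 1 -> V b ->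
  V (u * b * v).

Let V0 b : V b -> V 0.
Proof. by move=> Vb; have := VL (-1) Vb Vb; rewrite scaleN1r addNr. Qed.
Let VZ c b : V b -> V (c *: b).
Proof. by move=> Vb; rewrite -[c *: b]addr0; apply: VL => //; apply: V0 Vb. Qed.

(* Two summands that do not differ by a central factor are distinguished by the
   conjugation by some u in U; subtracting multiples of b from its conjugate
   kills either of them, which writes b with shorter sums. *)
Lemma monomial_split (s : seq (R * R)) :
  (forall p, p \in s -> K p.1 /\ U p.2) -> V (\sum_(p <- s) p.1 * p.2) ->
  exists2 s' : seq (R * R),
    (forall p, p \in s' -> [/\ K p.1, U p.2 & V (p.1 * p.2)])
    & \sum_(p <- s) p.1 * p.2 = \sum_(p <- s') p.1 * p.2.
Proof.
elim: {s}(size s).+1 {-2}s (ltnSn (size s)) => // N IH [|p0 [|p1 t]] sN sKU Vs.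
- by exists [::].
- have [Kp Up] := sKU p0 (mem_head _ _); exists [:: p0] => // p.
  by rewrite inE => /eqP ->; split=> //; rewrite big_seq1 in Vs.
have [K0 U0] := sKU p0 (mem_head _ _).
have [K1 U1] : K p1.1 /\ U p1.2 by apply: sKU; rewrite !inE eqxx orbT.
have tKU p : p \in t -> K p.1 /\ U p.2.
  by move=> pt; apply: sKU; rewrite !inE pt !orbT.
have [v0 Uv0 [uv0 vu0]] := mgV UP U0.
pose w := v0 * p1.2; have Uw : U w by apply: (mgM UP).
have p1E : p1.2 = p0.2 * w by rewrite mulrA uv0 mul1r.
(* If the ratio w of the first two monomials is central, it moves into the coefficient and the two
   summands merge. *)
have [wC|] := pselect (forall v, U v -> v * w = w * v).
  have wc : w \in @center F R by apply: mg_commute_center.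
  have sE : \sum_(p <- [:: p0, p1 & t]) p.1 * p.2
      = \sum_(p <- (p0.1 + p1.1 * w, p0.2) :: t) p.1 * p.2.
    by rewrite !big_cons /= addrA mulrDl p1E (wC _ U0) mulrA.
  rewrite sE; apply: IH; [by []| |by rewrite -sE].
  move=> p; rewrite inE => /orP[/eqP ->|/tKU //]; split=> //=.
  by apply: KD => //; apply: KM.
move=> /existsNP[u /not_implyP[Uu uw]].
have [v Uv [uv vu]] := mgV UP Uu.
have [Z ZP] : {Z : R -> F &
    forall x, U x -> u * x = Z x *: (x * u)}.
  apply: (choice (P := fun x z => U x -> u * x = z *: (x * u))) => x.
  have [Ux|nUx] := pselect (U x); last by exists 0.
  by have [z _ zE] := mgC UP Uu Ux; exists z.
(* Equal scalars would make u commute with the ratio w. *)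
have Z01 : Z p1.2 - Z p0.2 != 0.
  rewrite subr_eq0; apply/eqP => Z01; apply: uw.
  have [z _ zE] := mgC UP Uu Uw; rewrite zE.
  suff -> : z = 1 by rewrite scale1r.
  have: Z p0.2 * z = Z p1.2.
    apply: (mg_scale_inj Uu U1 _ (ZP _ U1)).
    rewrite p1E (mulrA u) (ZP _ U0) -scalerAl -!(mulrA p0.2) zE -scalerAr.
    by rewrite scalerA.
  rewrite Z01 -[RHS]mulr1 => /mulfI; apply; apply/eqP => Z0.
  have := ZP _ U0; rewrite Z0 scale0r => /eqP; apply/negP.
  by apply: mg_neq0; apply: (mgM UP).
(* [tw c] turns a sum b into u b v - c b, where v is the inverse of u. With c = Z p0.2 the summand
   of p0 disappears, with c = Z p1.2 that of p1. *)
pose tw c (r : seq (R * R)) := [seq ((Z p.2 - c) *: p.1, p.2) | p <- r].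
have twE c r : (forall p, p \in r -> K p.1 /\ U p.2) ->
    \sum_(p <- tw c r) p.1 * p.2
      = - c *: (\sum_(p <- r) p.1 * p.2) + u * (\sum_(p <- r) p.1 * p.2) * v.
  move=> rKU; rewrite big_map scaler_sumr mulr_sumr mulr_suml -big_split.
  apply: eq_big_seq => p /rKU[Kp Up] /=.
  have /centerP pC := K_center Kp.
  have -> : u * (p.1 * p.2) * v = Z p.2 *: (p.1 * p.2).
    rewrite mulrA -pC -(mulrA p.1) (ZP _ Up) -scalerAr -scalerAl.
    by rewrite -!mulrA uv mulr1.
  by rewrite -scalerAl -scalerDl addrC.
have twV c r : (forall p, p \in r -> K p.1 /\ U p.2) ->
    V (\sum_(p <- r) p.1 * p.2) -> V (\sum_(p <- tw c r) p.1 * p.2).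
  by move=> rKU Vr; rewrite twE //; apply: VL => //; apply: VJ.
have twKU c r : (forall p, p \in r -> K p.1 /\ U p.2) ->
    (forall p, p \in tw c r -> K p.1 /\ U p.2).
  by move=> rKU p /mapP[p' /rKU[Kp Up] ->]; split=> //; apply: KZ.
have V0s := twV (Z p0.2) _ sKU Vs; have V1s := twV (Z p1.2) _ sKU Vs.
have s1KU p : p \in p1 :: t -> K p.1 /\ U p.2.
  by move=> pt; apply: sKU; rewrite inE pt orbT.
have s0KU p : p \in p0 :: t -> K p.1 /\ U p.2.
  by rewrite inE => /orP[/eqP -> //|/tKU].
have E0 : \sum_(p <- tw (Z p0.2) [:: p0, p1 & t]) p.1 * p.2
    = \sum_(p <- tw (Z p0.2) (p1 :: t)) p.1 * p.2.
  by rewrite /= big_cons /= subrr scale0r mul0r add0r.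
have E1 : \sum_(p <- tw (Z p1.2) [:: p0, p1 & t]) p.1 * p.2
    = \sum_(p <- tw (Z p1.2) (p0 :: t)) p.1 * p.2.
  by rewrite /= !big_cons /= subrr scale0r mul0r add0r.
have [|||r0 r0P r0E] := IH (tw (Z p0.2) (p1 :: t)).
- by rewrite size_map.
- exact: twKU.
- by rewrite -E0.
have [|||r1 r1P r1E] := IH (tw (Z p1.2) (p0 :: t)).
- by rewrite size_map.
- exact: twKU.
- by rewrite -E1.
(* The two twisted sums differ by (Z p1.2 - Z p0.2) b, so d times their difference gives b back. *)
pose d := (Z p1.2 - Z p0.2)^-1.
exists ([seq (d *: p.1, p.2) | p <- r0] ++ [seq (- d *: p.1, p.2) | p <- r1]).
  move=> p; rewrite mem_cat => /orP[/mapP[p' /r0P[Kp Up Vp] ->]|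
                                   /mapP[p' /r1P[Kp Up Vp] ->]] /=;
  by split=> //; [apply: KZ|rewrite -scalerAl; apply: VZ].
rewrite big_cat !big_map /=.
transitivity (d *: (\sum_(p <- r0) p.1 * p.2) - d *: (\sum_(p <- r1) p.1 * p.2)).
  rewrite -r0E -r1E -E0 -E1 !twE // -scalerBr opprD addrACA subrr addr0.
  rewrite !scaleNr opprK addrC -scalerBl scalerA.
  by rewrite mulVf ?scale1r.
rewrite !scaler_sumr -sumrN; congr (_ + _); apply: eq_bigr => p _.
  by rewrite scalerAl.
by rewrite -scalerAl scaleNr.
Qed.

End Split.

Section CentralSimple.
Variable S : seq R.
Hypothesis US : forall u, U u -> exists c x, x \in S /\ u = c *: x.
Hypothesis UC : forall u, U u -> u \in @center F R -> exists c : F, u = c%:A.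

Let scalars (z : R) := exists c : F, z = c%:A.

(** The case of [monomial_split] where K is F times 1; [UC] keeps K stable under multiplication by
    central monomials. *)
Let split_scalars (V : R -> Prop) b :
  (forall c b b', V b -> V b' -> V (c *: b + b')) ->
  (forall u v b, U u -> u * v = 1 -> v * u = 1 -> V b -> V (u * b * v)) ->
  V b -> exists2 s : seq (F * R),
    (forall p, p \in s -> U p.2 /\ V (p.1 *: p.2)) & b = \sum_(p <- s) p.1 *: p.2.
Proof.
move=> VL VJ Vb; have [s sU bE] := mg_span UP b.
have bE' : b = \sum_(p <- [seq (p.1%:A, p.2) | p <- s]) p.1 * p.2.
  by rewrite bE big_map; apply: eq_bigr => p _; rewrite mulr_algl.
have [||||||s' s'P s'E] := @monomial_split scalars V _ _ _ _ VL VJ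
    [seq (p.1%:A, p.2) | p <- s].
- by move=> z [c ->]; apply/centerP => a; rewrite mulr_algl mulr_algr.
- by move=> z z' [c ->] [c' ->]; exists (c + c'); rewrite scalerDl.
- by move=> c z [c' ->]; exists (c * c'); rewrite scalerA.
- move=> z w [c ->] Uw /(UC Uw)[c' ->]; exists (c * c').
  by rewrite mulr_algl scalerA.
- by move=> p /mapP[p' /sU Up ->]; split=> //; exists p'.1.
- by rewrite -bE'.
have [f fP] : {f : R -> F & forall z, scalars z -> z = (f z)%:A}.
  apply: (choice (P := fun z c => scalars z -> z = c%:A)) => z.
  by have [[c ->]|nz] := pselect (scalars z); [exists c|exists 0].
exists [seq (f p.1, p.2) | p <- s'].
  by move=> p /mapP[p' /s'P[/fP Kp Up Vp] ->]; split=> //=; rewrite -mulr_algl -Kp.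
rewrite bE' s'E big_map; apply: eq_big_seq => p /s'P[/fP Kp _ _].
by rewrite {1}Kp mulr_algl.
Qed.

(** Conjugation fixes the center, which is thus spanned by central monomials, and these are scalars
    by [UC]. *)
Lemma mg_center z : z \in @center F R -> scalars z.
Proof.
move=> zC; have [||s sP ->] := split_scalars (V := fun z => z \in @center F R) _ _ zC.
- by move=> c b b' bC b'C; rewrite rpredD // rpredZ.
- by move=> u v b Uu uv vu /centerP bC; rewrite -bC -mulrA uv mulr1; apply/centerP.
elim: s sP => [|p s IH] sP; first by exists 0; rewrite big_nil scale0r.
have [c cE] : scalars (\sum_(p <- s) p.1 *: p.2).
  by apply: IH => q qs; apply: sP; rewrite inE qs orbT.
suff [c' c'E] : scalars (p.1 *: p.2).
  by exists (c' + c); rewrite big_cons c'E cE scalerDl.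
have [Up pC] := sP p (mem_head _ _).
have [->|p0] := eqVneq p.1 0; first by exists 0; rewrite !scale0r.
have [|c' ->] := UC Up; last by exists (p.1 * c'); rewrite scalerA.
by rewrite -[p.2]scale1r -(mulVf p0) -scalerA rpredZ.
Qed.

(** A nonzero ideal contains a nonzero multiple of a monomial, which is a unit. *)
Lemma mg_central_simple : central_simple (fun c : F => c *: (1 : R)).
Proof.
split; last 2 first.
- exact/eqP/oner_neq0.
- move=> I [[I0 IB Il] Ir].
  have IZ c b : I b -> I (c *: b) by move=> Ib; rewrite -mulr_algl; apply: Il.
  have ID b b' : I b -> I b' -> I (b + b').
    by move=> Ib /(IZ (-1)) /(IB _ _ Ib); rewrite scaleN1r opprK.
  have [I1|nI1] := pselect (I 1).
    by right=> p; rewrite -[p]mulr1; apply: Il.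
  left=> p Ip; have [||s sP ->] := split_scalars (V := I) _ _ Ip.
  + by move=> c b b' Ib Ib'; apply: ID => //; apply: IZ.
  + by move=> u v b Uu uv vu Ib; apply: Ir; apply: Il.
  rewrite big_seq big1 // => q /sP[Uq Iq].
  have [->|q0] := eqVneq q.1 0; first by rewrite scale0r.
  have [v _ [qv _]] := mgV UP Uq; case: nI1; rewrite -qv; apply: Ir.
  by rewrite -[q.2]scale1r -(mulVf q0) -scalerA; apply: IZ.
- exists S => p; have [c ->] := mg_cover_span US p; exists c.
  by apply: eq_bigr => i _; rewrite mulr_algl.
- by move=> z zC; apply: mg_center; apply/centerP.
Qed.

End CentralSimple.

End MonomialGroups.

Section RawLinear.
Variables (F : pzRingType) (V W : lmodType F) (f : V -> W).
Hypothesis fL : linear f.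
Lemma raw_linearD x y : f (x + y) = f x + f y.
Proof. by have := fL 1 x y; rewrite !scale1r. Qed.
Lemma raw_linear0 : f 0 = 0.
Proof. by apply: (addrI (f 0)); rewrite -raw_linearD !addr0. Qed.
Lemma raw_linearZ c x : f (c *: x) = c *: f x.
Proof. by have := fL c x 0; rewrite raw_linear0 !addr0. Qed.
Lemma raw_linear_sum (I : Type) (r : seq I) (G : I -> V) :
  f (\sum_(i <- r) G i) = \sum_(i <- r) f (G i).
Proof. by apply: (big_morph f) => [x y|]; [apply: raw_linearD|apply: raw_linear0]. Qed.
End RawLinear.

(** * Maschke averaging over monomials *)

Section Maschke.
Variables (F : fieldType).

(** A complement J grows by the spanning vectors that do not yet lie in I + J. The projection is
    linear because components in I and J are unique. *)
Lemma subspace_projection (V : lmodType F) (s : seq V) (I : V -> Prop) :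
  (forall v, exists c : nat -> F, v = \sum_(i < size s) c i *: s`_i) ->
  I 0 -> (forall c a b, I a -> I b -> I (c *: a + b)) ->
  exists p : V -> V, [/\ linear p, forall v, I (p v) & forall v, I v -> p v = v].
Proof.
move=> span I0 IL.
have [J [J0 JL IJ sIJ]] : exists J : V -> Prop,
    [/\ J 0, forall c a b, J a -> J b -> J (c *: a + b),
        forall v, I v -> J v -> v = 0
      & forall v, v \in s -> exists a b, [/\ I a, J b & v = a + b]].
  elim: s {span} => [|x s [J [J0 JL IJ sIJ]]].
    exists (fun v => v = 0); split=> // c a b -> ->.
    by rewrite scaler0 addr0.
  have [xIJ|xIJ] := pselect (exists a b, [/\ I a, J b & x = a + b]).
    by exists J; split=> // v; rewrite inE => /orP[/eqP -> //|/sIJ].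
  exists (fun v => exists c j, J j /\ v = c *: x + j); split.
  - by exists 0, 0; rewrite scale0r addr0.
  - move=> c _ _ [d [j [Jj ->]]] [d' [j' [Jj' ->]]].
    exists (c * d + d'), (c *: j + j'); split; first exact: JL.
    by rewrite scalerDr scalerA addrACA -scalerDl.
  - move=> v Iv [c [j [Jj vE]]]; have [c0|c0] := eqVneq c 0.
      by apply: IJ => //; rewrite vE c0 scale0r add0r.
    case: xIJ; exists (c^-1 *: v), (- c^-1 *: j); split.
    + by rewrite -[_ *: _]addr0; apply: IL.
    + by rewrite -[_ *: _]addr0; apply: JL.
    + by rewrite vE scalerDr scalerA mulVf // scale1r scaleNr addrK.
  - move=> v; rewrite inE => /orP[/eqP ->|/sIJ[a [b [Ia Jb ->]]]].
      by exists 0, x; split; rewrite ?add0r //; exists 1, 0; rewrite scale1r addr0.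
    by exists a, b; split=> //; exists 0, b; rewrite scale0r add0r.
have [p pP] : {p : V -> V & forall v, I (p v) /\ J (v - p v)}.
  apply: (choice (P := fun v a => I a /\ J (v - a))) => v; have [c ->] := span v.
  have IZ a b : I b -> I (a *: b) by move=> Ib; rewrite -[_ *: _]addr0; apply: IL.
  have JZ a b : J b -> J (a *: b) by move=> Jb; rewrite -[_ *: _]addr0; apply: JL.
  have: forall i : 'I_(size s), exists a, I a /\ J (s`_i - a).
    move=> i; have [a [b [Ia Jb ->]]] := sIJ _ (mem_nth 0 (ltn_ord i)).
    by exists a; split=> //; rewrite addrC addKr.
  move=> /choice[f fP]; exists (\sum_(i < size s) c i *: f i); rewrite -sumrB.
  split.
    apply: (big_ind I) => // [a b Ia Ib|i _]; first by rewrite -[a]scale1r; apply: IL.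
    by apply: IZ; have [] := fP i.
  apply: (big_ind J) => // [a b Ja Jb|i _]; first by rewrite -[a]scale1r; apply: JL.
  by rewrite -scalerBr; apply: JZ; have [] := fP i.
have uniq v a : I a -> J (v - a) -> p v = a.
  move=> Ia Ja; have [Ip Jp] := pP v; apply/eqP; rewrite -subr_eq0; apply/eqP.
  apply: IJ; first by rewrite addrC -scaleN1r; apply: IL.
  have -> : p v - a = -1 *: (v - p v) + (v - a).
    by rewrite scaleN1r opprB addrA subrK.
  exact: JL.
exists p; split=> [c a b|v|v Iv].
- have [Ia Ja] := pP a; have [Ib Jb] := pP b.
  by apply: uniq; [apply: IL|rewrite opprD addrACA -scalerBr; apply: JL].
- by have [] := pP v.
- by apply: uniq; rewrite ?subrr.
Qed.

Variables (l : nat) (R : algType F) (U : R -> Prop).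
Hypothesis UP : monomial_group l U.
Hypothesis l0 : l%:R != 0 :> F.
Hypothesis Ul : forall u, U u -> exists c : F, u ^+ l = c%:A.
Variable S : seq R.
Hypothesis SU : forall u, u \in S -> U u.
Hypothesis US : forall u, U u -> exists c x, x \in S /\ u = c *: x.

Let average g h (p : R -> R) (b : R) : R :=
  l%:R^-1 *: \sum_(i < l) g ^+ i * p (h ^+ i * b).

Let average_linear g h p : linear p -> linear (average g h p).
Proof.
move=> pL c x y; rewrite /average.
under eq_bigr do rewrite mulrDr -scalerAr pL mulrDr -scalerAr.
by rewrite big_split /= -scaler_sumr scalerDr !scalerA mulrC.
Qed.

(** Multiplication by g shifts the sum cyclically: g^l is a scalar, cancelled by h^l, so the term of
    index l equals the term of index 0. *)
Let average_commute g h p : linear p -> U g -> g * h = 1 -> h * g = 1 ->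
  forall b, average g h p (g * b) = g * average g h p b.
Proof.
move=> pL Ug gh hg b; rewrite /average -scalerAr; congr (_ *: _).
have pZ := raw_linearZ pL.
have hgb i : h ^+ i.+1 * (g * b) = h ^+ i * b.
  by rewrite exprSr -mulrA (mulrA h) hg mul1r.
have ghl : g ^+ l * h ^+ l = 1.
  by rewrite -exprMn_comm ?gh ?expr1n // /GRing.comm gh hg.
have last_term : g ^+ l * p (h ^+ l * (g * b)) = p (g * b).
  have [c cE] := Ul Ug.
  have: c *: h ^+ l = 1 by rewrite -ghl cE mulr_algl.
  by rewrite cE mulr_algl -pZ scalerAl => ->; rewrite mul1r.
pose t i := g ^+ i * p (h ^+ i * (g * b)).
have t0 : t 0%N = p (g * b) by rewrite /t !expr0 !mul1r.
have: \sum_(i < l) t i + t l = t 0%N + \sum_(i < l) t i.+1.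
  transitivity (\sum_(i < l.+1) t i); first by rewrite big_ord_recr.
  by rewrite big_ord_recl.
rewrite {2}/t last_term t0 addrC => /addrI ->.
rewrite mulr_sumr; apply: eq_bigr => i _.
by rewrite /t hgb exprS mulrA.
Qed.

(** The scalar produced when u passes h^i is undone when it passes g^i. Hence averaging over g keeps
    the commutation with u already obtained. *)
Let average_commute_other g h p u :
  linear p -> U g -> U h -> g * h = 1 -> h * g = 1 -> U u ->
  (forall b, p (u * b) = u * p b) ->
  forall b, average g h p (u * b) = u * average g h p b.
Proof.
move=> pL Ug Uh gh hg Uu pu b; rewrite /average -scalerAr; congr (_ *: _).
have pZ := raw_linearZ pL.
rewrite mulr_sumr; apply: eq_bigr => i _.
have [z _ zE] := mgC UP (mgX UP i Uh) Uu.
have ghi : g ^+ i * h ^+ i = 1.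
  by rewrite -exprMn_comm ?gh ?expr1n // /GRing.comm gh hg.
have hgi : h ^+ i * g ^+ i = 1.
  by rewrite -exprMn_comm ?hg ?expr1n // /GRing.comm gh hg.
rewrite mulrA zE -scalerAl pZ -mulrA pu -scalerAr !mulrA scalerAl; congr (_ * _).
rewrite -[RHS]mul1r -ghi -mulrA [h ^+ i * _]mulrA zE -scalerAl -scalerAr.
by rewrite -(mulrA u) hgi mulr1.
Qed.

Lemma mg_semisimple : semisimple R.
Proof.
move=> I [I0 IB Il].
have IZ c b : I b -> I (c *: b) by move=> Ib; rewrite -mulr_algl; apply: Il.
have IL c a b : I a -> I b -> I (c *: a + b).
  by move=> /(IZ c) Ia /(IZ (-1)) /(IB _ _ Ia); rewrite scaleN1r opprK.
have span := mg_cover_span UP US.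
(* Starting from any linear projection onto I, average over the elements of S in turn. As S spans R,
   the outcome is R-linear and its kernel is the complement. *)
have [p [pL pI pid pU]] : exists p : R -> R,
    [/\ linear p, forall v, I (p v), forall v, I v -> p v = v
      & forall u, u \in S -> forall b, p (u * b) = u * p b].
  elim: (S) SU => [|g T IH] TU.
    have [p [pL pI pid]] := subspace_projection span I0 IL.
    by exists p; split.
  have [|p [pL pI pid pT]] := IH; first by move=> u uT; apply: TU; rewrite inE uT orbT.
  have Ug := TU _ (mem_head _ _); have [h Uh [gh hg]] := mgV UP Ug.
  exists (average g h p); split.
  - exact: average_linear.
  - move=> v; apply: IZ; apply: (big_ind I) => // [a b Ia Ib|i _].
      by rewrite -[a]scale1r; apply: IL.
    exact: Il.
  - move=> v Iv; rewrite /average (eq_bigr (fun=> v)).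
      by rewrite sumr_const card_ord -scaler_nat scalerA mulVf ?scale1r.
    move=> i _; rewrite pid; last exact: Il.
    by rewrite mulrA -exprMn_comm ?gh ?expr1n ?mul1r // /GRing.comm gh hg.
  - move=> u; rewrite inE => /orP[/eqP ->|uT].
      exact: average_commute.
    by apply: average_commute_other => //; [apply: TU; rewrite inE uT orbT|exact: pT].
have p0 := raw_linear0 pL; have pZ := raw_linearZ pL.
have pD := raw_linearD pL.
have pR r b : p (r * b) = r * p b.
  have [t tU ->] := mg_span UP r; elim: t tU => [|q t IH] tU.
    by rewrite big_nil !mul0r.
  rewrite big_cons !mulrDl pD IH; last by move=> q' q't; apply: tU; rewrite inE q't orbT.
  congr (_ + _); have [c [x [xS ->]]] := US (tU _ (mem_head _ _)).
  by rewrite scalerA -!scalerAl pZ pU.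
exists (fun v => p v = 0); split.
- split=> // [a b pa pb|r a pa]; last by rewrite pR pa mulr0.
  by rewrite -scaleN1r pD pZ pa pb scaler0 addr0.
- by move=> a Ia; rewrite pid.
- move=> a; exists (p a), (a - p a); split=> //; last by rewrite addrC subrK.
  by rewrite -scaleN1r pD pZ (pid (p a)) // scaleN1r subrr.
Qed.

End Maschke.

(** * Polycyclic decomposition *)

(** The y_i are eigenvectors of conjugation by t with distinct eigenvalues. Repeated conjugation
    gives a relation for every polynomial in the eigenvalues, and the product of the X - lam_j over
    j other than i isolates y_i. *)
Lemma eigen_independent (F : fieldType) (R : algType F) (I : finType)
    (t t' : R) (lam : I -> F) (y : I -> R) :
  t * t' = 1 -> injective lam -> (forall i, t * y i = lam i *: (y i * t)) ->
  \sum_i y i = 0 -> forall i, y i = 0.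
Proof.
move=> tt' lamI ty y0.
have pow0 m : \sum_i lam i ^+ m *: y i = 0.
  elim: m => [|m IH]; first by under eq_bigr do rewrite expr0 scale1r.
  transitivity (t * (\sum_i lam i ^+ m *: y i) * t'); last by rewrite IH mulr0 mul0r.
  rewrite mulr_sumr mulr_suml; apply: eq_bigr => i _.
  by rewrite -scalerAr ty scalerA -exprSr -scalerAl -mulrA tt' mulr1.
have horner0 (P : {poly F}) : \sum_i P.[lam i] *: y i = 0.
  under eq_bigr do rewrite horner_coef scaler_suml.
  rewrite exchange_big big1 // => m _.
  by under eq_bigr do rewrite -scalerA; rewrite -scaler_sumr pow0 scaler0.
move=> i; have := horner0 (\prod_(j | j != i) ('X - (lam j)%:P)).
rewrite (bigD1 i) //= [X in _ + X]big1 ?addr0 => [/eqP|j ji].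
  rewrite scaler_eq0 horner_prod => /orP[/prodf_eq0[j ji]|/eqP //].
  by rewrite hornerXsubC subr_eq0 (inj_eq lamI) eq_sym (negPf ji).
by rewrite horner_prod (bigD1 j) //= hornerXsubC subrr mul0r scale0r.
Qed.

Lemma scale_commX (F : fieldType) (R : algType F) (u v : R) (z : F) m :
  u * v = z *: (v * u) -> u ^+ m * v = z ^+ m *: (v * u ^+ m).
Proof.
move=> uv; elim: m => [|m IH]; first by rewrite !expr0 scale1r mulr1 mul1r.
rewrite exprSr -(mulrA (u ^+ m)) uv -scalerAr (mulrA (u ^+ m)) IH -scalerAl.
by rewrite scalerA -exprS -mulrA.
Qed.

Lemma scale_commXr (F : fieldType) (R : algType F) (u v : R) (z : F) m :
  u * v = z *: (v * u) -> u * v ^+ m = z ^+ m *: (v ^+ m * u).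
Proof.
move=> uv; elim: m => [|m IH]; first by rewrite !expr0 scale1r mulr1 mul1r.
rewrite exprSr (mulrA u) IH -scalerAl -(mulrA _ u) uv -scalerAr scalerA.
by rewrite mulrA -!exprSr.
Qed.

Section CyclicPair.
Variables (F : fieldType) (R : algType F) (d : nat) (w a b : F) (u v : R).
Hypothesis wP : d.-primitive_root w.
Hypotheses (a0 : a != 0) (b0 : b != 0).
Hypotheses (ud : u ^+ d = a%:A) (vd : v ^+ d = b%:A).
Hypothesis uv : u * v = w *: (v * u).

Let d_gt0 : (0 < d)%N. Proof. exact: prim_order_gt0 wP. Qed.
Let w0 : w != 0.
Proof.
apply/eqP => w0; have /eqP := prim_expr_order wP.
by rewrite w0 expr0n gtn_eqF // eq_sym oner_eq0.
Qed.

Definition cyc_mon i j := u ^+ i * v ^+ j.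
Local Notation e := cyc_mon.

Let vu : v * u = w^-1 *: (u * v).
Proof. by rewrite uv scalerA mulVf // scale1r. Qed.

Let u_inv : exists2 u', u * u' = 1 & u' * u = 1.
Proof.
exists (a^-1 *: u ^+ d.-1).
  by rewrite -scalerAr -exprS prednK // ud scalerA mulVf // scale1r.
by rewrite -scalerAl -exprSr prednK // ud scalerA mulVf // scale1r.
Qed.
Let v_inv : exists2 v', v * v' = 1 & v' * v = 1.
Proof.
exists (b^-1 *: v ^+ d.-1).
  by rewrite -scalerAr -exprS prednK // vd scalerA mulVf // scale1r.
by rewrite -scalerAl -exprSr prednK // vd scalerA mulVf // scale1r.
Qed.

Lemma cyc_monM i j i' j' :
  e i j * e i' j' = w^-1 ^+ (j * i') *: e (i + i') (j + j').
Proof.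
rewrite /e -mulrA (mulrA (v ^+ j)).
have -> : v ^+ j * u ^+ i' = w^-1 ^+ (j * i') *: (u ^+ i' * v ^+ j).
  by rewrite exprM (scale_commXr i' (scale_commX j vu)).
by rewrite -scalerAl -scalerAr !exprD !mulrA.
Qed.

Lemma cyc_mon_mod i j :
  e i j = (a ^+ (i %/ d) * b ^+ (j %/ d)) *: e (i %% d) (j %% d).
Proof.
rewrite /e {1}(divn_eq i d) {1}(divn_eq j d) !exprD ![(_ * d)%N]mulnC !exprM ud vd.
by rewrite !exprZn !expr1n !mulr_algl -scalerAl -scalerAr scalerA.
Qed.

(** Conjugation by u separates the exponents j, with eigenvalues w^j, and conjugation by v the
    exponents i, with eigenvalues w^-i. Coefficients may come from the whole centralizer of u and v,
    which later makes the tensor decomposition injective. *)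
Lemma cyc_mon_independent (z : 'I_d -> 'I_d -> R) :
  (forall i j, u * z i j = z i j * u) -> (forall i j, v * z i j = z i j * v) ->
  \sum_j \sum_i z i j * e i j = 0 -> forall i j, z i j = 0.
Proof.
move=> uz vz z0 i j; have [u' uu' u'u] := u_inv; have [v' vv' v'v] := v_inv.
have XK (x x' : R) m : x * x' = 1 -> x' * x = 1 -> x ^+ m * x' ^+ m = 1.
  by move=> xx' x'x; rewrite -exprMn_comm ?xx' ?expr1n // /GRing.comm xx' x'x.
have zj : \sum_i z i j * e i j = 0.
  apply: (eigen_independent (t := u) (lam := fun j : 'I_d => w ^+ j) uu' _ _ z0).
    move=> i1 i2 /eqP; rewrite (eq_prim_root_expr wP) => /eqP.
    by rewrite !modn_small // => /val_inj.
  move=> j'; rewrite mulr_sumr mulr_suml scaler_sumr; apply: eq_bigr => i' _.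
  rewrite mulrA uz -!mulrA scalerAr; congr (_ * _).
  by rewrite /e mulrA -exprS exprSr -!mulrA (scale_commXr _ uv) -scalerAr.
have zj' : \sum_i z i j * u ^+ i = 0.
  move: zj => /(congr1 (fun x => x * v' ^+ j)); rewrite mul0r mulr_suml => zj.
  by rewrite -[RHS]zj; apply: eq_bigr => i' _; rewrite /e -!mulrA XK // mulr1.
have := eigen_independent (t := v) (lam := fun i : 'I_d => w^-1 ^+ i) vv' _ _ zj' i.
move=> zi; have {}zi : z i j * u ^+ i = 0.
  apply: zi => [i1 i2|i'].
    rewrite !exprVn => /invr_inj /eqP; rewrite (eq_prim_root_expr wP) => /eqP.
    by rewrite !modn_small // => /val_inj.
  rewrite mulrA vz -!mulrA scalerAr; congr (_ * _).
  by rewrite -(scale_commXr _ vu).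
by rewrite -[z i j]mulr1 -(XK _ _ i uu' u'u) mulrA zi mul0r.
Qed.

Lemma cyc_mon_scalar_independent (c : 'I_d -> 'I_d -> F) :
  \sum_j \sum_i c i j *: e i j = 0 -> forall i j, c i j = 0.
Proof.
move=> c0 i j; apply/eqP; have: (c i j)%:A = 0 :> R; last first.
  by move=> /eqP; rewrite scaler_eq0 oner_eq0 orbF.
apply: (@cyc_mon_independent (fun i j => (c i j)%:A)).
- by move=> i' j'; rewrite mulr_algl mulr_algr.
- by move=> i' j'; rewrite mulr_algl mulr_algr.
- by under eq_bigr do under eq_bigr do rewrite mulr_algl.
Qed.

Hypothesis spanR : forall r, exists c : 'I_d -> 'I_d -> F,
  r = \sum_j \sum_i c i j *: e i j.

Let coef := projT1 (choice spanR).
Let coefE r : r = \sum_j \sum_i coef r i j *: e i j.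
Proof. exact: (projT2 (choice spanR)). Qed.

Let coef_uniq r (c : 'I_d -> 'I_d -> F) : r = \sum_j \sum_i c i j *: e i j ->
  forall i j, coef r i j = c i j.
Proof.
move=> rE i j; apply/eqP; rewrite -subr_eq0; apply/eqP.
apply: (@cyc_mon_scalar_independent (fun i j => coef r i j - c i j)).
transitivity (r - r); last exact: subrr.
rewrite [X in _ = _ - X]rE [X in _ = X - _](coefE r) -sumrB.
apply: eq_bigr => j' _; rewrite -sumrB.
by apply: eq_bigr => i' _; rewrite scalerBl.
Qed.

(** The monomials u^i v^j form a basis, so a target of the presentation receives a linear map; it is
    multiplicative because the same reordering and reduction rules hold on both sides. *)
Lemma cyc_mon_is_cyclic : is_cyclic_algebra R.
Proof.
exists d, a, b, w, (fun i => if i then u else v); split=> //.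
split; first by split.
move=> C x [xd yd xy].
pose X i j := x true ^+ i * x false ^+ j.
pose f r := \sum_j \sum_i coef r i j *: X i j.
have flin : linear f.
  move=> c r r'; rewrite /f scaler_sumr -big_split; apply: eq_bigr => j _ /=.
  rewrite scaler_sumr -big_split; apply: eq_bigr => i _ /=.
  rewrite (@coef_uniq _ (fun i j => c * coef r i j + coef r' i j)).
    by rewrite scalerDl scalerA.
  rewrite {1}(coefE r) {1}(coefE r') scaler_sumr -big_split; apply: eq_bigr => j' _ /=.
  rewrite scaler_sumr -big_split; apply: eq_bigr => i' _ /=.
  by rewrite scalerDl scalerA.
have wV : w^-1 * w = 1 by rewrite mulVf.
have yx : x false * x true = w^-1 *: (x true * x false).
  by rewrite xy scalerA wV scale1r.
have XM i j i' j' :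
    X i j * X i' j' = w^-1 ^+ (j * i') *: X (i + i')%N (j + j')%N.
  rewrite /X -mulrA (mulrA (x false ^+ j)).
  rewrite (scale_commXr i' (scale_commX j yx)) -exprM.
  by rewrite -scalerAl -scalerAr !exprD !mulrA.
have X_mod i j :
    X i j = (a ^+ (i %/ d) * b ^+ (j %/ d)) *: X (i %% d)%N (j %% d)%N.
  rewrite /X {1}(divn_eq i d) {1}(divn_eq j d) !exprD ![(_ * d)%N]mulnC !exprM xd yd.
  by rewrite !exprZn !expr1n !mulr_algl -scalerAl -scalerAr scalerA.
have fe i j : f (e i j) = X i j.
  rewrite cyc_mon_mod X_mod raw_linearZ //; congr (_ *: _).
  pose i0 := Ordinal (ltn_pmod i d_gt0); pose j0 := Ordinal (ltn_pmod j d_gt0).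
  (* A single monomial is written as a full sum with Kronecker coefficients, so that [coef_uniq]
     reads off its coordinates. *)
  have dE (G : 'I_d -> 'I_d -> C) :
      G i0 j0 = \sum_j \sum_i ((i == i0) && (j == j0))%:R *: G i j.
    rewrite (bigD1 j0) //= [X in _ + X]big1 ?addr0 => [|j' /negPf ->]; last first.
      by rewrite big1 // => i' _; rewrite andbF scale0r.
    rewrite (bigD1 i0) //= !eqxx scale1r big1 ?addr0 // => i' /negPf ->.
    by rewrite scale0r.
  have dE' (G : 'I_d -> 'I_d -> R) :
      G i0 j0 = \sum_j \sum_i ((i == i0) && (j == j0))%:R *: G i j.
    rewrite (bigD1 j0) //= [X in _ + X]big1 ?addr0 => [|j' /negPf ->]; last first.
      by rewrite big1 // => i' _; rewrite andbF scale0r.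
    rewrite (bigD1 i0) //= !eqxx scale1r big1 ?addr0 // => i' /negPf ->.
    by rewrite scale0r.
  rewrite [RHS](dE (fun i j => X i j)); apply: eq_bigr => j' _.
  apply: eq_bigr => i' _.
  by rewrite (coef_uniq (dE' (fun i j => e i j))).
have fM : monoid_morphism f.
  split; first by have := fe 0%N 0%N; rewrite /e /X !expr0 !mulr1.
  move=> r r'; rewrite [in LHS](coefE r) [in LHS](coefE r').
  rewrite mulr_suml (raw_linear_sum flin) [f r in RHS]/f mulr_suml; apply: eq_bigr => j _.
  rewrite !mulr_suml (raw_linear_sum flin); apply: eq_bigr => i _.
  rewrite [in LHS]mulr_sumr (raw_linear_sum flin) mulr_sumr; apply: eq_bigr => j' _.
  rewrite [in LHS]mulr_sumr (raw_linear_sum flin) mulr_sumr; apply: eq_bigr => i' _.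
  rewrite -!scalerAl -!scalerAr !(raw_linearZ flin) cyc_monM (raw_linearZ flin).
  by rewrite fe XM.
pose F1 := GRing.isLinear.Build _ _ _ _ _ flin.
pose F2 := GRing.isMonoidMorphism.Build _ _ _ fM.
pose ff : {lrmorphism R -> C} := HB.pack f F1 F2.
exists ff; split.
  case; last by have := fe 0%N 1%N; rewrite /e /X !expr0 !mul1r !expr1.
  by have := fe 1%N 0%N; rewrite /e /X !expr0 !mulr1 !expr1.
move=> f' f'E r; transitivity (f r) => //.
have f'u : f' u = x true := f'E true; have f'v : f' v = x false := f'E false.
rewrite {1}(coefE r) linear_sum; apply: eq_bigr => j _.
rewrite linear_sum; apply: eq_bigr => i _.
rewrite linearZ /= rmorphM !rmorphXn.
by congr (_ *: (_ ^+ _ * _ ^+ _)); [apply: f'u|apply: f'v].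
Qed.

End CyclicPair.

Lemma scale_comm_div (F : fieldType) (R : algType F) (x g f t : R) (z : F) :
  g * f = 1 -> f * g = 1 -> t * g = z *: (g * t) -> t * x = z *: (x * t) ->
  x * f * t = t * (x * f).
Proof.
move=> gf fg tg tx; rewrite (mulrA t) tx -scalerAl -!mulrA scalerAr; congr (_ * _).
by rewrite -[f * t]mulr1 -gf -!mulrA (mulrA t) tg -scalerAl -scalerAr !mulrA fg mul1r.
Qed.

(** * Splitting off a cyclic tensor factor *)

Section Centralizer.
Variables (F : fieldType) (R : algType F) (u v : R).

Definition centralizer : {pred R} := fun r => (r * u == u * r) && (r * v == v * r).

Lemma centralizerP r : reflect (r * u = u * r /\ r * v = v * r) (r \in centralizer).
Proof. by apply: (iffP andP) => -[/eqP ? /eqP ?]. Qed.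

Lemma centralizer_subalg : subalg_closed centralizer.
Proof.
split=> [|c x y /centralizerP[xu xv] /centralizerP[yu yv]|
          x y /centralizerP[xu xv] /centralizerP[yu yv]];
  apply/centralizerP; split; rewrite ?mul1r ?mulr1 //.
- by rewrite mulrDl mulrDr -scalerAl -scalerAr xu yu.
- by rewrite mulrDl mulrDr -scalerAl -scalerAr xv yv.
- by rewrite -mulrA yu mulrA xu mulrA.
- by rewrite -mulrA yv mulrA xv mulrA.
Qed.
HB.instance Definition _ :=
  GRing.isSubalgClosed.Build F R centralizer centralizer_subalg.

Record centralizerT := Centralizer { cent_val : R; _ : cent_val \in centralizer }.
HB.instance Definition _ := [isSub for cent_val].
HB.instance Definition _ := [Choice of centralizerT by <:].
HB.instance Definition _ := [SubChoice_isSubAlgebra of centralizerT by <:].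
End Centralizer.

Section Decomposition.
Variables (F : fieldType) (l : nat) (R : algType F) (U : R -> Prop).
Hypothesis UP : monomial_group l U.
Variables (d : nat) (w a b : F) (u v : R).
Hypothesis wP : d.-primitive_root w.
Hypotheses (a0 : a != 0) (b0 : b != 0).
Hypotheses (ud : u ^+ d = a%:A) (vd : v ^+ d = b%:A).
Hypothesis uv : u * v = w *: (v * u).
Hypotheses (Uu : U u) (Uv : U v).
Hypothesis u_root : forall x, U x -> exists i : 'I_d, u * x = w ^+ i *: (x * u).
Hypothesis v_root : forall x, U x -> exists i : 'I_d, v * x = w ^+ i *: (x * v).

Local Notation e := (cyc_mon u v).
Local Notation C := (@centralizer F R u v).
Local Notation CT := (centralizerT u v).
Local Notation E := (gen_subalgT (fun r => r = u \/ r = v)).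

Let d_gt0 : (0 < d)%N. Proof. exact: prim_order_gt0 wP. Qed.
Let w0 : w != 0.
Proof.
apply/eqP => w0; have /eqP := prim_expr_order wP.
by rewrite w0 expr0n gtn_eqF // eq_sym oner_eq0.
Qed.
Let vu : v * u = w^-1 *: (u * v).
Proof. by rewrite uv scalerA mulVf // scale1r. Qed.

Let U_e i j : U (e i j).
Proof. by apply: (mgM UP); apply: mgX UP _ _ _. Qed.

(** Some monomial in u and v has the same commutators with u and v as x; dividing x by it leaves an
    element of the centralizer. *)
Lemma mg_factor x : U x -> exists (y : R) (i j : 'I_d),
  [/\ U y, y \in C & x = y * e i j].
Proof.
move=> Ux; have [i ux] := u_root Ux; have [j vx] := v_root Ux.
(* The commutator of v with u^i' is w^-i', which must be w^j; reduction modulo d takes care of j =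
   0. *)
pose i' := Ordinal (ltn_pmod (d - j) d_gt0).
have [f Uf [ef fe]] := mgV UP (U_e i' i).
exists (x * f), i', i; split; first exact: (mgM UP).
- have ue : u * e i' i = w ^+ i *: (e i' i * u).
    rewrite /cyc_mon mulrA -exprS exprSr -!mulrA scalerAr.
    by rewrite -(scale_commXr _ uv).
  have ve : v * e i' i = w ^+ j *: (e i' i * v).
    have -> : w ^+ j = w^-1 ^+ i'.
      rewrite exprVn /= (prim_expr_mod wP).
      apply: (mulIf (x := w ^+ (d - j))); first by rewrite expf_neq0.
      rewrite mulVf ?expf_neq0 // -exprD subnKC ?(prim_expr_order wP) //.
      exact: ltnW.
    rewrite /cyc_mon mulrA (scale_commXr i' vu) -scalerAl -!mulrA.
    by rewrite -exprS exprSr.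
  apply/centralizerP; split.
    exact: scale_comm_div ef fe ue ux.
  exact: scale_comm_div ef fe ve vx.
- by rewrite -mulrA fe mulr1.
Qed.

Lemma mg_expand (s : seq (F * R)) : (forall p, p \in s -> U p.2) ->
  exists t : 'I_d -> 'I_d -> seq (F * R),
    (forall i j p, p \in t i j -> U p.2 /\ p.2 \in C) /\
    \sum_(p <- s) p.1 *: p.2
      = \sum_j \sum_i (\sum_(p <- t i j) p.1 *: p.2) * e i j.
Proof.
elim: s => [|p s IH] sU.
  exists (fun _ _ => [::]); split=> //.
  rewrite big_nil big1 // => j _; rewrite big1 // => i _.
  by rewrite mul0r.
have [|t [tU tE]] := IH; first by move=> q qs; apply: sU; rewrite inE qs orbT.
have [y [i0 [j0 [Uy yC pE]]]] := mg_factor (sU _ (mem_head _ _)).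
exists (fun i j => if (i == i0) && (j == j0) then (p.1, y) :: t i j else t i j).
split=> [i j q|].
  by case: ifP => _; rewrite ?inE; [case/orP => [/eqP -> //|]|]; apply: tU.
rewrite big_cons tE (bigD1 j0) //= [in RHS](bigD1 j0) //= addrA; congr (_ + _).
  rewrite (bigD1 i0) //= [in RHS](bigD1 i0) //= addrA !eqxx /= big_cons /=.
  rewrite mulrDl -scalerAl -pE; congr (_ + _).
  by apply: eq_bigr => i /negPf ->.
by apply: eq_bigr => j /negPf nj; apply: eq_bigr => i _; rewrite nj andbF.
Qed.

Let E_mem i j : e i j \in gen_subalg (fun r => r = u \/ r = v).
Proof.
by apply: rpredM; apply: rpredX; apply/asboolP => S _ SX; apply: SX; [left|right].
Qed.

Let E_span (y : E) : exists c : 'I_d -> 'I_d -> F,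
  val y = \sum_j \sum_i c i j *: e i j.
Proof.
pose S : {pred R} := fun r => `[< exists s : seq (F * (nat * nat)),
  r = \sum_(p <- s) p.1 *: e p.2.1 p.2.2 >].
have SS : subalg_closed S.
  split=> [|c x y' /asboolP[s ->] /asboolP[t ->]|x y' /asboolP[s ->] /asboolP[t ->]];
    apply/asboolP.
  - exists [:: (1, (0%N, 0%N))].
    by rewrite big_seq1 /cyc_mon !expr0 mulr1 scale1r.
  - exists ([seq (c * p.1, p.2) | p <- s] ++ t).
    rewrite big_cat big_map scaler_sumr; congr (_ + _).
    by apply: eq_bigr => p _; rewrite scalerA.
  - exists [seq (p.1 * q.1 * w^-1 ^+ (p.2.2 * q.2.1),
      ((p.2.1 + q.2.1)%N, (p.2.2 + q.2.2)%N)) | p <- s, q <- t].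
    rewrite big_allpairs_dep mulr_suml; apply: eq_bigr => p _.
    rewrite mulr_sumr; apply: eq_bigr => q _ /=.
    by rewrite -scalerAl -scalerAr (cyc_monM wP) // !scalerA.
have Sy : val y \in S.
  apply: (asboolW (valP y)) => // x [->|->]; apply/asboolP.
    by exists [:: (1, (1%N, 0%N))]; rewrite big_seq1 /cyc_mon expr0 expr1 mulr1 scale1r.
  by exists [:: (1, (0%N, 1%N))]; rewrite big_seq1 /cyc_mon expr0 expr1 mul1r scale1r.
have /asboolP[s ->] := Sy.
elim: s => [|p s [c IH]].
  exists (fun _ _ => 0); rewrite big_nil big1 // => j _.
  by rewrite big1 // => i _; rewrite scale0r.
pose i0 := Ordinal (ltn_pmod p.2.1 d_gt0); pose j0 := Ordinal (ltn_pmod p.2.2 d_gt0).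
pose c0 := a ^+ (p.2.1 %/ d) * b ^+ (p.2.2 %/ d).
exists (fun i j => (if (i == i0) && (j == j0) then p.1 * c0 else 0) + c i j).
rewrite big_cons IH.
under [RHS]eq_bigr do under eq_bigr do rewrite scalerDl.
under [RHS]eq_bigr do rewrite big_split.
rewrite big_split /=; congr (_ + _).
rewrite (bigD1 j0) //= [X in _ + X]big1 ?addr0 => [|j /negPf ->]; last first.
  by rewrite big1 // => i _; rewrite andbF scale0r.
rewrite (bigD1 i0) //= !eqxx big1 ?addr0 => [|i /negPf ->]; last by rewrite scale0r.
by rewrite (cyc_mon_mod ud vd) scalerA.
Qed.

Lemma gen_pair_cyclic : is_cyclic_algebra E.
Proof.
have uE : u \in gen_subalg (fun r => r = u \/ r = v).
  by apply/asboolP => S _ SX; apply: SX; left.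
have vE : v \in gen_subalg (fun r => r = u \/ r = v).
  by apply/asboolP => S _ SX; apply: SX; right.
pose u' : E := GenSubalg uE; pose v' : E := GenSubalg vE.
apply: (@cyc_mon_is_cyclic F E d w a b u' v') => //.
- by apply: val_inj; rewrite rmorphXn; exact: ud.
- by apply: val_inj; rewrite rmorphXn; exact: vd.
- by apply: val_inj; exact: uv.
- move=> r; have [c rE] := E_span r; exists c; apply: val_inj; rewrite rE.
  rewrite linear_sum; apply: eq_bigr => j _; rewrite linear_sum; apply: eq_bigr => i _.
  by rewrite linearZ /cyc_mon rmorphM !rmorphXn.
Qed.

Let centralizer_gen (x : CT) (y : E) : val x * val y = val y * val x.
Proof.
have /centralizerP[xu xv] := valP x.
have [c ->] := E_span y; rewrite mulr_sumr mulr_suml; apply: eq_bigr => j _.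
rewrite mulr_sumr mulr_suml; apply: eq_bigr => i _.
rewrite -scalerAl -scalerAr; congr (_ *: _).
have comX (t : R) m : val x * t = t * val x -> val x * t ^+ m = t ^+ m * val x.
  by move=> xt; have /(commrX m) : GRing.comm (val x) t by [].
by rewrite /cyc_mon mulrA comX // -!mulrA comX.
Qed.

Let mul_val (x : CT) (y : E) : R := val x * val y.

Let mul_val_bilin : bilin mul_val.
Proof.
split=> [x|y] c y1 y2.
  transitivity (val x * val (c *: y1 + y2)) => //.
  by rewrite linearP mulrDr -scalerAr.
transitivity (val (c *: y1 + y2) * val y) => //.
by rewrite linearP mulrDl -scalerAl.
Qed.

Let tens_mul : tens CT E -> R := tlift mul_val.

Let tens_mul_pure x y : tens_mul (x ⊗ y) = val x * val y.
Proof. exact: (tlift_pure mul_val_bilin). Qed.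

Lemma tens_mul_alghom : alghom tens_mul.
Proof.
split; first exact: (tlift_linear mul_val_bilin).
split=> [|x y]; first by rewrite [LHS]tens_mul_pure !rmorph1 mulr1.
have [s ->] := tens_pures x; have [t ->] := tens_pures y.
have sumE := raw_linear_sum (tlift_linear mul_val_bilin).
rewrite /tens_mul [in LHS]mulr_suml !sumE mulr_suml; apply: eq_bigr => p _.
rewrite [in LHS]mulr_sumr sumE mulr_sumr; apply: eq_bigr => q _.
have -> : (p.1 ⊗ p.2) * (q.1 ⊗ q.2) = (p.1 * q.1) ⊗ (p.2 * q.2).
  apply: tens_ext => W f bf; rewrite tlift_tmul // !tlift_pure //.
    by apply: mul_bilin_r.
  exact: mul_bilin_l.
rewrite !(tlift_pure mul_val_bilin) /mul_val !rmorphM.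
by rewrite -!mulrA; congr (_ * _); rewrite !mulrA centralizer_gen.
Qed.

Let eE i j : E := GenSubalg (E_mem i j).

(** Spanning is the point. Expanding x along the monomials in u and v gives coefficients that are
    sums of monomials of the centralizer; since x itself centralizes u and v, independence
    identifies it with the coefficient of 1. *)
Lemma centralizer_monomial_group :
  monomial_group l (fun x : CT => U (val x)).
Proof.
split.
- by rewrite rmorph1; apply: mg1 UP.
- by move=> x y Ux Uy; rewrite rmorphM; apply: (mgM UP).
- move=> x /(mgV UP)[y Uy [xy yx]]; have /centralizerP[xu xv] := valP x.
  have inv_comm t : val x * t = t * val x -> y * t = t * y.
    by move=> xt; rewrite -[y * t]mulr1 -xy -!mulrA (mulrA t) -xt !mulrA yx mul1r.
  have yC : y \in C by apply/centralizerP; split; apply: inv_comm.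
  by exists (Centralizer yC) => //; split; apply: val_inj.
- move=> x y Ux Uy; have [z zl zE] := mgC UP Ux Uy; exists z => //.
  exact: val_inj.
- move=> x; have [s sU xE] := mg_span UP (val x).
  have [t [tU tE]] := mg_expand sU.
  pose i0 := Ordinal d_gt0.
  have tC i j : \sum_(p <- t i j) p.1 *: p.2 \in C.
    by rewrite big_seq rpred_sum // => p /tU[_ pC]; rewrite rpredZ.
  have xt : val x = \sum_(p <- t i0 i0) p.1 *: p.2.
    pose z i j := \sum_(p <- t i j) p.1 *: p.2
      - (if (i == i0) && (j == i0) then val x else 0).
    have zC i j : z i j \in C.
      by rewrite rpredB // ; case: ifP => _; [apply: valP|apply: rpred0].
    have z0 : \sum_j \sum_i z i j * e i j = 0.
      transitivity (val x - val x); last exact: subrr.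
      rewrite {1}xE tE.
      transitivity (\sum_j (\sum_i (\sum_(p <- t i j) p.1 *: p.2) * e i j
        - if j == i0 then val x else 0)).
        apply: eq_bigr => j _.
        transitivity (\sum_i ((\sum_(p <- t i j) p.1 *: p.2) * e i j
          - (if (i == i0) && (j == i0) then val x else 0) * e i j)).
          by apply: eq_bigr => i _; rewrite mulrBl.
        rewrite sumrB; congr (_ - _); rewrite (bigD1 i0) //= ?eqxx big1 ?addr0.
          case: eqP => [->|]; last by rewrite mul0r.
          by rewrite /cyc_mon !expr0 !mulr1.
        by move=> i /negPf ->; rewrite mul0r.
      rewrite sumrB; congr (_ - _); rewrite (bigD1 i0) //= ?eqxx big1 ?addr0 //.
      by move=> j /negPf ->.
    have := cyc_mon_independent wP a0 b0 ud vd uv _ _ z0 i0 i0.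
    rewrite /z !eqxx /= => z00; apply/eqP; rewrite eq_sym -subr_eq0; apply/eqP.
    by apply: z00 => i j; have /centralizerP[] := zC i j.
  have [s' s'E s't] : exists2 s' : seq (F * CT),
      (forall p, p \in s' -> U (val p.2))
      & \sum_(p <- t i0 i0) p.1 *: p.2 = \sum_(p <- s') p.1 *: val p.2.
    elim: (t i0 i0) (tU i0 i0) => [|p r IH] rU.
      by exists [::]; rewrite ?big_nil.
    have [|s' s'U s'E] := IH; first by move=> q qr; apply: rU; rewrite inE qr orbT.
    have [Up pC] := rU _ (mem_head _ _).
    exists ((p.1, Centralizer pC) :: s'); last by rewrite !big_cons s'E.
    by move=> q; rewrite inE => /orP[/eqP ->|/s'U].
  exists s' => //; apply: val_inj; rewrite xt s't linear_sum.
  by apply: eq_bigr => p _; rewrite linearZ.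
Qed.

(** Injectivity is the independence of the u^i v^j over the centralizer, surjectivity is
    [mg_factor]. *)
Lemma tens_mul_bij : bijective tens_mul.
Proof.
have [tL tM] := tens_mul_alghom; apply: inj_surj_bij => [x y xy|r].
- apply/eqP; rewrite -subr_eq0; apply/eqP.
  have: tens_mul (x - y) = 0.
    by rewrite -scaleN1r addrC tL xy scaleN1r addNr.
  have [s ->] := tens_pures (x - y).
  have [c cE] := choice E_span.
  have pE (p : CT * E) :
      p.1 ⊗ p.2 = \sum_j \sum_i (c p.2 i j *: p.1) ⊗ eE i j.
    have {1}-> : p.2 = \sum_j \sum_i c p.2 i j *: eE i j.
      apply: val_inj; rewrite cE linear_sum; apply: eq_bigr => j _.
      by rewrite linear_sum; apply: eq_bigr => i _; rewrite linearZ.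
    rewrite pure_sumr; apply: eq_bigr => j _; rewrite pure_sumr.
    by apply: eq_bigr => i _; rewrite pureZl pureZr.
  have -> : \sum_(p <- s) p.1 ⊗ p.2
      = \sum_(j < d) \sum_(i < d) (\sum_(p <- s) c p.2 i j *: p.1) ⊗ eE i j.
    under eq_bigr do rewrite pE; rewrite exchange_big; apply: eq_bigr => j _.
    by rewrite exchange_big; apply: eq_bigr => i _; rewrite pure_suml.
  rewrite (raw_linear_sum tL) => z0; rewrite big1 // => j _; rewrite big1 // => i _.
  suff -> : \sum_(p <- s) c p.2 i j *: p.1 = 0 by rewrite pure0l.
  apply: val_inj; rewrite rmorph0.
  apply: (cyc_mon_independent wP a0 b0 ud vd uv
    (z := fun i j => val (\sum_(p <- s) c p.2 i j *: p.1))).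
  + by move=> i' j'; case/centralizerP: (valP (\sum_(p <- s) c p.2 i' j' *: p.1)).
  + by move=> i' j'; case/centralizerP: (valP (\sum_(p <- s) c p.2 i' j' *: p.1)).
  + rewrite -[RHS]z0; apply: eq_bigr => j' _; rewrite (raw_linear_sum tL).
    by apply: eq_bigr => i' _; rewrite tens_mul_pure.
- have [s sU ->] := mg_span UP r; elim: s sU => [|p s IH] sU.
    by exists 0; rewrite big_nil (raw_linear0 tL).
  have [|x xE] := IH; first by move=> q qs; apply: sU; rewrite inE qs orbT.
  have [y [i [j [Uy yC pE]]]] := mg_factor (sU _ (mem_head _ _)).
  exists (p.1 *: (Centralizer yC ⊗ eE i j) + x).
  by rewrite tL xE big_cons tens_mul_pure pE.
Qed.

Lemma mg_decomposition : polycyclic CT -> polycyclic R.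
Proof.
move=> pC; apply: (polycyclic_tens (h := tens_mul) pC gen_pair_cyclic).
  exact: tens_mul_alghom.
exact: tens_mul_bij.
Qed.

End Decomposition.

(* When the commutators are not all trivial, let N be their least common
   exponent and p a prime factor of N, with N = m d and d the p-part of N.  Some
   commutator z of u0 and v0 satisfies z ^ (N / p) <> 1, and then u0 ^ m and
   v0 ^ m generate a cyclic algebra of degree d, which splits off because the
   commutators of these two elements with U are powers of theirs. *)
Lemma mg_polycyclic (F : fieldType) (l : nat) (l_gt0 : (0 < l)%N) (R : algType F)
    (U : R -> Prop) (S : seq R) :
  monomial_group l U ->
  (forall x, U x -> exists c y, y \in S /\ x = c *: y) ->
  (forall x, U x -> x \in @center F R -> exists c : F, x = c%:A) ->
  polycyclic R.
Proof.
(* The induction is on the size of a list S representing U modulo scalars, which drops on passing to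
   the centralizer. *)
have [n] := ubnP (size S); elim: n R U S => // n IH R U S Sn.
move=> UP US UC.
(* Here all monomials are central, hence scalars, and R is the cyclic algebra of degree 1 over F. *)
have [comm|] := pselect (forall x y, U x -> U y -> x * y = y * x).
  apply: polycyclic_cyclic; apply: (@cyc_mon_is_cyclic F R 1 1 1 1 1 1).
  - by apply/forallP => i; rewrite ord1 unity_rootE expr1n eqxx.
  - exact: oner_neq0.
  - exact: oner_neq0.
  - by rewrite expr1n scale1r.
  - by rewrite expr1n scale1r.
  - by rewrite scale1r.
  move=> r; have [s sU ->] := mg_span UP r.
  have [c cE] : exists c : F, \sum_(p <- s) p.1 *: p.2 = c%:A.
    elim: s sU => [|p s IHs] sU; first by exists 0; rewrite big_nil scale0r.
    have [|c cE] := IHs; first by move=> q qs; apply: sU; rewrite inE qs orbT.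
    have Up := sU _ (mem_head _ _).
    have [|c' c'E] := UC _ Up.
      by apply: (mg_commute_center UP) => v Uv; apply: comm.
    by exists (p.1 * c' + c); rewrite big_cons cE c'E scalerA scalerDl.
  exists (fun _ _ => c); rewrite !big_ord1 cE /cyc_mon !expr1n mulr1 //.
move=> ncomm.
pose expo N := (0 < N)%N && `[< forall x y z, U x -> U y ->
   x * y = z *: (y * x) -> z ^+ N = 1 >].
have ex_expo : exists N, expo N.
  exists l; rewrite /expo l_gt0; apply/asboolP => x y z Ux Uy xy.
  have [z' z'l xy'] := mgC UP Ux Uy.
  by rewrite (mg_scale_inj UP Ux Uy xy xy').
case: (ex_minnP ex_expo) => N /andP[N_gt0 /asboolP NP] Nmin.
have N_gt1 : (1 < N)%N.
  rewrite ltn_neqAle N_gt0 andbT; apply/eqP => N1; apply: ncomm => x y Ux Uy.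
  have [z _ xy] := mgC UP Ux Uy; have := NP _ _ _ Ux Uy xy.
  by rewrite -N1 expr1 => z1; rewrite xy z1 scale1r.
have pP := pdiv_prime N_gt1; set p := pdiv N in pP.
have [m pm NE] := pfactor_coprime pP N_gt0; set e := logn p N in NE.
have e_gt0 : (0 < e)%N by rewrite logn_gt0 mem_primes pP N_gt0 pdiv_dvd.
have m_gt0 : (0 < m)%N by move: N_gt0; rewrite NE; case: (m).
have [u0 [v0 [z0 [Uu0 Uv0 uv0 z0N]]]] : exists u0 v0 z0,
    [/\ U u0, U v0, u0 * v0 = z0 *: (v0 * u0) & z0 ^+ (m * p ^ e.-1) != 1].
  apply: contrapT => no.
  have /Nmin : expo (m * p ^ e.-1)%N.
    rewrite /expo muln_gt0 m_gt0 expn_gt0 prime_gt0 //=; apply/asboolP.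
    move=> x y z Ux Uy xy; apply/eqP; apply: contrapT => /negP zN.
    by apply: no; exists x, y, z.
  rewrite NE leq_pmul2l // leqNgt => /negP; apply.
  by rewrite ltn_exp2l ?prime_gt1 // prednK.
pose d := (p ^ e)%N; pose u := u0 ^+ m; pose v := v0 ^+ m.
have Uu : U u by apply: mgX UP _ _ _.
have Uv : U v by apply: mgX UP _ _ _.
(* The order of z0^m divides p^e, and by the choice of z0 it does not divide p^(e-1). *)
have zetaP : d.-primitive_root (z0 ^+ m).
  have zd : (z0 ^+ m) ^+ d = 1 by rewrite -exprM -NE (NP _ _ _ Uu0 Uv0 uv0).
  have d_gt0 : (0 < d)%N by rewrite expn_gt0 prime_gt0.
  have [d' d'P d'd] := prim_order_exists d_gt0 zd.
  have [f fe d'E] := dvdn_pfactor _ _ pP d'd.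
  suff fE : f = e by rewrite /d -fE -d'E.
  apply/eqP; rewrite eqn_leq fe leqNgt; apply: contra z0N => lt_fe.
  rewrite exprM -(prim_order_dvd d'P) d'E dvdn_exp2l //.
  by rewrite -ltnS prednK.
(* Both u and v carry the exponent m, so m enters twice; the second power keeps the root primitive
   because m is prime to d. *)
pose w := (z0 ^+ m) ^+ m.
have wP : d.-primitive_root w.
  by rewrite prim_root_exp_coprime // coprime_sym coprimeXl.
have uv : u * v = w *: (v * u).
  by rewrite /u /v (scale_commXr _ (scale_commX _ uv0)).
have root_of (t : R) : U t -> forall x, U x ->
    exists i : 'I_d, t ^+ m * x = w ^+ i *: (x * t ^+ m).
  move=> Ut x Ux; have [z _ tx] := mgC UP Ut Ux.
  have zd : (z ^+ m) ^+ d = 1 by rewrite -exprM -NE (NP _ _ _ Ut Ux tx).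
  have [i iE] := prim_rootP wP zd; exists i.
  by rewrite -iE; apply: scale_commX.
have pow_scalar (t : R) : U t -> exists2 c : F, c != 0 & (t ^+ m) ^+ d = c%:A.
  move=> Ut; have Utd := mgX UP (m * d) Ut.
  have [|c cE] := UC _ Utd.
    apply: (mg_commute_center UP) => x Ux; have [z _ tx] := mgC UP Ut Ux.
    by rewrite (scale_commX _ tx) -NE (NP _ _ _ Ut Ux tx) scale1r.
  exists c; last by rewrite -exprM.
  apply: contraTneq (mg_neq0 UP Utd) => c0.
  by rewrite cE c0 scale0r eqxx.
have [a a0 ud] := pow_scalar _ Uu0; have [b b0 vd] := pow_scalar _ Uv0.
have u_root := root_of _ Uu0; have v_root := root_of _ Uv0.
have CP := centralizer_monomial_group UP wP a0 b0 ud vd uv Uu Uv u_root v_root.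
apply: (mg_decomposition UP wP a0 b0 ud vd uv Uu Uv u_root v_root).
pose S' : seq (centralizerT u v) := pmap insub S.
have inC c x : c != 0 -> c *: x \in centralizer u v -> x \in centralizer u v.
  by move=> c0 xC; rewrite -[x]scale1r -(mulVf c0) -scalerA rpredZ.
apply: (IH _ _ S' _ CP).
(* The representative of u is lost: u does not commute with v, as w differs from 1. *)
- rewrite /S' size_pmap_sub.
  rewrite -ltnS; apply: leq_trans Sn; rewrite ltnS -[X in (_ < X)%N](count_predC (mem (centralizer u v))).
  rewrite -[X in (X < _)%N]addn0 ltn_add2l -has_count.
  have [c [x [xS uE]]] := US _ Uu; apply/hasP; exists x => //=.
  apply/negP => xC; have: c *: x \in centralizer u v by rewrite rpredZ.
  rewrite -uE => /centralizerP[_].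
  rewrite uv.
  move=> vu; have /eqP : (w - 1) *: (v * u) = 0 by rewrite scalerBl scale1r vu subrr.
  rewrite scaler_eq0 (negPf (mg_neq0 UP (mgM UP Uv Uu))) orbF subr_eq0 => /eqP w1.
  have := eq_prim_root_expr wP 1 0; rewrite expr1 expr0 w1 eqxx mod0n modn_small //.
  by rewrite -[1%N](expn0 p) ltn_exp2l ?prime_gt1.
- move=> x Ux; have [c [y [yS xE]]] := US _ Ux.
  have c0 : c != 0.
    by apply: contraTneq (mg_neq0 UP Ux) => c0; rewrite xE c0 scale0r eqxx.
  have yC : y \in centralizer u v by apply: (inC c) => //; rewrite -xE; apply: valP.
  exists c, (Centralizer yC); split; last by apply: val_inj; rewrite xE linearZ.
  by rewrite mem_pmap_sub.
(* Such an x commutes with the centralizer and with u and v, hence with all of U by [mg_factor], and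
   is central in R. *)
- move=> x Ux /centerP xc; have [|c cE] := UC _ Ux.
    apply: (mg_commute_center UP) => t /(mg_factor UP wP uv Uu Uv u_root v_root).
    move=> [y [i [j [Uy yC ->]]]]; have /centralizerP[xu xv] := valP x.
    have comX (r : R) k : val x * r = r * val x -> val x * r ^+ k = r ^+ k * val x.
      by move=> xr; have /(commrX k) : GRing.comm (val x) r by [].
    have xy : val x * y = y * val x := congr1 val (xc (Centralizer yC)).
    apply: esym; rewrite mulrA xy /cyc_mon -!mulrA; congr (_ * _).
    by rewrite mulrA comX // -mulrA comX.
  by exists c; apply: val_inj; rewrite cE linearZ rmorph1.
Qed.

(** * Quantum tori and their units *)

Section UpToRoots.
Variables (F : fieldType) (l : nat) (R : algType F).
Hypothesis l_gt0 : (0 < l)%N.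

(** Computing up to l-th roots of unity avoids tracking the products of the q_ij that arise when
    monomials are reordered. *)
Definition eq_root (u v : R) := exists2 z : F, z ^+ l = 1 & u = z *: v.
Local Notation "u ~ v" := (eq_root u v) (at level 70).

Lemma root_neq0 (z : F) : z ^+ l = 1 -> z != 0.
Proof.
move=> zl; apply/eqP => z0; have /eqP := zl.
by rewrite z0 expr0n gtn_eqF // eq_sym oner_eq0.
Qed.

Lemma eq_root_refl u : u ~ u.
Proof. by exists 1; rewrite ?expr1n ?scale1r. Qed.
Lemma eq_root_sym u v : u ~ v -> v ~ u.
Proof.
move=> [z zl ->]; exists z^-1; first by rewrite exprVn zl invr1.
by rewrite scalerA mulVf ?scale1r ?root_neq0.
Qed.
Lemma eq_root_trans u v w : u ~ v -> v ~ w -> u ~ w.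
Proof.
move=> [z zl ->] [z' zl' ->]; exists (z * z'); first by rewrite exprMn zl zl' mulr1.
by rewrite scalerA.
Qed.
Lemma eq_rootM u u' v v' : u ~ u' -> v ~ v' -> u * v ~ u' * v'.
Proof.
move=> [z zl ->] [z' zl' ->]; exists (z * z'); first by rewrite exprMn zl zl' mulr1.
by rewrite -scalerAl -scalerAr scalerA.
Qed.

Definition root_comm u v := u * v ~ v * u.

Lemma root_commC u v : root_comm u v -> root_comm v u.
Proof. exact: eq_root_sym. Qed.
Lemma root_comm1 u : root_comm u 1.
Proof. by rewrite /root_comm mulr1 mul1r; apply: eq_root_refl. Qed.
Lemma root_commM u v w : root_comm u v -> root_comm u w -> root_comm u (v * w).
Proof.
move=> uv uw; rewrite /root_comm mulrA.
apply: eq_root_trans (eq_rootM uv (eq_root_refl w)) _.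
rewrite -!mulrA; exact: eq_rootM (eq_root_refl v) uw.
Qed.
Lemma root_commX u v m : root_comm u v -> root_comm u (v ^+ m).
Proof.
move=> uv; elim: m => [|m IH]; first exact: root_comm1.
by rewrite exprS; apply: root_commM.
Qed.
Lemma root_commV u v v' : v * v' = 1 -> v' * v = 1 ->
  root_comm u v -> root_comm u v'.
Proof.
move=> vv' v'v [z zl uv]; apply: eq_root_sym; exists z => //.
by rewrite -[v' * u]mulr1 -vv' -mulrA (mulrA u) uv -scalerAl -scalerAr !mulrA v'v mul1r.
Qed.
Lemma root_comm_prod (I : Type) (r : seq I) u (G : I -> R) :
  (forall i, root_comm u (G i)) -> root_comm u (\prod_(i <- r) G i).
Proof.
move=> uG; apply: (big_ind (root_comm u)) => //; first exact: root_comm1.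
exact: root_commM.
Qed.

Lemma eq_root_prodM (I : Type) (r : seq I) (G H : I -> R) :
  (forall i j, root_comm (G i) (H j)) ->
  (\prod_(i <- r) G i) * (\prod_(i <- r) H i) ~ \prod_(i <- r) (G i * H i).
Proof.
move=> GH; elim: r => [|i r IH].
  by rewrite !big_nil mulr1; apply: eq_root_refl.
rewrite !big_cons.
apply: eq_root_trans (eq_rootM (eq_root_refl (G i * H i)) IH).
rewrite -!mulrA; apply: eq_rootM; first exact: eq_root_refl.
rewrite !mulrA; apply: eq_rootM; last exact: eq_root_refl.
apply: root_commC; apply: root_comm_prod => j.
by apply: root_commC; apply: GH.
Qed.

End UpToRoots.

Section QuantumTorus.
Variables (F : fieldType) (n l : nat) (q : 'M[F]_n) (B : algType F).
Variable x : 'I_n + 'I_n -> B.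
Hypothesis l_gt0 : (0 < l)%N.
Hypothesis ql : forall i j, q i j ^+ l = 1.
Hypothesis xP : is_qtorus q x.

Local Notation "u ~ v" := (eq_root l u v) (at level 70).
Local Notation ffunZ := {ffun 'I_n -> int}.

Let xV i : x (inl i) * x (inr i) = 1. Proof. by have [[/(_ i)[]]] := xP. Qed.
Let Vx i : x (inr i) * x (inl i) = 1. Proof. by have [[/(_ i)[]]] := xP. Qed.

(** The presentation gives a map from B to the subalgebra generated by the x_g. Followed by the
    inclusion it fixes the generators, so by uniqueness it is the identity. *)
Lemma qtorus_generated b : b \in gen_subalg (fun b => exists g, b = x g).
Proof.
pose S : algType F := gen_subalgT (fun b => exists g, b = x g).
have xS g : x g \in gen_subalg (fun b => exists g, b = x g).
  by apply/asboolP => T _ XT; apply: XT; exists g.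
pose y g : S := GenSubalg (xS g).
have [[relV relC] univ] := xP.
have relS : qtorus_rel q y.
  split=> [i|i j]; last by apply: val_inj; exact: relC.
  by split; apply: val_inj; [exact: (relV i).1|exact: (relV i).2].
have [f [fy _]] := univ S y relS.
have [f0 [_ f0U]] := univ B x (conj relV relC).
pose v b : B := gen_val (f b).
have vL : linear v by move=> c u w; rewrite /v linearP.
have vM : monoid_morphism v by split=> [|u w]; rewrite /v ?rmorph1 ?rmorphM.
pose vL' := GRing.isLinear.Build _ _ _ _ _ vL.
pose vM' := GRing.isMonoidMorphism.Build _ _ _ vM.
pose g : {lrmorphism B -> B} := HB.pack v vL' vM'.
have gE : g =1 f0 by apply: f0U => h; rewrite /= /v fy.
have idE : (idfun : {lrmorphism B -> B}) =1 f0 by apply: f0U.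
have -> : b = val (f b) by rewrite [LHS](idE b) -gE.
exact: valP.
Qed.

Definition xpow i (z : int) : B :=
  match z with Posz m => x (inl i) ^+ m | Negz m => x (inr i) ^+ m.+1 end.

Lemma xpowS i z : xpow i (z + 1) = xpow i z * x (inl i).
Proof.
case: z => [m|[|m]]; first by rewrite -PoszD addn1 /= exprSr.
  by rewrite NegzE addNr /= expr0 expr1 Vx.
rewrite (_ : Negz m.+1 + 1 = Negz m) /=; last by rewrite !NegzE -addn1 PoszD opprD subrK.
by rewrite [in RHS]exprSr -mulrA Vx mulr1.
Qed.

Lemma xpowP i z : xpow i (z - 1) = xpow i z * x (inr i).
Proof.
by rewrite -[in RHS](subrK 1 z) xpowS -mulrA xV mulr1.
Qed.

Lemma xpowD i a b : xpow i (a + b) = xpow i a * xpow i b.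
Proof.
elim: b => [|m IH|m IH]; first by rewrite addr0 /= expr0 mulr1.
  by rewrite -addn1 PoszD addrA !xpowS IH mulrA.
by rewrite -addn1 PoszD opprD addrA !xpowP IH mulrA.
Qed.

Definition xmon (a : ffunZ) : B := \prod_(i < n) xpow i (a i).

Let x_comm g h : root_comm l (x g) (x h).
Proof.
have ll i j : root_comm l (x (inl i)) (x (inl j)).
  by exists (q i j) => //; have [[_ ->]] := xP.
have lr i j : root_comm l (x (inl i)) (x (inr j)).
  exact: (root_commV l_gt0 (xV j) (Vx j) (ll i j)).
have rr i j : root_comm l (x (inr i)) (x (inr j)).
  apply: root_commC => //; apply: (root_commV l_gt0 (xV i) (Vx i)).
  by apply: root_commC => //; apply: lr.
by case: g h => [i|i] [j|j] //; apply: root_commC => //; apply: lr.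
Qed.

Let xpow_comm i a j b : root_comm l (xpow i a) (xpow j b).
Proof.
by case: a => m; case: b => m'; apply: root_commX => //; apply: root_commC => //;
  apply: root_commX.
Qed.

Lemma xmonD a b : xmon a * xmon b ~ xmon (a + b).
Proof.
have := eq_root_prodM l_gt0 (index_enum 'I_n)
  (fun i j => xpow_comm i (a i) j (b j)).
rewrite /xmon; under [X in _ ~ X -> _]eq_bigr do rewrite -xpowD.
by under [X in _ -> _ ~ X]eq_bigr do rewrite ffunE.
Qed.

Lemma xmon0 : xmon 0 = 1.
Proof. by apply: big1 => i _; rewrite ffunE. Qed.

Lemma xmon_gen g : exists a, x g = xmon a.
Proof.
have H i z : xmon [ffun j => if j == i then z else 0] = xpow i z.
  rewrite /xmon (eq_bigr (fun j => if j == i then xpow j z else 1)).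
    by rewrite -big_mkcond big_pred1_eq.
  by move=> j _; rewrite ffunE; case: eqP.
case: g => i; first by exists [ffun j => if j == i then 1 else 0]; rewrite H /= expr1.
by exists [ffun j => if j == i then -1 else 0]; rewrite H /= expr1.
Qed.

Definition monomial b := exists a, b ~ xmon a.

(** [xmonD] gives a right inverse, which is a left inverse up to a scalar; cancelling [xmon a] shows
    that the scalar is 1. *)
Lemma xmon_inv a : exists2 b, monomial b & xmon a * b = 1 /\ b * xmon a = 1.
Proof.
have [z zl zE] := xmonD a (- a); have [z' zl' zE'] := xmonD (- a) a.
have z0 := root_neq0 l_gt0 zl.
have u1 : xmon a * (z^-1 *: xmon (- a)) = 1.
  by rewrite -scalerAr zE subrr xmon0 scalerA mulVf ?scale1r.
exists (z^-1 *: xmon (- a)).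
  by exists (- a), z^-1; rewrite // exprVn zl invr1.
split=> //; have : xmon a * (z^-1 *: xmon (- a)) * xmon a = xmon a by rewrite u1 mul1r.
rewrite -mulrA -!scalerAl zE' addNr xmon0 scalerA mulr_algr.
move=> /eqP; rewrite -[X in _ == X]scale1r -subr_eq0 -scalerBl scaler_eq0.
case/orP => [|/eqP a0]; first by rewrite subr_eq0 => /eqP ->; rewrite scale1r.
by have /eqP := oner_neq0 B; rewrite -u1 a0 mul0r.
Qed.

Lemma qtorus_monomial_group : monomial_group l monomial.
Proof.
split.
- by exists 0; rewrite xmon0; apply: eq_root_refl.
- move=> u v [a ua] [b vb]; exists (a + b).
  exact: eq_root_trans (eq_rootM ua vb) (xmonD a b).
- move=> u [a [z zl ->]]; have [b [c bc] [ab ba]] := xmon_inv a.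
  have z0 := root_neq0 l_gt0 zl.
  exists (z^-1 *: b).
    exists c; apply: eq_root_trans bc; exists z^-1 => //.
    by rewrite exprVn zl invr1.
  split; rewrite -scalerAl -scalerAr scalerA ?mulfV ?mulVf // scale1r //.
- move=> u v [a ua] [b vb]; apply: eq_root_trans (eq_rootM ua vb) _.
  apply: eq_root_trans (xmonD a b) _; apply: eq_root_sym => //; rewrite addrC.
  exact: eq_root_trans (eq_rootM vb ua) (xmonD b a).
- move=> b; pose S : {pred B} := fun b => `[< exists s : seq (F * B),
    (forall p, p \in s -> monomial p.2) /\ b = \sum_(p <- s) p.1 *: p.2 >].
  have SS : subalg_closed S.
    split=> [|c u v /asboolP[s [sU ->]] /asboolP[t [tU ->]]|
             u v /asboolP[s [sU ->]] /asboolP[t [tU ->]]]; apply/asboolP.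
    + exists [:: (1, 1)]; split; last by rewrite big_seq1 scale1r.
      move=> p; rewrite inE => /eqP ->; exists 0; rewrite xmon0; exact: eq_root_refl.
    + exists ([seq (c * p.1, p.2) | p <- s] ++ t); split.
        by move=> p; rewrite mem_cat => /orP[/mapP[p' /sU Up ->]|/tU].
      rewrite big_cat big_map scaler_sumr; congr (_ + _).
      by apply: eq_bigr => p _; rewrite scalerA.
    + exists [seq (p.1 * r.1, p.2 * r.2) | p <- s, r <- t]; split.
        move=> p /allpairsP[[p1 p2] [/sU [a pa] /tU [b' pb] ->]] /=.
        by exists (a + b'); apply: eq_root_trans (eq_rootM pa pb) (xmonD a b').
      rewrite big_allpairs_dep mulr_suml; apply: eq_bigr => p _.
      rewrite mulr_sumr; apply: eq_bigr => r _.
      by rewrite -scalerAl -scalerAr scalerA.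
  have /asboolP/(_ S SS) := qtorus_generated b.
  have xS y : (exists g, y = x g) -> y \in S.
    move=> [g ->]; apply/asboolP; exists [:: (1, x g)].
    split; last by rewrite big_seq1 scale1r.
    move=> p; rewrite inE => /eqP -> /=; have [a ->] := xmon_gen g.
    by exists a; apply: eq_root_refl.
  by move=> /(_ xS) /asboolP[s [sU bE]]; exists s.
Qed.

Lemma xmonX a m : xmon a ^+ m ~ xmon (a *+ m).
Proof.
elim: m => [|m IH]; first by rewrite expr0 mulr0n xmon0; apply: eq_root_refl.
rewrite exprSr mulrSr; apply: eq_root_trans (xmonD _ _).
exact: eq_rootM IH (eq_root_refl _ _).
Qed.

Lemma monomial_pow_mem b : monomial b ->
  b ^+ l \in gen_subalg (fun b => exists g, b = x g ^+ l).
Proof.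
move=> [a [z _ ->]]; rewrite exprZn rpredZ //; have [z' _ ->] := xmonX a l.
rewrite rpredZ // rpred_prod // => i _; rewrite ffunMnE.
have -> : xpow i (a i *+ l) = xpow i (a i) ^+ l.
  elim: (l) => [|m IH]; first by rewrite mulr0n /= expr0.
  by rewrite mulrSr xpowD IH exprSr.
have gen g : x g ^+ l \in gen_subalg (fun b => exists g, b = x g ^+ l).
  by apply/asboolP => S _ XS; apply: XS; exists g.
by case: (a i) => m /=; rewrite exprAC rpredX.
Qed.

Section Image.
Variables (P : algType F) (f : B -> P).
Hypotheses (fL : linear f) (fM : monoid_morphism f).
Hypothesis f_surj : forall p, exists b, p = f b.

Definition monomial_image p := exists2 b, monomial b & p = f b.

Lemma monomial_image_group : monomial_group l monomial_image.
Proof.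
have UP := qtorus_monomial_group; split.
- by exists 1; [exact: mg1 UP|rewrite fM.1].
- by move=> _ _ [u Uu ->] [v Uv ->]; exists (u * v); [exact: mgM UP _ _ _ _|rewrite fM.2].
- move=> _ [u Uu ->]; have [v Uv [uv vu]] := mgV UP Uu.
  exists (f v); first by exists v.
  by rewrite -!fM.2 uv vu fM.1.
- move=> _ _ [u Uu ->] [v Uv ->]; have [z zl zE] := mgC UP Uu Uv; exists z => //.
  by rewrite -!fM.2 zE (raw_linearZ fL).
- move=> p; have [b ->] := f_surj p; have [s sU ->] := mg_span UP b.
  exists [seq (r.1, f r.2) | r <- s].
    by move=> r /mapP[r' /sU Ur ->]; exists r'.2.
  rewrite big_map (raw_linear_sum fL); apply: eq_bigr => r _.
  by rewrite (raw_linearZ fL).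
Qed.

Hypothesis f_pow : forall b, monomial b -> exists c : F, f (b ^+ l) = c%:A.

Definition monomial_reps : seq P :=
  [seq f (xmon [ffun i => (r i : nat)%:Z]) | r : {ffun 'I_n -> 'I_l}].

Lemma monomial_reps_monomial p : p \in monomial_reps -> monomial_image p.
Proof.
move=> /imageP[r _ ->]; exists (xmon [ffun i => (r i : nat)%:Z]) => //.
by exists [ffun i => (r i : nat)%:Z]; apply: eq_root_refl.
Qed.

(** Divide the exponents by l: x^a is, up to a root of unity, x^r times the l-th power of x^c, and f
    sends the latter to a scalar. *)
Lemma monomial_reps_cover p : monomial_image p ->
  exists c y, y \in monomial_reps /\ p = c *: y.
Proof.
move=> [b [a [z _ ->]] ->].
have lZ : (l%:Z != 0) by rewrite eqz_nat -lt0n.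
have modl (m : int) : (`|(m %% l)%Z| < l)%N.
  by rewrite -ltz_nat gez0_abs ?modz_ge0 // ltz_pmod // ltz_nat.
pose r := [ffun i => Ordinal (modl (a i))].
pose r' : ffunZ := [ffun i => (r i : nat)%:Z].
pose c : ffunZ := [ffun i => (a i %/ l)%Z].
have aE : a = r' + c *+ l.
  apply/ffunP => i; rewrite !ffunE ffunMnE !ffunE /= gez0_abs ?modz_ge0 //.
  by rewrite addrC -mulr_natr natz -divz_eq.
have [z1 z1l E1] := xmonD r' (c *+ l); have [z2 z2l E2] := xmonX c l.
have [|d dE] := f_pow (b := xmon c); first by exists c; apply: eq_root_refl.
exists (z * (z1^-1 * (z2^-1 * d))), (f (xmon r')); split; first exact: image_f.
have -> : xmon a = z1^-1 *: (xmon r' * (z2^-1 *: xmon c ^+ l)).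
  rewrite E2 scalerA mulVf ?(root_neq0 l_gt0) // scale1r E1 scalerA.
  by rewrite mulVf ?(root_neq0 l_gt0) // scale1r -aE.
rewrite !(raw_linearZ fL) fM.2 (raw_linearZ fL) dE.
by rewrite -!scalerAr mulr1 !scalerA !mulrA.
Qed.

End Image.

End QuantumTorus.

(** * Algebras of operators on function spaces *)

Section FunctionEndomorphisms.
Variables (F : fieldType) (T : Type) (t0 : T).

(** Linear operators on the functions T -> F. They are a target for the universal property of the
    quantum torus, in which independence of the monomials becomes visible. *)
Definition endo_axiom (f : (T -> F) -> T -> F) :=
  forall c g h t, f (fun t => c * g t + h t) t = c * f g t + f h t.

(* The parameter t0 only witnesses that the algebra is not zero. *)
Record endo (t : T) := Endo { endo_fun :> (T -> F) -> T -> F; endoP : endo_axiom endo_fun }.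
Local Notation E := (endo t0).

HB.instance Definition _ := gen_eqMixin E.
HB.instance Definition _ := gen_choiceMixin E.

Lemma endo_ext (f g : E) : (forall h t, f h t = g h t) -> f = g.
Proof.
case: f g => [f fP] [g gP] /= fg.
have fgE : f = g by apply/funext => h; apply/funext => t.
by case: _ / fgE gP {fg} => gP; congr Endo; apply: Prop_irrelevance.
Qed.

Lemma endo_eta (f : E) h h' t : (forall t, h t = h' t) -> f h t = f h' t.
Proof. by move=> hh; congr (f _ t); apply/funext. Qed.

Fact endo_zero_subproof : endo_axiom (fun _ _ => 0).
Proof. by move=> c g h t; rewrite mulr0 addr0. Qed.
Fact endo_opp_subproof (f : E) : endo_axiom (fun g t => - f g t).
Proof. by move=> c g h t; rewrite endoP opprD mulrN. Qed.
Fact endo_add_subproof (f f' : E) : endo_axiom (fun g t => f g t + f' g t).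
Proof. by move=> c g h t; rewrite !endoP mulrDr addrACA. Qed.
Fact endo_scale_subproof (a : F) (f : E) : endo_axiom (fun g t => a * f g t).
Proof. by move=> c g h t; rewrite endoP mulrDr mulrCA. Qed.
Fact endo_one_subproof : endo_axiom (fun g t => g t).
Proof. by []. Qed.
Fact endo_mul_subproof (f f' : E) : endo_axiom (fun g t => f (f' g) t).
Proof. by move=> c g h t; rewrite -endoP; apply: endo_eta => t'; rewrite endoP. Qed.

Definition endo_zero : E := Endo _ endo_zero_subproof.
Definition endo_opp f : E := Endo _ (endo_opp_subproof f).
Definition endo_add f f' : E := Endo _ (endo_add_subproof f f').
Definition endo_scale a f : E := Endo _ (endo_scale_subproof a f).
Definition endo_one : E := Endo _ endo_one_subproof.
Definition endo_mul f f' : E := Endo _ (endo_mul_subproof f f').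

Fact endo_addA : associative endo_add.
Proof. by move=> f g h; apply: endo_ext => u t /=; rewrite addrA. Qed.
Fact endo_addC : commutative endo_add.
Proof. by move=> f g; apply: endo_ext => u t /=; rewrite addrC. Qed.
Fact endo_add0 : left_id endo_zero endo_add.
Proof. by move=> f; apply: endo_ext => u t /=; rewrite add0r. Qed.
Fact endo_addN : left_inverse endo_zero endo_opp endo_add.
Proof. by move=> f; apply: endo_ext => u t /=; rewrite addNr. Qed.
HB.instance Definition _ := GRing.isZmodule.Build E
  endo_addA endo_addC endo_add0 endo_addN.

Fact endo_mulA : associative endo_mul.
Proof. by move=> f g h; apply: endo_ext. Qed.
Fact endo_mul1x : left_id endo_one endo_mul.
Proof. by move=> f; apply: endo_ext. Qed.
Fact endo_mulx1 : right_id endo_one endo_mul.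
Proof. by move=> f; apply: endo_ext. Qed.
Fact endo_mulDl : left_distributive endo_mul +%R.
Proof. by move=> f g h; apply: endo_ext. Qed.
Fact endo_mulDr : right_distributive endo_mul +%R.
Proof.
move=> f g h; apply: endo_ext => u t /=.
by rewrite -[X in X + _]mul1r -endoP; apply: endo_eta => t'; rewrite mul1r.
Qed.
Fact endo_one_neq0 : endo_one != 0 :> E.
Proof.
apply/eqP => /(congr1 (fun f : E => f (fun=> 1) t0)) /= /eqP.
by rewrite oner_eq0.
Qed.
HB.instance Definition _ := GRing.Zmodule_isNzRing.Build E
  endo_mulA endo_mul1x endo_mulx1 endo_mulDl endo_mulDr endo_one_neq0.

Fact endo_scaleA a b f : endo_scale a (endo_scale b f) = endo_scale (a * b) f.
Proof. by apply: endo_ext => u t /=; rewrite mulrA. Qed.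
Fact endo_scale1 : left_id 1 endo_scale.
Proof. by move=> f; apply: endo_ext => u t /=; rewrite mul1r. Qed.
Fact endo_scaleDr : right_distributive endo_scale +%R.
Proof. by move=> a f g; apply: endo_ext => u t /=; rewrite mulrDr. Qed.
Fact endo_scaleDl f : {morph endo_scale^~ f : a b / a + b}.
Proof. by move=> a b; apply: endo_ext => u t /=; rewrite mulrDl. Qed.
HB.instance Definition _ := GRing.Zmodule_isLmodule.Build F E
  endo_scaleA endo_scale1 endo_scaleDr endo_scaleDl.

Fact endo_scaleAl (a : F) (f g : E) : a *: (f * g) = (a *: f) * g.
Proof. by apply: endo_ext. Qed.
Fact endo_scaleAr (a : F) (f g : E) : a *: (f * g) = f * (a *: g).
Proof.
apply: endo_ext => u t /=.
have /= := endoP f a (g u) (fun=> 0) t.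
have -> : f (fun=> 0) t = 0.
  transitivity (-1 * f (fun=> 0) t + f (fun=> 0) t); last by rewrite mulN1r addNr.
  by rewrite -endoP; apply: endo_eta => t'; rewrite mulr0 addr0.
by rewrite addr0 => <-; apply: endo_eta => t'; rewrite addr0.
Qed.
HB.instance Definition _ := GRing.Lmodule_isLalgebra.Build F E endo_scaleAl.
HB.instance Definition _ := GRing.Lalgebra_isAlgebra.Build F E endo_scaleAr.

End FunctionEndomorphisms.

Lemma seq_max (T : eqType) (s : seq T) (phi : T -> int) : s != [::] ->
  exists2 a, a \in s & forall b, b \in s -> phi b <= phi a.
Proof.
elim: s => // a [|c s] IH _.
  by exists a; rewrite ?mem_head // => b; rewrite inE => /eqP ->.
have [//|a' a's a'P] := IH; have [le|lt] := leP (phi a') (phi a).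
  exists a; rewrite ?mem_head // => b; rewrite inE => /orP[/eqP -> //|/a'P].
  by move=> /le_trans; apply.
exists a'; first by rewrite inE a's orbT.
by move=> b; rewrite inE => /orP[/eqP ->|/a'P //]; apply: ltW.
Qed.

(* The functional is a |-> \sum_i a_i N^i for N not a root of any of the
   polynomials \sum_i (a_i - b_i) X^i. *)
Lemma separating_functional n (s : seq {ffun 'I_n -> int}) :
  exists phi : {ffun 'I_n -> int} -> int,
    (forall a b, phi (a + b) = phi a + phi b) /\ {in s &, injective phi}.
Proof.
pose psi (a : {ffun 'I_n -> int}) : {poly int} := \sum_(i < n) a i *: 'X^i.
have psiD a b : psi (a + b) = psi a + psi b.
  by rewrite /psi -big_split; apply: eq_bigr => i _; rewrite ffunE scalerDl.
have psi_coef a (i : 'I_n) : (psi a)`_i = a i.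
  rewrite coef_sum (bigD1 i) //= coefZ coefXn eqxx mulr1 big1 ?addr0 // => j ji.
  by rewrite coefZ coefXn eq_sym val_eqE (negPf ji) mulr0.
have psi_eq0 a : psi a = 0 -> a = 0.
  by move=> a0; apply/ffunP => i; rewrite -psi_coef a0 coef0 ffunE.
pose D := [seq p.1 - p.2 | p <- [seq (a, b) | a <- s, b <- s]].
pose P := \prod_(a <- D | a != 0) psi a.
have P0 : P != 0.
  rewrite prodf_seq_neq0; apply/allP => a _; apply/implyP => a0.
  by apply: contra a0 => /eqP/psi_eq0 ->.
have [N PN] : exists N : int, P.[N] != 0.
  (* A nonzero P has fewer than [size P] roots, so it does not vanish at all the integers below
     [size P]. *)
  apply: contrapT => no; pose rs := [seq i%:Z | i <- iota 0 (size P)].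
  have := @max_poly_roots _ P rs P0; rewrite size_map size_iota ltnn => H.
  suff: false by []; apply: H; last by rewrite map_inj_uniq ?iota_uniq // => i j [].
  apply/allP => N _; rewrite rootE; apply/negPn/negP => PN.
  by apply: no; exists N.
exists (fun a => (psi a).[N]); split=> [a b|a b sa sb ab].
  by rewrite psiD hornerD.
apply/eqP; rewrite -subr_eq0; apply: contraNT PN => ab0.
have abD : a - b \in D.
  apply/mapP; exists (a, b) => //; apply/allpairsP; exists (a, b); split=> //.
rewrite /P (big_rem _ abD) /= ab0 hornerM.
have -> : (psi (a - b)).[N] = 0; last by rewrite mul0r.
apply: (addIr (psi b).[N]); rewrite -hornerD -psiD subrK add0r; exact: ab.
Qed.

(** * Units of the quantum torus *)

Section QuantumTorusUnits.
Variables (F : fieldType) (n l : nat) (q : 'M[F]_n) (B : algType F).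
Variable x : 'I_n + 'I_n -> B.
Hypothesis l_gt0 : (0 < l)%N.
Hypothesis ql : forall i j, q i j ^+ l = 1.
Hypothesis q_skew : forall i j, q i j * q j i = 1.
Hypothesis q_diag : forall i, q i i = 1.
Hypothesis xP : is_qtorus q x.

Local Notation ffunZ := {ffun 'I_n -> int}.
Local Notation E := (endo F (0 : ffunZ)).

Let q0 i j : q i j != 0.
Proof.
by apply/eqP => q0; have /eqP := q_skew i j; rewrite q0 mul0r eq_sym oner_eq0.
Qed.

Let ev (i : 'I_n) : ffunZ := [ffun j => if j == i then 1 else 0].

(** The scalar that arises when x_i, multiplied from the left to the ordered monomial of exponent m,
    passes the x_j with j < i. It does not depend on m_i. *)
Let kappa (i : 'I_n) (m : ffunZ) : F := \prod_(j < n | (j < i)%N) q i j ^ m j.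

Let kappa_neq0 i m : kappa i m != 0.
Proof. by apply/prodf_neq0 => j _; rewrite expfz_neq0. Qed.

Let kappaD i j m : kappa i (m + ev j) = kappa i m * (if (j < i)%N then q i j else 1).
Proof.
rewrite /kappa; under eq_bigr do rewrite !ffunE expfzDr //.
rewrite big_split /=; congr (_ * _).
rewrite (eq_bigr (fun j' => if j' == j then q i j' else 1)); last first.
  by move=> j' _; case: eqP.
rewrite -big_mkcondr /=; case: ifP => ji.
  rewrite (bigD1 j) ?eqxx ?ji //= big1 ?mulr1 // => j' /andP[/andP[_ /eqP ->]].
  by rewrite eqxx.
by rewrite big1 // => j' /andP[j'i /eqP j'j]; rewrite -j'j j'i in ji.
Qed.

Let shift_axiom (k : ffunZ -> F) (a : ffunZ) :
  endo_axiom (fun g m => k m * g (m - a)).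
Proof. by move=> c g h m; rewrite mulrDr mulrCA. Qed.
Let shift k a : E := Endo _ (shift_axiom k a).

(* The x_i act on the functions on Z^n as in the left regular representation. *)
Let model (g : 'I_n + 'I_n) : E :=
  match g with
  | inl i => shift (kappa i) (ev i)
  | inr i => shift (fun m => (kappa i (m + ev i))^-1) (- ev i)
  end.

Let model_rel : qtorus_rel q model.
Proof.
split=> [i|i j].
  split; apply: endo_ext => g m /=.
    by rewrite subrK mulrA mulfV // mul1r opprK subrK.
  by rewrite opprK mulrA mulVf // mul1r addrK.
apply: endo_ext => g m /=; rewrite !mulrA -addrA [- _ - _]addrC addrA.
congr (_ * _).
have E1 : kappa j (m - ev i) * (if (i < j)%N then q j i else 1) = kappa j m.
  by rewrite -kappaD subrK.
have E2 : kappa i (m - ev j) * (if (j < i)%N then q i j else 1) = kappa i m.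
  by rewrite -kappaD subrK.
rewrite -E1 -E2; case: (ltngtP i j) => ij; rewrite ?mulr1.
- by rewrite mulrCA q_skew mulr1 mulrC.
- by rewrite mulrAC mulrC mulrA mulrAC.
- by rewrite (val_inj ij) q_diag mul1r mulrC.
Qed.

Let rep_ex : exists f : {lrmorphism B -> E}, forall g, f (x g) = model g.
Proof. by have [_ /(_ _ _ model_rel)[f [fE _]]] := xP; exists f. Qed.
Let rep := projT1 (cid rep_ex).
Let repE g : rep (x g) = model g. Proof. exact: (projT2 (cid rep_ex)). Qed.

(** Weighted shifts by a whose weights never vanish. They are stable under products, and they map
    the delta function at 0 to a function with support exactly a. *)
Let homog (a : ffunZ) (f : E) := exists2 k : ffunZ -> F,
  forall m, k m != 0 & forall g m, f g m = k m * g (m - a).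

Let homog1 : homog 0 1.
Proof. by exists (fun=> 1) => [m|g m] /=; rewrite ?oner_neq0 // mul1r subr0. Qed.
Let homogM a a' f f' : homog a f -> homog a' f' -> homog (a + a') (f * f').
Proof.
move=> [k k0 fE] [k' k'0 fE']; exists (fun m => k m * k' (m - a)).
  by move=> m; rewrite mulf_neq0.
by move=> g m /=; rewrite fE fE' opprD addrA mulrA.
Qed.
Let homogX a f m : homog a f -> homog (a *+ m) (f ^+ m).
Proof.
move=> af; elim: m => [|m IH]; first by rewrite mulr0n expr0; apply: homog1.
by rewrite mulrS exprS; apply: homogM.
Qed.

Let homog_xmon a : homog a (rep (xmon x a)).
Proof.
have homog_pow i z : homog (ev i *~ z) (rep (xpow x i z)).
  case: z => m; rewrite /xpow rmorphXn /= repE.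
    by apply: homogX; exists (kappa i).
  rewrite NegzE mulrNz -pmulrn -mulNrn; apply: homogX.
  by exists (fun m => (kappa i (m + ev i))^-1) => // m'; rewrite invr_neq0.
have ffunMz (u : ffunZ) z j : (u *~ z) j = u j *~ z.
  case: z => m; first by rewrite -!pmulrn ffunMnE.
  by rewrite NegzE !mulrNz -!pmulrn ffunE ffunMnE.
have aE : a = \sum_(i < n) ev i *~ a i.
  apply/ffunP => j; rewrite sum_ffunE (bigD1 j) //= big1 => [|i ij].
    by rewrite ffunMz ffunE eqxx addr0 intz.
  by rewrite ffunMz ffunE eq_sym (negPf ij) mul0rz.
rewrite [X in homog X _]aE /xmon rmorph_prod.
by apply: (big_ind2 homog) => // a1 f1 a2 f2; apply: homogM.
Qed.

(** Up to a nonzero factor depending on m only, this is the coefficient of x^m in b. *)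
Let coef (b : B) (m : ffunZ) : F := rep b (fun m' => (m' == 0)%:R) m.

Let coefD b b' m : coef (b + b') m = coef b m + coef b' m.
Proof. by rewrite /coef rmorphD. Qed.
Let coefZ c b m : coef (c *: b) m = c * coef b m.
Proof. by rewrite /coef linearZ. Qed.
Let coef_sum (I : Type) (r : seq I) (G : I -> B) m :
  coef (\sum_(i <- r) G i) m = \sum_(i <- r) coef (G i) m.
Proof.
apply: (big_morph (coef^~ m)) => [b b'|]; first exact: coefD.
by rewrite /coef rmorph0.
Qed.
Let coef_xmon a m : m != a -> coef (xmon x a) m = 0.
Proof.
move=> ma; have [k _ kE] := homog_xmon a; rewrite /coef kE.
by rewrite subr_eq0 (negPf ma) mulr0.
Qed.
Let coef_xmon_neq0 a : coef (xmon x a) a != 0.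
Proof.
by have [k k0 kE] := homog_xmon a; rewrite /coef kE subrr eqxx mulr1.
Qed.

Let xmon_expand (b : B) : exists (s : seq ffunZ) (c : ffunZ -> F),
  [/\ uniq s, forall a, a \in s -> c a != 0 & b = \sum_(a <- s) c a *: xmon x a].
Proof.
have [t [_ bE]] : exists t : seq (F * ffunZ), True /\ b = \sum_(p <- t) p.1 *: xmon x p.2.
  have [s sU bE] := mg_span (qtorus_monomial_group l_gt0 ql xP) b.
  rewrite bE {bE b}; elim: s sU => [|p s IH] sU.
    by exists [::]; rewrite !big_nil.
  have [|t [_ tE]] := IH; first by move=> p' p's; apply: sU; rewrite inE p's orbT.
  have [a [z _ pE]] := sU p (mem_head _ _).
  by exists ((p.1 * z, a) :: t); rewrite !big_cons tE pE scalerA.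
pose u := undup [seq p.2 | p <- t].
pose c a := \sum_(p <- t) (p.2 == a)%:R * p.1.
exists [seq a <- u | c a != 0], c; split.
- by rewrite filter_uniq // undup_uniq.
- by move=> a; rewrite mem_filter => /andP[].
rewrite big_filter big_rmcond => [|a]; last by rewrite negbK => /eqP ->; rewrite scale0r.
rewrite bE; under [RHS]eq_bigr do rewrite scaler_suml.
rewrite exchange_big; apply: eq_big_seq => p pt /=.
have pu : p.2 \in u by rewrite mem_undup map_f.
rewrite (bigD1_seq p.2) ?undup_uniq //= eqxx mul1r big1 ?addr0 // => a ap.
by rewrite eq_sym (negPf ap) mul0r scale0r.
Qed.

(** Order the exponents by an additive phi, injective on those of y and y'. Only the product of the
    leading terms, of exponents a and b, contributes to the coefficient of y y' at a + b; as y y' =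
    1, this forces a + b = 0. The same holds for the lowest terms. *)
Lemma qtorus_unit y y' : y * y' = 1 -> exists c u, monomial l x u /\ y = c *: u.
Proof.
move=> yy'; have [s [al [us al0 yE]]] := xmon_expand y.
have [s' [be [us' be0 yE']]] := xmon_expand y'.
have coef1 m : m != 0 -> coef 1 m = 0 by rewrite -(xmon0 x); apply: coef_xmon.
have one0 : (1 : B) <> 0 by apply/eqP/oner_neq0.
have s0 : s != [::].
  by apply/eqP => s0; apply: one0; rewrite -yy' yE s0 big_nil mul0r.
have s0' : s' != [::].
  by apply/eqP => s0'; apply: one0; rewrite -yy' yE' s0' big_nil mulr0.
have extremal (phi : ffunZ -> int) :
    (forall a b, phi (a + b) = phi a + phi b) -> {in s ++ s' &, injective phi} ->
    exists a b, [/\ a \in s, b \in s', phi a + phi b = 0,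
      forall a', a' \in s -> phi a' <= phi a & forall b', b' \in s' -> phi b' <= phi b].
  move=> phiD phiI; have [a sa aP] := seq_max phi s0; have [b sb bP] := seq_max phi s0'.
  exists a, b; split=> //.
  suff ab0 : a + b = 0.
    rewrite -phiD ab0; apply: (addrI (phi 0)); by rewrite -phiD !addr0.
  apply/eqP; apply: contraT => /coef1; rewrite -yy' yE yE'.
  rewrite mulr_suml coef_sum (bigD1_seq a) //= [X in _ + X]big1_seq ?addr0; last first.
    move=> a' /andP[a'a sa']; rewrite mulr_sumr coef_sum big1_seq // => b' /andP[_ sb'].
    rewrite -scalerAl -scalerAr; have [z zl ->] := xmonD l_gt0 ql xP a' b'.
    rewrite !coefZ coef_xmon ?mulr0 //; apply: contra a'a => /eqP ab.
    have /eqP := congr1 phi ab; rewrite !phiD => /eqP phiab.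
    apply/eqP/phiI; rewrite ?mem_cat ?sa ?sa' //.
    apply: le_anti; rewrite aP //=.
    by rewrite -(lerD2r (phi b)) phiab lerD2l bP.
  rewrite mulr_sumr coef_sum (bigD1_seq b) //= [X in _ + X]big1_seq ?addr0; last first.
    move=> b' /andP[b'b sb'].
    rewrite -scalerAl -scalerAr; have [z zl ->] := xmonD l_gt0 ql xP a b'.
    rewrite !coefZ coef_xmon ?mulr0 //; apply: contra b'b => /eqP ab.
    by apply/eqP; apply: (addrI a); rewrite ab.
  rewrite -scalerAl -scalerAr; have [z zl ->] := xmonD l_gt0 ql xP a b.
  rewrite !coefZ => /eqP; rewrite !mulf_eq0 (negPf (al0 _ sa)) (negPf (be0 _ sb)).
  by rewrite (negPf (root_neq0 l_gt0 zl)) (negPf (coef_xmon_neq0 _)).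
have [phi [phiD phiI]] := separating_functional (s ++ s').
have [a [b [sa sb ab aP bP]]] := extremal phi phiD phiI.
have [||a' [b' [sa' sb' ab' aP' bP']]] := extremal (fun a => - phi a).
- by move=> c d; rewrite phiD opprD.
- by move=> c d cs ds /oppr_inj; apply: phiI.
(* The maximum of phi on the support of y is minus its maximum on that of y', and likewise for
   minima; so the maximum for y is at most the minimum. *)
have aa' : phi a <= phi a'.
  have -> : phi a = - phi b by apply/eqP; rewrite -addr_eq0 ab.
  have -> : phi a' = - phi b'.
    by apply/eqP; rewrite -addr_eq0 -oppr_eq0 opprD ab'.
  by rewrite lerN2 bP.
exists (\sum_(c <- s) al c), (xmon x a); split.
  by exists a; apply: eq_root_refl.
rewrite {1}yE scaler_suml; apply: eq_big_seq => c cs; congr (_ *: xmon x _).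
apply: phiI; rewrite ?mem_cat ?cs ?sa //; apply: le_anti; rewrite aP //=.
by apply: le_trans aa' _; rewrite -lerN2 aP'.
Qed.

End QuantumTorusUnits.

(** * Galois descent *)

Section SemilinearAction.
Variables (k : fieldType) (L : splittingFieldType k) (A : algType k) (B : algType L).
Variable inc : A -> B.
Hypothesis incM : monoid_morphism inc.
Hypothesis incL : semilinear_over inc.
Hypothesis incP : bijective (extmap inc).

Lemma tmap_gal_bilin (g : gal_of {:L}) :
  bilin (fun (a : A) (c : L) => id a ⊗ g c).
Proof.
split=> [a|c] d x y /=; first by rewrite linearP pureDr pureZr.
by rewrite pureDl pureZl.
Qed.

(* The action of g on B = A ⊗_k L through the second factor. *)
Lemma gal_act_ex (g : gal_of {:L}) (b : B) : exists b' : B,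
  forall s : seq (L * A), b = \sum_(p <- s) p.1 *: inc p.2 ->
    b' = \sum_(p <- s) g p.1 *: inc p.2.
Proof.
have [h hK Kh] := incP; exists (extmap inc (tmap id g (h b))) => s bE.
have -> : h b = \sum_(p <- s) p.2 ⊗ p.1.
  rewrite -[RHS]hK; congr h; rewrite bE (extmap_sum incL); apply: eq_bigr => p _.
  by rewrite (extmap_pure incL).
rewrite /tmap (tlift_sum _ _ (tmap_gal_bilin g)) (extmap_sum incL).
by apply: eq_bigr => p _; rewrite tlift_pure ?(extmap_pure incL) //; apply: tmap_gal_bilin.
Qed.

Definition gal_act g b := sval (cid (gal_act_ex g b)).

Lemma gal_act_sum g (s : seq (L * A)) :
  gal_act g (\sum_(p <- s) p.1 *: inc p.2) = \sum_(p <- s) g p.1 *: inc p.2.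
Proof. by rewrite /gal_act; case: cid => b' /= b'E; apply: b'E. Qed.

Lemma gal_act_inc g a : gal_act g (inc a) = inc a.
Proof.
have := gal_act_sum g [:: (1, a)]; rewrite !big_seq1 /= scale1r => ->.
by rewrite rmorph1 scale1r.
Qed.

Lemma gal_actD g b b' : gal_act g (b + b') = gal_act g b + gal_act g b'.
Proof.
have [s ->] := base_change_span incL incP b.
have [t ->] := base_change_span incL incP b'.
by rewrite -big_cat !gal_act_sum big_cat.
Qed.

Lemma gal_act0 g : gal_act g 0 = 0.
Proof. by apply: (addrI (gal_act g 0)); rewrite -gal_actD !addr0. Qed.

Lemma gal_actZ g c b : gal_act g (c *: b) = g c *: gal_act g b.
Proof.
have [s ->] := base_change_span incL incP b.
have -> : c *: (\sum_(p <- s) p.1 *: inc p.2)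
    = \sum_(p <- [seq (c * p.1, p.2) | p <- s]) p.1 *: inc p.2.
  by rewrite big_map scaler_sumr; apply: eq_bigr => p _; rewrite scalerA.
rewrite !gal_act_sum big_map scaler_sumr; apply: eq_bigr => p _.
by rewrite scalerA rmorphM.
Qed.

Lemma gal_act_bigsum g (I : Type) (r : seq I) (G : I -> B) :
  gal_act g (\sum_(i <- r) G i) = \sum_(i <- r) gal_act g (G i).
Proof. by apply: (big_morph (gal_act g)) => [x y|]; [apply: gal_actD|apply: gal_act0]. Qed.

Lemma gal_actM g b b' : gal_act g (b * b') = gal_act g b * gal_act g b'.
Proof.
have [s ->] := base_change_span incL incP b.
have [t ->] := base_change_span incL incP b'.
rewrite mulr_suml !gal_act_bigsum mulr_suml; apply: eq_bigr => p _.
rewrite mulr_sumr gal_act_bigsum mulr_sumr; apply: eq_bigr => q _.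
rewrite -scalerAl -scalerAr -incM.2 !gal_actZ !gal_act_inc incM.2.
by rewrite -scalerAl -scalerAr.
Qed.

Lemma gal_act1 g : gal_act g 1 = 1.
Proof. by rewrite -incM.1 gal_act_inc. Qed.

Lemma gal_actX g b m : gal_act g (b ^+ m) = gal_act g b ^+ m.
Proof.
elim: m => [|m IH]; first by rewrite !expr0 gal_act1.
by rewrite !exprS gal_actM IH.
Qed.

Hypothesis galL : galois 1 {:L}.

(* In a shortest sum \sum_i c_i a_i with c_0 = 1, either all the c_i lie in k or
   b - g b is a shorter sum for some g. *)
Lemma galois_descent (W : B -> Prop) :
  (forall c b b', W b -> W b' -> W (c *: b + b')) ->
  (forall g b, g \in 'Gal({:L} / 1)%g -> W b -> W (gal_act g b)) ->
  forall b, W b ->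
  exists2 s : seq (L * A), (forall p, p \in s -> W (inc p.2))
                         & b = \sum_(p <- s) p.1 *: inc p.2.
Proof.
move=> WL Wact b; have [s bE] := base_change_span incL incP b; rewrite {b}bE.
have [N] := ubnP (size s); elim: N s => // N IH [|p t] sN Ws.
  by exists [::]; rewrite ?big_nil.
have W0 : W 0 by have := WL (-1) _ _ Ws Ws; rewrite scaleN1r addNr.
have WZ c b : W b -> W (c *: b) by move=> Wb; rewrite -[_ *: _]addr0; apply: WL.
have WB b b' : W b -> W b' -> W (b - b').
  by move=> Wb Wb'; rewrite addrC -scaleN1r; apply: WL.
have [p0|p0] := eqVneq p.1 0.
  rewrite big_cons p0 scale0r add0r; apply: IH => //.
  by move: Ws; rewrite big_cons p0 scale0r add0r.
pose b := inc p.2 + \sum_(r <- t) (p.1^-1 * r.1) *: inc r.2.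
have bE : \sum_(r <- p :: t) r.1 *: inc r.2 = p.1 *: b.
  rewrite big_cons scalerDr scaler_sumr; congr (_ + _); apply: eq_bigr => r _.
  by rewrite scalerA mulVKf.
have Wb : W b by rewrite -[b]scale1r -(mulVf p0) -scalerA -bE; apply: WZ.
have scaled c b' : (exists2 s : seq (L * A), (forall p, p \in s -> W (inc p.2))
        & b' = \sum_(p <- s) p.1 *: inc p.2) ->
    exists2 s : seq (L * A), (forall p, p \in s -> W (inc p.2))
        & c *: b' = \sum_(p <- s) p.1 *: inc p.2.
  move=> [s sW ->]; exists [seq (c * r.1, r.2) | r <- s].
    by move=> r /mapP[r' /sW Wr ->].
  by rewrite big_map scaler_sumr; apply: eq_bigr => r _; rewrite scalerA.
rewrite bE; apply: (scaled).
have [tk|/existsNP[r /not_implyP[rt rk]]] :=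
    pselect (forall r, r \in t -> exists c : k, p.1^-1 * r.1 = c%:A).
  have [a aE] : exists a, b = inc a.
    suff [a aE] : exists a, \sum_(r <- t) (p.1^-1 * r.1) *: inc r.2 = inc a.
      by exists (p.2 + a); rewrite (semilinD incL) /b aE.
    elim: (t) tk => [|r u IHu] uk; first by exists 0; rewrite big_nil (semilin0 incL).
    have [|a aE] := IHu; first by move=> r' r'u; apply: uk; rewrite inE r'u orbT.
    have [c cE] := uk r (mem_head _ _).
    by exists (c *: r.2 + a); rewrite big_cons cE incL aE.
  exists [:: (1, a)]; last by rewrite big_seq1 scale1r.
  by move=> r; rewrite inE => /eqP ->; rewrite -aE.
set d := p.1^-1 * r.1 in rk.
(* The fixed field is k, which does not contain d. *)
have [g gG gd] : exists2 g : gal_of {:L}, g \in 'Gal({:L} / 1)%g & g d != d.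
  apply: contrapT => no; apply: rk.
  have : d \in fixedField 'Gal({:L} / 1)%g.
    apply/fixedFieldP; first exact: memvf.
    move=> g gG; apply/eqP; apply: contraT => gd.
    by case: no; exists g.
  by rewrite (galois_fixedField galL) => /vlineP[c ->]; exists c.
have gd0 : g d - d != 0 by rewrite subr_eq0.
pose f1 (r : L * A) := g (p.1^-1 * r.1) - p.1^-1 * r.1.
pose t1 := [seq (f1 r, r.2) | r <- t].
have b1E : gal_act g b - b = \sum_(r <- t1) r.1 *: inc r.2.
  rewrite /b gal_actD gal_act_inc gal_act_bigsum opprD addrACA subrr add0r.
  rewrite -sumrB big_map; apply: eq_bigr => r' _.
  by rewrite gal_actZ gal_act_inc -scalerBl.
(* The leading coefficient 1 cancels in g b - b, while e is chosen to cancel the term of r in b - e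
   (g b - b). Both sums are shorter, and together they give b. *)
pose e := d / (g d - d).
pose f2 (r : L * A) := p.1^-1 * r.1 - e * f1 r.
pose t2 := (1, p.2) :: [seq (f2 r, r.2) | r <- rem r t].
have b2E : b - e *: (gal_act g b - b) = \sum_(r <- t2) r.1 *: inc r.2.
  rewrite b1E /b big_map scaler_sumr -addrA -sumrB big_cons scale1r; congr (_ + _).
  rewrite big_map (big_rem _ rt) /= scalerA -scalerBl -/d /f1 -/d.
  rewrite divfK // subrr scale0r add0r; apply: eq_bigr => r' _.
  by rewrite scalerA -scalerBl.
have Wb1 : W (gal_act g b - b) by apply: (WB) => //; apply: Wact.
have Wb2 : W (b - e *: (gal_act g b - b)) by apply: (WB) => //; apply: WZ.
have [||s1 s1W s1E] := IH t1.
- by rewrite size_map.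
- by rewrite -b1E.
have [||s2 s2W s2E] := IH t2.
- by rewrite /= size_map size_rem // prednK //; case: (t) rt.
- by rewrite -b2E.
have [|s3 s3W s3E] := scaled e (gal_act g b - b).
  by exists s1 => //; rewrite b1E.
exists (s2 ++ s3); last by rewrite big_cat /= -s2E -s3E -b2E subrK.
by move=> r'; rewrite mem_cat => /orP[/s2W|/s3W].
Qed.

End SemilinearAction.

(** * Quotients of quantum forms *)

Section QuantumForm.
Variables (k : fieldType) (L : splittingFieldType k).
Hypothesis galL : galois 1 {:L}.
Variables (n l : nat) (T : torus_split_by L n) (q : 'M[L]_n).
Hypothesis l_gt0 : (0 < l)%N.
Hypothesis ql : forall i j, q i j ^+ l = 1.
Hypothesis q_skew : forall i j, q i j * q j i = 1.
Hypothesis q_diag : forall i, q i i = 1.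
Variable A : quantum_form T q.

Local Notation B := (qf_algL A).
Local Notation x := (@qf_gen _ _ _ _ _ A).
Local Notation inc := (@qf_inc _ _ _ _ _ A).
Local Notation U := (monomial l x).
Local Notation lpow := (gen_subalg (fun b : B => exists g, b = x g ^+ l)).

Let incM : monoid_morphism inc := qf_incM A.
Let incL : semilinear_over inc := (qf_incP A).1.
Let incP : bijective (extmap inc) := (qf_incP A).2.
Let UP : monomial_group l U := qtorus_monomial_group l_gt0 ql (qf_genP A).

Lemma qf_inc_inj : injective inc.
Proof.
have [f fE] := functional_one L => a a' /(congr1 (slice incP f)).
by rewrite !(slice_inc incL) fE !scale1r.
Qed.

Lemma qf_inc_center a : (inc a \in @center _ _) = (a \in @center _ _).
Proof.
apply/idP/idP => [/centerP aC|/centerP aC]; apply/centerP => b.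
  by apply: qf_inc_inj; rewrite !incM.2 aC.
have [s ->] := base_change_span incL incP b.
rewrite mulr_sumr mulr_suml; apply: eq_bigr => p _.
by rewrite -scalerAl -scalerAr -!incM.2 aC.
Qed.

(** Slices of a central element are central, since slicing commutes with multiplication by A on
    either side. *)
Lemma qf_center_span b : b \in @center _ _ ->
  exists2 s : seq (L * qf_alg A), (forall p, p \in s -> p.2 \in @center _ _)
                                & b = \sum_(p <- s) p.1 *: inc p.2.
Proof.
move=> /centerP bC; have [d [e [f eL]]] := dual_basis L.
exists [seq (e i, slice incP (f i) b) | i <- index_enum 'I_d].
  move=> p /mapP[i _ ->]; apply/centerP => a /=.
  by rewrite -(slice_incr incM incL) -(slice_incl incM incL) bC.
by rewrite big_map -(slice_expand incL incP eL).
Qed.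

Lemma monomial_pow_center u : U u -> u ^+ l \in @center _ _.
Proof.
move=> Uu; apply: (mg_commute_center UP) => v Uv.
have [z zl uv] := mgC UP Uu Uv.
by rewrite (scale_commX _ uv) zl scale1r.
Qed.

Lemma gen_monomial g : U (x g).
Proof. by have [a ->] := xmon_gen x g; exists a; apply: eq_root_refl. Qed.

Lemma lpow_center b : b \in lpow -> b \in @center _ _.
Proof.
move=> /asboolP; apply=> [|_ [g ->]]; first exact: center_subalg.
exact/monomial_pow_center/gen_monomial.
Qed.

Lemma lpow_gal_act g b : b \in lpow -> gal_act incL incP g b \in lpow.
Proof.
move=> bl; pose S : {pred B} := fun b => gal_act incL incP g b \in lpow.
have SS : subalg_closed S.
  split=> [|c u v|u v]; rewrite /S unfold_in.
  - by rewrite (gal_act1 incM) rpred1.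
  - by move=> Su Sv; rewrite unfold_in gal_actD gal_actZ rpredD // rpredZ.
  - by move=> Su Sv; rewrite unfold_in (gal_actM incM) rpredM.
have /asboolP/(_ S SS) : b \in lpow by [].
apply=> _ [h ->]; rewrite /S unfold_in (gal_actX incM).
(* The second factor is the inverse generator; its last branch is never reached. *)
have xx' : x h * (if h is inl i then x (inr i) else if h is inr i then x (inl i) else 1) = 1.
  by have [[xV _] _] := qf_genP A; case: h => i; have [] := xV i.
have act_unit : gal_act incL incP g (x h) * gal_act incL incP g
    (if h is inl i then x (inr i) else if h is inr i then x (inl i) else 1) = 1.
  by rewrite -(gal_actM incM) xx' (gal_act1 incM).
have [c [u [Uu ->]]] := qtorus_unit l_gt0 ql q_skew q_diag (qf_genP A) act_unit.
by rewrite exprZn rpredZ // (monomial_pow_mem l_gt0 ql (qf_genP A)).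
Qed.

Lemma lpow_span b : b \in lpow ->
  exists2 s : seq (L * qf_alg A), (forall p, p \in s -> inc p.2 \in lpow)
                                & b = \sum_(p <- s) p.1 *: inc p.2.
Proof.
move=> bl; apply: (galois_descent (incP := incP) galL (W := fun b => b \in lpow)) => //.
- by move=> c u v ul vl; rewrite rpredD // rpredZ.
- by move=> g u _; apply: lpow_gal_act.
Qed.

(** Elements coming from A are of the form a ⊗ 1, hence Galois invariant. *)
Lemma lcenterE a : lcenter l a <-> inc a \in lpow.
Proof.
split=> [[_ [w <-]]|al]; first exact: valP.
split; last by exists (GenSubalg al).
move=> g _ t ta; have [h hK _] := incP.
have -> : t = a ⊗ 1.
  by rewrite -[t]hK -[RHS]hK ta (extmap_pure incL) scale1r.
rewrite /tmap tlift_pure; last exact: tmap_gal_bilin.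
by rewrite (extmap_pure incL) rmorph1 scale1r.
Qed.

Variable chi : {lrmorphism centerT (qf_alg A) -> k^o}.

Section Center.
Variable chiL : {linear centerT B -> L^o}.
Hypothesis chiL_ext : extends_chi chi chiL.

Let cinc (z : centerT (qf_alg A)) : centerT B :=
  CenterT (etrans (qf_inc_center (center_val z)) (valP z)).

Let chiL_cinc z : chiL (cinc z) = (chi z : k)%:A :> L.
Proof. exact: chiL_ext. Qed.

Let cinc_span w : exists s : seq (L * centerT (qf_alg A)),
  w = \sum_(p <- s) p.1 *: cinc p.2.
Proof.
have [s sC wE] := qf_center_span (valP w).
suff [s' s'E] : exists s' : seq (L * centerT (qf_alg A)),
    \sum_(p <- s) p.1 *: inc p.2 = \sum_(p <- s') p.1 *: val (cinc p.2).
  exists s'; apply: val_inj; rewrite wE s'E linear_sum.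
  by apply: eq_bigr => p _; rewrite linearZ.
elim: s sC {wE} => [|p s IH] sC; first by exists [::]; rewrite !big_nil.
have [|s' s'E] := IH; first by move=> r rs; apply: sC; rewrite inE rs orbT.
exists ((p.1, CenterT (sC _ (mem_head _ _))) :: s').
by rewrite !big_cons s'E.
Qed.

Let chiL_sum (s : seq (L * centerT (qf_alg A))) :
  chiL (\sum_(p <- s) p.1 *: cinc p.2) = \sum_(p <- s) p.1 * (chi p.2 : k)%:A :> L.
Proof. by rewrite linear_sum; apply: eq_bigr => p _; rewrite linearZ chiL_cinc. Qed.

Lemma chiL1 : chiL 1 = 1 :> L.
Proof.
have -> : (1 : centerT B) = cinc 1 by apply: val_inj; rewrite /= incM.1.
by rewrite chiL_cinc rmorph1 scale1r.
Qed.

(** The center of L_Q[M] is spanned over L by that of A_Q, where [chiL] agrees with the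
    multiplicative [chi]. *)
Lemma chiLM w w' : chiL (w * w') = chiL w * chiL w' :> L.
Proof.
have [s ->] := cinc_span w; have [t ->] := cinc_span w'.
rewrite mulr_suml linear_sum chiL_sum mulr_suml; apply: eq_bigr => p _.
rewrite mulr_sumr linear_sum chiL_sum mulr_sumr; apply: eq_bigr => r _.
rewrite -scalerAl -scalerAr.
have -> : cinc p.2 * cinc r.2 = cinc (p.2 * r.2).
  by apply: val_inj; rewrite /= incM.2.
rewrite !linearZ chiL_cinc rmorphM /=.
have -> (c d : k) : (c * d)%:A = c%:A * d%:A :> L by rewrite mulr_algl scalerA.
by rewrite [RHS]mulrACA; apply: mulrA.
Qed.

Lemma ker_chi_inc a : ker_chi chi a -> ker_chiL chiL (inc a).
Proof. by move=> [z <- z0]; exists (cinc z); rewrite // chiL_cinc z0 scale0r. Qed.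

(** If w is the sum of the c_i z_i and the c_i chi(z_i) add up to 0, then w is also the sum of the
    c_i (z_i - chi(z_i)). *)
Lemma ker_chiL_span b : ker_chiL chiL b ->
  exists2 s : seq (L * qf_alg A), (forall p, p \in s -> ker_chi chi p.2)
                                & b = \sum_(p <- s) p.1 *: inc p.2.
Proof.
move=> [w <- w0]; have [s wE] := cinc_span w; rewrite wE chiL_sum in w0.
exists [seq (p.1, center_val (p.2 - (chi p.2 : k)%:A)) | p <- s].
  move=> _ /mapP[p _ ->]; exists (p.2 - (chi p.2 : k)%:A) => //.
  by rewrite linearB linearZ /= rmorph1 -[_ *: 1]/(_ * 1) mulr1 subrr.
rewrite big_map wE -[center_val _]/(\val _) linear_sum.
transitivity (\sum_(p <- s) (p.1 *: inc (center_val p.2))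
   - (\sum_(p <- s) p.1 * (chi p.2 : k)%:A) *: (1 : B)).
  by rewrite w0 scale0r subr0; apply: eq_bigr => p _; rewrite linearZ.
rewrite scaler_suml -sumrB; apply: eq_bigr => p _.
rewrite (semilinB incL) scalerBr; congr (_ - _).
by rewrite (semilinZ incL) incM.1 scalerA.
Qed.

Lemma central_scalar u : u \in @center _ _ ->
  exists c : L, quo_pi (ker_chiL chiL) u = c *: (1 : quo (ker_chiL chiL)).
Proof.
move=> uC; pose w := CenterT uC; exists (chiL w).
transitivity (quo_pi (ker_chiL chiL) ((chiL w : L) *: 1)); last by rewrite quo_piZ.
apply/quo_eq; apply: gen_ideal_gen; exists (w - (chiL w : L)%:A) => //.
by rewrite linearB linearZ /= chiL1 -[_ *: 1]/(_ * 1) mulr1 subrr.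
Qed.

(** The ideal generated by the kernel K consists of sums of products z u with z in K and u a
    monomial. If 1 is such a sum, [monomial_split] rewrites it with every product z u central. Then
    z u lies in K if u is central; otherwise some v commutes with u only up to a scalar other than
    1, and z u = 0. So 1 lies in K, although [chiL] maps 1 to 1. *)
Lemma quo_chiL_neq0 : (1 : quo (ker_chiL chiL)) != 0.
Proof.
apply/eqP => one0.
have mem1 : 1 \in gen_ideal (ker_chiL chiL).
  by rewrite -[1]subr0; apply/quo_eq; rewrite quo_pi0.
pose K := ker_chiL chiL.
have K_center z : K z -> z \in @center _ _ by move=> [w <- _]; apply: valP.
have K0 : K 0 by exists 0; rewrite ?linear0.
have KD z z' : K z -> K z' -> K (z + z').
  by move=> [w <- w0] [w' <- w0']; exists (w + w'); rewrite // linearD w0 w0' addr0.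
have KZ c z : K z -> K (c *: z).
  by move=> [w <- w0]; exists (c *: w); rewrite // linearZ w0; apply: mulr0.
have KM z u : K z -> U u -> u \in @center _ _ -> K (z * u).
  by move=> [w <- w0] _ uC; exists (w * CenterT uC); rewrite // chiLM w0 mul0r.
pose I b := exists2 s : seq (B * B), (forall p, p \in s -> K p.1 /\ U p.2)
                                   & b = \sum_(p <- s) p.1 * p.2.
have I0 : I 0 by exists [::]; rewrite ?big_nil.
have ID b b' : I b -> I b' -> I (b + b').
  move=> [s sI ->] [t tI ->]; exists (s ++ t); last by rewrite big_cat.
  by move=> p; rewrite mem_cat => /orP[/sI|/tI].
have IZ c b : I b -> I (c *: b).
  move=> [s sI ->]; exists [seq (c *: p.1, p.2) | p <- s].
    by move=> _ /mapP[p /sI[Kp Up] ->]; split=> //; apply: KZ.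
  by rewrite big_map scaler_sumr; apply: eq_bigr => p _; rewrite scalerAl.
have IU b u : I b -> U u -> I (u * b) /\ I (b * u).
  move=> [s sI ->] Uu; split.
    exists [seq (p.1, u * p.2) | p <- s].
      by move=> _ /mapP[p /sI[Kp Up] ->]; split=> //; apply: (mgM UP).
    rewrite big_map mulr_sumr; apply: eq_big_seq => p /sI[/K_center/centerP pC _].
    by rewrite !mulrA pC.
  exists [seq (p.1, p.2 * u) | p <- s].
    by move=> _ /mapP[p /sI[Kp Up] ->]; split=> //; apply: (mgM UP).
  by rewrite big_map mulr_suml; apply: eq_bigr => p _; rewrite mulrA.
have Isum (s : seq (L * B)) (G : L * B -> B) :
    (forall p, p \in s -> I (G p)) -> I (\sum_(p <- s) G p).
  by move=> IG; rewrite big_seq; apply: (big_ind I).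
have II : two_sided_ideal I.
  split; first split=> //.
  - by move=> b b' Ib Ib'; rewrite -scaleN1r; apply: (ID) => //; apply: IZ.
  - move=> p b Ib; have [s sU ->] := mg_span UP p.
    rewrite mulr_suml; apply: Isum => r rs; rewrite -scalerAl; apply: IZ.
    by have [] := IU _ _ Ib (sU _ rs).
  - move=> b p Ib; have [s sU ->] := mg_span UP p.
    rewrite mulr_sumr; apply: Isum => r rs; rewrite -scalerAr; apply: IZ.
    by have [] := IU _ _ Ib (sU _ rs).
have /asboolP/(_ I II) := mem1.
case=> [z Kz|s sI oneE].
  exists [:: (z, 1)]; last by rewrite big_seq1 mulr1.
  by move=> p; rewrite inE => /eqP -> /=; split=> //; apply: mg1 UP.
have [|||s' s'P s'E] := monomial_split UP K_center KD KZ KM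
    (V := fun b => b \in @center _ _) _ _ sI.
- by move=> c b b' bC b'C; rewrite rpredD // rpredZ.
- by move=> u v b Uu uv vu /centerP bC; rewrite -bC -mulrA uv mulr1; apply/centerP.
- by rewrite -oneE rpred1.
have K1 : K 1.
  rewrite oneE s'E big_seq; apply: (big_ind K) => // p /s'P[Kp Up pC].
  have [pc|/existsNP[v /not_implyP[Uv pv]]] :=
      pselect (forall v, U v -> v * p.2 = p.2 * v).
    by apply: KM => //; apply: (mg_commute_center UP).
  suff -> : p.1 * p.2 = 0 by [].
  have [z _ zE] := mgC UP Uv Up.
  have z1 : z - 1 != 0.
    by apply/negP; rewrite subr_eq0 => /eqP z1; apply: pv; rewrite zE z1 scale1r.
  have [v' _ [vv' _]] := mgV UP Uv.
  have /centerP/(_ v) pvC := pC; have /centerP/(_ v) p1C := K_center _ Kp.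
  have : (z - 1) *: (p.1 * p.2 * v) = 0.
    rewrite scalerBl scale1r {2}pvC mulrA -p1C -!mulrA zE -scalerAr subrr //.
  move=> /eqP; rewrite scaler_eq0 (negPf z1) => /eqP pv0.
  by rewrite -[LHS]mulr1 -vv' mulrA pv0 mul0r.
have [w w1 w0] := K1; have : chiL w = 1.
  by rewrite -chiL1; congr (chiL _); apply: val_inj.
by move/eqP; rewrite w0 eq_sym oner_eq0.
Qed.

End Center.

Section LCenter.
Variable chilL : {linear lcenterL A l -> L^o}.
Hypothesis chilL_ext : extends_chi_l chi chilL.

Lemma chilL_inc (z : centerT (qf_alg A)) (w : lcenterL A l) :
  gen_val w = inc (center_val z) -> chilL w = (chi z : k)%:A :> L.
Proof.
move=> wz; apply: chilL_ext => //; apply/lcenterE; rewrite -wz; exact: valP.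
Qed.

Lemma chilL1 : chilL 1 = 1 :> L.
Proof.
by rewrite (chilL_inc (z := 1)) ?rmorph1 ?scale1r //= incM.1.
Qed.

Lemma ker_chi_l_inc a : ker_chi_l l chi a -> ker_chi_lL chilL (inc a).
Proof.
move=> [z <- [/lcenterE zl z0]]; exists (GenSubalg zl) => //.
by rewrite (chilL_inc (z := z)) // z0 scale0r.
Qed.

Lemma ker_chi_lL_span b : ker_chi_lL chilL b ->
  exists2 s : seq (L * qf_alg A), (forall p, p \in s -> ker_chi_l l chi p.2)
                                & b = \sum_(p <- s) p.1 *: inc p.2.
Proof.
move=> [w <- w0]; have [s sl wE] := lpow_span (valP w).
have [s' s'l s'E] : exists2 s' : seq (L * centerT (qf_alg A)),
    (forall p, p \in s' -> inc (center_val p.2) \in lpow)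
    & \sum_(p <- s) p.1 *: inc p.2 = \sum_(p <- s') p.1 *: inc (center_val p.2).
  elim: s sl {wE} => [|p s IH] sl; first by exists [::]; rewrite ?big_nil.
  have [|s' s'l s'E] := IH; first by move=> r rs; apply: sl; rewrite inE rs orbT.
  have pl := sl _ (mem_head _ _).
  have pC : p.2 \in @center _ _ by rewrite -qf_inc_center; apply: lpow_center.
  exists ((p.1, CenterT pC) :: s'); last by rewrite !big_cons s'E.
  by move=> r; rewrite inE => /orP[/eqP ->|/s'l].
(* [chilL] is evaluated term by term; generalizing w lets each step subtract one element of
   Z_Q^(l)[M]. *)
have sum0 : \sum_(p <- s') p.1 * (chi p.2 : k)%:A = 0 :> L.
  rewrite -[RHS]w0; rewrite s'E in wE.
  elim: s' s'l (w) wE {w0 s'E} => [|p s' IH] s'l w' w'E.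
    by rewrite (_ : w' = 0) ?linear0 ?big_nil //; apply: val_inj; rewrite w'E big_nil.
  pose wp : lcenterL A l := GenSubalg (s'l _ (mem_head _ _)).
  rewrite (_ : w' = p.1 *: wp + (w' - p.1 *: wp)); last by rewrite addrC subrK.
  rewrite linearD linearZ (chilL_inc (z := p.2) (w := wp)) // big_cons; congr (_ + _).
  apply: IH; first by move=> r rs; apply: (s'l); rewrite inE rs orbT.
  transitivity (\val w' - p.1 *: \val wp) => //.
  by rewrite w'E big_cons addrC addKr.
exists [seq (p.1, center_val (p.2 - (chi p.2 : k)%:A)) | p <- s'].
  move=> _ /mapP[p /s'l pl ->]; exists (p.2 - (chi p.2 : k)%:A) => //; split.
    apply/lcenterE; rewrite (semilinB incL) rpredB // (semilinZ incL) incM.1.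
    by rewrite rpredZ // rpred1.
  by rewrite linearB linearZ /= rmorph1 -[_ *: 1]/(_ * 1) mulr1 subrr.
rewrite big_map wE s'E.
transitivity (\sum_(p <- s') (p.1 *: inc (center_val p.2))
   - (\sum_(p <- s') p.1 * (chi p.2 : k)%:A) *: (1 : B)).
  by rewrite sum0 scale0r subr0.
rewrite scaler_suml -sumrB; apply: eq_bigr => p _.
rewrite (semilinB incL) scalerBr; congr (_ - _).
by rewrite (semilinZ incL) incM.1 scalerA.
Qed.

Lemma lpow_scalar b : b \in lpow ->
  exists c : L, quo_pi (ker_chi_lL chilL) b = c *: (1 : quo (ker_chi_lL chilL)).
Proof.
move=> bl; pose w : lcenterL A l := GenSubalg bl; exists (chilL w).
transitivity (quo_pi (ker_chi_lL chilL) ((chilL w : L) *: 1)); last by rewrite quo_piZ.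
apply/quo_eq; apply: gen_ideal_gen; exists (w - (chilL w : L)%:A) => //.
by rewrite linearB linearZ /= chilL1 -[_ *: 1]/(_ * 1) mulr1 subrr.
Qed.

End LCenter.

End QuantumForm.

Section QuotientMap.
Variables (R : comNzRingType) (C : algType R) (X : C -> Prop).
Variable nz : (1 : quo X) != 0.

Definition nzquo_pi (c : C) : nzquo nz := quo_pi X c.

Lemma nzquo_pi_linear : linear nzquo_pi.
Proof.
move=> c a b; rewrite /nzquo_pi quo_piD; congr (_ + _).
exact: quo_piZ.
Qed.

Lemma nzquo_pi_monoid : monoid_morphism nzquo_pi.
Proof. by split=> // a b; apply: quo_piM. Qed.

Lemma nzquo_pi_surj p : exists c, p = nzquo_pi c.
Proof. by exists (repr (p : quo X)); rewrite /nzquo_pi quo_repr. Qed.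

Lemma nzquo_piX c m : nzquo_pi (c ^+ m) = nzquo_pi c ^+ m.
Proof.
have [pi1 piM] := nzquo_pi_monoid.
by elim: m => [|m IH]; rewrite ?expr0 // !exprS piM IH.
Qed.

End QuotientMap.

Lemma semisimple_trivial (P : pzRingType) : (1 : P) = 0 -> semisimple P.
Proof.
move=> P0 I [I0 IB Il]; have all0 (a : P) : a = 0 by rewrite -[a]mul1r P0 mul0r.
exists I; split=> // a.
by exists 0, 0; split; rewrite ?addr0.
Qed.

Theorem proposition2
    (k : fieldType) (L : splittingFieldType k) (galL : galois 1 {:L})
    (n l : nat) (T : torus_split_by L n)
    (eps : L) (eps_prim : l.-primitive_root eps)
    (s : 'I_n -> 'I_n -> 'I_l) (q : 'M[L]_n)
    (qE : forall i j, q i j = eps ^+ s i j)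
    (q_skew : forall i j, q i j * q j i = 1) (q_diag : forall i, q i i = 1)
    (A : quantum_form T q)
    (chi : {lrmorphism centerT (qf_alg A) -> k^o})
    (chiL : {linear centerT (qf_algL A) -> L^o})
    (chiL_ext : extends_chi chi chiL)
    (chilL : {linear lcenterL A l -> L^o})
    (chilL_ext : extends_chi_l chi chilL) :
  let P := quo (ker_chi chi) in
  let Pl := quo (ker_chi_l l chi) in
  let PL := quo (ker_chiL chiL) in
  let PlL := quo (ker_chi_lL chilL) in
  [/\ semisimple Pl, semisimple PlL,
      central_simple (fun c : k => c *: (1 : P)),
      central_simple (fun c : L => c *: (1 : PL))
    & exists (D : algType L) (h : D -> PL),
        [/\ polycyclic D, alghom h & bijective h]] /\
  (exists2 psi : Pl -> PlL,
     (forall a, psi (quo_pi _ a) = quo_pi _ (qf_inc a)) &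
     monoid_morphism psi /\ base_change psi) /\
  (exists2 psi : P -> PL,
     (forall a, psi (quo_pi _ a) = quo_pi _ (qf_inc a)) &
     monoid_morphism psi /\ base_change psi).
Proof.
move=> P Pl PL PlL.
have l_gt0 : (0 < l)%N := prim_order_gt0 eps_prim.
have ql i j : q i j ^+ l = 1.
  by rewrite qE -exprM mulnC exprM (prim_expr_order eps_prim) expr1n.
have lL : l%:R != 0 :> L := prim_root_natf_neq0 eps_prim.
have incM := qf_incM A; have [incL incP] := qf_incP A.
have xP := qf_genP A; have UP := qtorus_monomial_group l_gt0 ql xP.
have [psil psilE [psilM [psilL psilP]]] := quo_base_change incM incL incP
  (ker_chi_l_inc chilL_ext)
  (ker_chi_lL_span galL l_gt0 ql q_skew q_diag chilL_ext).
have [psi psiE [psiM [psiL psiP]]] := quo_base_change incM incL incP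
  (ker_chi_inc chiL_ext) (ker_chiL_span chiL_ext).
have nz : (1 : PL) != 0 := quo_chiL_neq0 l_gt0 ql chiL_ext.
have nzP : (1 : P) != 0.
  apply: contraNneq nz => P0; apply/eqP; rewrite -psiM.1 P0.
  exact: (semilin0 psiL).
pose D : algType L := nzquo nz.
have pi_pow b : monomial l (@qf_gen _ _ _ _ _ A) b ->
    exists c : L, nzquo_pi nz (b ^+ l) = c%:A.
  move=> Ub; apply: (central_scalar chiL_ext).
  exact: (monomial_pow_center l_gt0 ql).
have DG := monomial_image_group l_gt0 ql xP (nzquo_pi_linear nz)
  (nzquo_pi_monoid nz) (@nzquo_pi_surj _ _ _ nz).
have Dcover := monomial_reps_cover l_gt0 ql xP (nzquo_pi_linear nz)
  (nzquo_pi_monoid nz) pi_pow.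
(* The commutator scalar of two monomials survives in the nonzero quotient, so a monomial with
   central image is already central in L_Q[M], where [chiL] makes it a scalar. *)
have Dcenter p : monomial_image l (@qf_gen _ _ _ _ _ A) (nzquo_pi nz) p ->
    p \in @center L D -> exists c : L, p = c%:A.
  move=> [u Uu ->] /centerP uC; apply: (central_scalar chiL_ext).
  apply: (mg_commute_center UP) => v Uv; have [z _ vu] := mgC UP Uv Uu.
  suff z1 : z = 1 by rewrite vu z1 scale1r.
  apply: (mg_scale_inj DG (u := nzquo_pi nz v) (v := nzquo_pi nz u)).
  - by exists v.
  - by exists u.
  - by rewrite -!(nzquo_pi_monoid nz).2 vu (raw_linearZ (nzquo_pi_linear nz)).
  - by rewrite scale1r uC.
have simplePL : central_simple (fun c : L => c *: (1 : D)).
  exact: mg_central_simple DG _ Dcover Dcenter.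
have semisimplePlL : semisimple PlL.
  have [P0|nzl] := eqVneq (1 : PlL) 0; first exact: semisimple_trivial.
  have pil_pow b : monomial l (@qf_gen _ _ _ _ _ A) b ->
      exists c : L, nzquo_pi nzl (b ^+ l) = c%:A.
    move=> Ub; apply: (lpow_scalar chilL_ext).
    exact: monomial_pow_mem l_gt0 ql xP _ Ub.
  apply: (@mg_semisimple L l (nzquo nzl) _ (monomial_image_group l_gt0 ql xP
    (nzquo_pi_linear nzl) (nzquo_pi_monoid nzl) (@nzquo_pi_surj _ _ _ nzl)) lL _ _
    (@monomial_reps_monomial _ _ _ _ _ _ _) (monomial_reps_cover l_gt0 ql xP
    (nzquo_pi_linear nzl) (nzquo_pi_monoid nzl) pil_pow)).
  move=> _ [u Uu ->]; have [c cE] := pil_pow _ Uu; exists c.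
  by rewrite -cE nzquo_piX.
split; [split|split].
- have [P0|nzPl] := eqVneq (1 : Pl) 0; first exact: semisimple_trivial.
  (* Slicing [psil 1] along a functional of value 1 at 1 returns 1, so 1 = 0 in [PlL] would give 1 =
     0 in [Pl]. *)
  have nzPlL : (1 : PlL) != 0.
    apply: contraNneq nzPl => P0; have [f fE] := functional_one L.
    have := sliceZ psilL psilP f 1 1; rewrite scale1r psilM.1 P0 (slice0 psilL) fE.
    by rewrite scale1r => <-.
  exact: (@semisimple_base_change k L (nzquo nzPl) (nzquo nzPlL) psil psilM
    psilL psilP).
- exact: semisimplePlL.
- exact: (@central_simple_base_change k L (nzquo nzP) (nzquo nz) psi psiM
    psiL psiP simplePL).
- exact: simplePL.
- exists D, (fun p : D => p : PL); split.
  + exact: (mg_polycyclic l_gt0 DG Dcover Dcenter).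
  + by split.
  + by exists id.
- by exists psil => //; split=> //; split.
- by exists psi => //; split=> //; split.
Qed.
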